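(* Let $I\subset\mathbb{R}$ be an interval, let $(\gamma,\boldsymbol{\nu}):I\to\mathbb{R}_1^2\times\Delta$ be a non-lightlike Legendre curve with $\gamma(u)=(x_1(u),x_2(u))$, $\boldsymbol{\nu}(u)=(a(u),b(u))$ and curvature $(l,\beta)$, let $\lambda\neq 0$ be a real constant, and let $$\boldsymbol{r}_1:I\times\mathbb{R}\to\mathbb{R}_1^3,\qquad \boldsymbol{r}_1(u,v)=(x_1(u)+\lambda v,\ x_2(u)\sin v,\ x_2(u)\cos v)$$ be the associated 1-type helicoidal surface. Let $(u_0,v_0)\in I\times\mathbb{R}$ be a singular point of $\boldsymbol{r}_1$ and assume that $x_2(u_0)=0$. Then the following hold. (1) If $\beta(u_0)=0$ and $a(u_0)=0$, then for any $v\in\mathbb{R}$, $\boldsymbol{r}_1$ is a $(3,5)$-cuspidal edge at $(u_0,v)$ if and only if $\beta'(u_0)l(u_0)\neq 0$. In this case ($\beta(u_0)=0$, $a(u_0)=0$), for any $v\in\mathbb{R}$, $\boldsymbol{r}_1$ is not a $(2,3)$-cuspidal edge, not a $(2,5)$-cuspidal edge and not a $(3,4)$-cuspidal edge at $(u_0,v)$. (2) If $\beta(u_0)=0$ and $a(u_0)\neq 0$, then for any $v\in\mathbb{R}$, $\boldsymbol{r}_1$ is a $(2,5)$-cuspidal edge at $(u_0,v)$ if and only if $\beta'(u_0)l(u_0)\neq 0$. In this case ($\beta(u_0)=0$, $a(u_0)\neq 0$), for any $v\in\mathbb{R}$, $\boldsymbol{r}_1$ is not a $(2,3)$-cuspidal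 edge, not a $(3,4)$-cuspidal edge and not a $(3,5)$-cuspidal edge at $(u_0,v)$. (3) If $\beta(u_0)\neq 0$ and $a(u_0)=0$, then for any $v\in\mathbb{R}$, $\boldsymbol{r}_1$ is a $(2,3)$-cuspidal edge at $(u_0,v)$ if and only if $l(u_0)\neq 0$, and $\boldsymbol{r}_1$ is a $(3,4)$-cuspidal edge at $(u_0,v)$ if and only if $l(u_0)=0$ and $l'(u_0)\neq 0$. In this case ($\beta(u_0)\neq 0$, $a(u_0)=0$), for any $v\in\mathbb{R}$, $\boldsymbol{r}_1$ is not a $(2,5)$-cuspidal edge and not a $(3,5)$-cuspidal edge at $(u_0,v)$.
   Context: All maps are of class $C^\infty$. $\mathbb{R}_1^3$ is $\mathbb{R}^3$ with the pseudo inner product $\langle \boldsymbol{x},\boldsymbol{y}\rangle=-x_1y_1+x_2y_2+x_3y_3$, and $\mathbb{R}_1^2$ is $\mathbb{R}^2$ with $\langle \boldsymbol{x},\boldsymbol{y}\rangle=-x_1y_1+x_2y_2$. Put $\Delta=\{\boldsymbol{x}\in\mathbb{R}_1^2:\langle\boldsymbol{x},\boldsymbol{x}\rangle=1\}\cup\{\boldsymbol{x}\in\mathbb{R}_1^2:\langle\boldsymbol{x},\boldsymbol{x}\rangle=-1\}$. A smooth map $(\gamma,\boldsymbol{\nu}):I\to\mathbb{R}_1^2\times\Delta$ is a non-lightlike Legendre curve if $\langle\gamma'(u),\boldsymbol{\nu}(u)\rangle=0$ for all $u\in I$. Write $\boldsymbol{\nu}=(a,b)$, $\delta=a^2(u)-b^2(u)\in\{1,-1\}$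 (constant on $I$), and $\boldsymbol{\mu}(u)=(b(u),a(u))$. The curvature of $(\gamma,\boldsymbol{\nu})$ is the pair $(l,\beta)$ with $l(u)=\delta\langle\boldsymbol{\nu}'(u),\boldsymbol{\mu}(u)\rangle$ and $\beta(u)=\delta\langle\gamma'(u),\boldsymbol{\mu}(u)\rangle$; equivalently $\boldsymbol{\nu}'=l\boldsymbol{\mu}$, $\boldsymbol{\mu}'=l\boldsymbol{\nu}$, $\gamma'=\beta\boldsymbol{\mu}$. A singular point of a surface $\boldsymbol{r}:I\times\mathbb{R}\to\mathbb{R}_1^3$ is a point at which $\boldsymbol{r}_u$ and $\boldsymbol{r}_v$ are linearly dependent. For $(i,j)\in\{(2,3),(2,5),(3,4),(3,5)\}$, a map is an $(i,j)$-cuspidal edge at a point $p$ of its two-dimensional domain if its germ at $p$ is $\mathcal{A}$-equivalent (i.e. equal up to germs of diffeomorphisms of source and target) to the germ at the origin of $(u,v)\mapsto(u,v^i,v^j)$. *)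

(* Defs.v *)
From HB Require Import structures.
From mathcomp Require Import all_boot all_order all_algebra.
From mathcomp Require Import all_classical all_reals all_analysis.

Set Implicit Arguments.
Unset Strict Implicit.
Unset Printing Implicit Defensive.

Import Order.TTheory GRing.Theory Num.Theory.
Import numFieldNormedType.Exports.

Local Open Scope ring_scope.
Local Open Scope classical_set_scope.

Section Smoothness.
Context {R : realType} {V W : normedModType R}.
Implicit Types (f : V -> W) (U : set V).

(* The set U is meant to be open and V finite-dimensional; then this is the
   usual class C^n, expressed through all iterated directional derivatives. *)
Fixpoint class_C (n : nat) U f : Prop :=
  match n with
  | 0 => forall x, U x -> {for x, continuous f}
  | m.+1 => (forall x, U x -> differentiable f x) /\
            (forall v : V, class_C m U ('D_v f))
  end.

Definition smooth_at f (x : V) : Prop :=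
  exists U : set V, [/\ open U, U x & forall n, class_C n U f].

(* For a set A that is not open, this says that f is C^oo on an open
   neighborhood of A. *)
Definition smooth_on (A : set V) f : Prop := forall x, A x -> smooth_at f x.

End Smoothness.

Section Germs.
Context {R : realType}.

(* phi and psi are representatives of mutually inverse germs of smooth maps
   (V, p) -> (W, q) and (W, q) -> (V, p). *)
Definition inverse_germs {V W : normedModType R} (p : V) (q : W)
    (phi : V -> W) (psi : W -> V) : Prop :=
  [/\ phi p = q /\ psi q = p,
      smooth_at phi p /\ smooth_at psi q,
      \forall x \near p, psi (phi x) = x &
      \forall y \near q, phi (psi y) = y].

Definition diffeo_germ {V W : normedModType R} (p : V) (q : W)
    (phi : V -> W) : Prop :=
  exists psi : W -> V, inverse_germs p q phi psi.

Definition A_equivalent {V1 W1 V2 W2 : normedModType R}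
    (f : V1 -> W1) (p : V1) (g : V2 -> W2) (q : V2) : Prop :=
  exists (phi : V1 -> V2) (Phi : W1 -> W2),
    [/\ diffeo_germ p q phi, diffeo_germ (f p) (g q) Phi &
        \forall x \near p, Phi (f x) = g (phi x)].

End Germs.

Section Surfaces.
Context {R : realType}.
Implicit Types (r : R * R -> R * R * R) (p : R * R).

Definition linearly_dependent {V : lmodType R} (x y : V) : Prop :=
  exists s t : R, (s, t) != (0, 0) /\ s *: x + t *: y = 0.

Definition partial_u r p : R * R * R := 'D_((1, 0) : R * R) r p.
Definition partial_v r p : R * R * R := 'D_((0, 1) : R * R) r p.

Definition singular_point r p : Prop :=
  linearly_dependent (partial_u r p) (partial_v r p).

Definition cuspidal_edge_model (i j : nat) : R * R -> R * R * R :=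
  fun p => (p.1, p.2 ^+ i, p.2 ^+ j).

Definition cuspidal_edge (i j : nat) r p : Prop :=
  A_equivalent r p (cuspidal_edge_model i j) ((0, 0) : R * R).

End Surfaces.

Section LegendreCurves.
Context {R : realType}.
Implicit Types (I : set R) (gamma nu : R -> R * R) (u : R).

Definition pseudo_inner (x y : R * R) : R := - x.1 * y.1 + x.2 * y.2.

Definition Delta : set (R * R) :=
  [set x | pseudo_inner x x = 1] `|` [set x | pseudo_inner x x = -1].

Definition nonlightlike_legendre I gamma nu : Prop :=
  [/\ smooth_on I (fun u => (gamma u, nu u)),
      forall u, I u -> Delta (nu u) &
      forall u, I u -> pseudo_inner (gamma^`() u) (nu u) = 0].

Definition delta nu u : R := (nu u).1 ^+ 2 - (nu u).2 ^+ 2.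

Definition mu nu u : R * R := ((nu u).2, (nu u).1).

Definition curvature_l nu u : R :=
  delta nu u * pseudo_inner (nu^`() u) (mu nu u).

Definition curvature_beta gamma nu u : R :=
  delta nu u * pseudo_inner (gamma^`() u) (mu nu u).

Definition helicoidal1 (lambda : R) gamma : R * R -> R * R * R :=
  fun p => ((gamma p.1).1 + lambda * p.2,
            (gamma p.1).2 * sin p.2,
            (gamma p.1).2 * cos p.2).

End LegendreCurves.

(* Main.v *)
Require Import Defs.
From HB Require Import structures.
From mathcomp Require Import all_boot all_order all_algebra.
From mathcomp Require Import all_classical all_reals all_analysis.
From mathcomp Require Import ring lra.
Import Order.TTheory GRing.Theory Num.Theory.
Import numFieldNormedType.Exports.
Local Open Scope ring_scope.
Local Open Scope classical_set_scope.

(** Near a point of the axis the helicoidal surface is a cylinder in disguise.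
    The first coordinate [x1 + lambda v] of the surface is a submersion because
    [lambda] is nonzero; taking it as a parameter and rotating the two other
    target coordinates by an angle that depends on it removes [v] altogether,
    and the surface becomes [(s, t) |-> (s, c t)] for the plane curve
    [c = (x2 cos theta, x2 sin theta)], [theta = (x1 - x1 u0) / lambda]
    ([helicoidal_cylinder]).  The models are cylinders over the monomial curves
    [(t^i, t^j)].  So everything is about a plane curve germ [c] at a point
    where [c] and its derivative vanish, the same one for all [v].

    The Frenet equations [x1' = beta b], [x2' = beta a], [a' = l b], [b' = l a]
    give the orders of vanishing of the two coordinates of [c].  If [beta] and
    [a] vanish, they are at least 3 and 5, both exact iff [beta' l <> 0].
    If only [beta] vanishes, they are at least 2 and 4, and the term of order 4
    is a multiple of the square of the first coordinate; after subtracting this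
    multiple the orders are at least 2 and 5, both exact iff [beta' l <> 0].
    If only [a] vanishes, they are 2 and 3 when [l <> 0], 3 and
    4 when [l = 0] and [l' <> 0], and at least 4 otherwise.

    Sufficiency is a normal form: a curve with exact orders (2, odd), (3, 4) or
    (3, 5) is equivalent to the monomial curve ([cusp2_normal_form],
    [cusp34_normal_form], [cusp35_normal_form]).  A reparametrization makes the
    first coordinate [t^i], and a linear change of the target plane removes the
    one coefficient (of [t^5], resp. [t^7]) whose exponent is a gap of the
    semigroup generated by [i] and [j].  What is left has the form
    [al (z) + Y be (z) + Y^2 ka (z)] with [z = t^i], [Y = t^j], and the map
    [(z, Y) |-> (z, al + Y be + Y^2 ka)] is a local diffeomorphism inverted by
    the quadratic formula.  The coefficients come from writing a smooth [f] as
    the sum of the [t^r A_r (t^i)], [r < i] ([decompose2], [decompose3]): the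
    lemma of Borel provides smooth [A_r] with the right Taylor series, and the
    flat remainder composed with the [i]-th root is smooth.

    Necessity rests on two invariants of a cylinder over a curve of order at
    least 2: the order of vanishing of the curve ([vanishing_invariant]) and the
    largest order of contact of the curve with a regular function of the plane
    ([contact_invariant]).  For the monomial curve [(t^i, t^j)] they are [i] and
    [j] ([model_contact]). *)

Set Implicit Arguments.
Unset Strict Implicit.
Unset Printing Implicit Defensive.

(** * Smooth maps between normed modules *)

Section ClassC.
Context {R : realType} {V W : normedModType R}.
Implicit Types (f g : V -> W) (U : set V).

Lemma near_eq_differentiable f g x :
  (\forall y \near x, f y = g y) -> differentiable f x -> differentiable g x.
Proof.
move=> fg df.
have fcts := diff_continuous df.
have fgx : f x = g x by exact: nbhs_singleton fg.
have gE : g \o shift x = cst (g x) + 'd f x +o_ 0 id.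
  apply/eqaddoP => e e0.
  have /eqaddoP/(_ e e0) := diff_locally df.
  have fg0 : \forall y \near (0 : V), f (y + x) = g (y + x).
    by move: fg; rewrite (near_shift 0) /= subr0.
  apply: filterS2 fg0 => y fgy.
  by rewrite !fctE /= fgx fgy.
have dg := diff_unique fcts gE.
by apply/diff_locallyP; rewrite dg.
Unshelve. all: by end_near. Qed.

Lemma open_eq_near f g U x : open U -> U x -> (forall y, U y -> f y = g y) ->
  \forall y \near x, f y = g y.
Proof.
by move=> Uo Ux fg; apply: filterS (open_nbhs_nbhs (conj Uo Ux)) => y /fg.
Qed.

(** Class C^oo on one fixed set.  The germ predicate [smooth_at] hides this set,
    but an argument that produces infinitely many functions at once needs all of
    them to be smooth on the same neighborhood. *)
Definition Cinf U f := forall n, class_C n U f.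

Lemma class_C_ext n U f g : open U -> (forall x, U x -> f x = g x) ->
  class_C n U f -> class_C n U g.
Proof.
move=> Uo; elim: n f g => [|n IH] f g fg /=.
  move=> fc x Ux; have fgx := open_eq_near Uo Ux fg.
  rewrite /prop_for /continuous_at -(fg x Ux).
  apply: cvg_trans (fc x Ux); exact: near_eq_cvg.
move=> [fd fD]; split.
  by move=> x Ux; apply: near_eq_differentiable (fd x Ux); exact: open_eq_near fg.
move=> v; apply: IH (fD v) => x Ux.
by apply: near_eq_derive; exact: open_eq_near fg.
Qed.

Lemma class_C_sub n U U' f : U' `<=` U -> class_C n U f -> class_C n U' f.
Proof.
move=> U'U; elim: n f => [|n IH] f /=; first by move=> fc x /U'U; exact: fc.
by move=> [fd fD]; split=> [x /U'U|v]; [exact: fd|exact: IH].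
Qed.

Lemma Cinf_ext U f g : open U -> (forall x, U x -> f x = g x) ->
  Cinf U f -> Cinf U g.
Proof. by move=> Uo fg fC n; apply: class_C_ext fg (fC n). Qed.

Lemma Cinf_sub U U' f : U' `<=` U -> Cinf U f -> Cinf U' f.
Proof. by move=> UU fC n; apply: class_C_sub UU (fC n). Qed.

Lemma Cinf_differentiable U f x : Cinf U f -> U x -> differentiable f x.
Proof. by move=> /(_ 1%N)[fd _] /fd. Qed.

Lemma Cinf_derive U f v : Cinf U f -> Cinf U ('D_v f).
Proof. by move=> fC n; have [_] := fC n.+1; exact. Qed.

(** Smoothness is coinductive: a family of differentiable functions stable under
    directional derivatives consists of smooth functions.  Products, chain rule,
    inverse functions and division by a power are all obtained by exhibiting
    such a family. *)
Lemma Cinf_coind U (P : (V -> W) -> Prop) : open U ->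
  (forall f, P f -> forall x, U x -> differentiable f x) ->
  (forall f v, P f -> exists2 g, P g & forall x, U x -> g x = 'D_v f x) ->
  forall f, P f -> Cinf U f.
Proof.
move=> Uo Pd PD f + n; elim: n f => [|n IH] f Pf /=.
  by move=> x Ux; apply: differentiable_continuous; exact: Pd.
split=> [x Ux|v]; first exact: Pd.
by have [g /IH gC gE] := PD f v Pf; apply: class_C_ext gC.
Qed.

Lemma smooth_at_differentiable f x : smooth_at f x -> differentiable f x.
Proof. by move=> [U [Uo Ux fC]]; apply: (Cinf_differentiable fC). Qed.

Lemma smooth_at_continuous f x : smooth_at f x -> {for x, continuous f}.
Proof. by move=> /smooth_at_differentiable/differentiable_continuous. Qed.

Lemma smooth_at_derive f x v : smooth_at f x -> smooth_at ('D_v f) x.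
Proof.
by move=> [U [Uo Ux fC]]; exists U; split => //; exact: Cinf_derive.
Qed.

Lemma smooth_near f x : smooth_at f x -> \forall y \near x, smooth_at f y.
Proof.
move=> [U [Uo Ux fC]]; apply: filterS (open_nbhs_nbhs (conj Uo Ux)) => y Uy.
by exists U.
Qed.

End ClassC.

Section Algebra.
Context {R : realType} {V : normedModType R}.
Implicit Types (f g : V -> R) (U : set V).

(** The closure of the products [f g] under sums, because the Leibniz rule
    turns one product into a sum of two. *)
Inductive prod_family U : (V -> R) -> Prop :=
| Prod_family f g : Cinf U f -> Cinf U g -> prod_family U (fun x => f x * g x)
| Prod_family_add f g : prod_family U f -> prod_family U g ->
    prod_family U (fun x => f x + g x).

Lemma prod_family_differentiable U f x : U x -> prod_family U f ->
  differentiable f x.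
Proof.
move=> Ux; elim=> {f} [f g fC gC|f g _ fd _ gd].
  by apply: differentiableM; apply: Cinf_differentiable Ux.
exact: differentiableD.
Qed.

Lemma CinfM U f g : open U -> Cinf U f -> Cinf U g ->
  Cinf U (fun x => f x * g x).
Proof.
move=> Uo fC gC.
apply: (Cinf_coind Uo (P := prod_family U)); last exact: Prod_family.
  by move=> h Ph x Ux; exact: prod_family_differentiable Ph.
move=> h v; elim=> {h f g fC gC} [f g fC gC|f g Pf [f' Pf' fE] Pg [g' Pg' gE]].
  exists (fun x => f x * 'D_v g x + g x * 'D_v f x).
    by apply: Prod_family_add; apply: Prod_family => //; exact: Cinf_derive.
  move=> x Ux; rewrite deriveM//; apply: diff_derivable;
    by apply: Cinf_differentiable Ux.
exists (fun x => f' x + g' x); first exact: Prod_family_add.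
move=> x Ux; rewrite fE// gE// deriveD//; apply: diff_derivable;
  by apply: prod_family_differentiable; first exact: Ux.
Qed.

End Algebra.

Lemma derive_comp (R : realType) (V W X : normedModType R) (f : V -> W)
    (g : W -> X) x v : differentiable f x -> differentiable g (f x) ->
  'D_v (fun x => g (f x)) x = 'D_('D_v f x) g (f x).
Proof.
move=> df dg; rewrite (deriveE _ (differentiable_comp df dg)).
by rewrite (diff_comp df dg) /= (deriveE _ dg) (deriveE _ df).
Qed.

Section Linear.
Context {R : realType} {V W : normedModType R}.
Implicit Types (U : set V).

Lemma CinfD U (f g : V -> W) : open U -> Cinf U f -> Cinf U g ->
  Cinf U (fun x => f x + g x).
Proof.
move=> Uo fC gC.
apply: (Cinf_coind Uo (P := fun h => exists f g,
    [/\ Cinf U f, Cinf U g & h = fun x => f x + g x])); last by exists f, g.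
  move=> _ {f g fC gC} [f [g [fC gC ->]]] x Ux; apply: differentiableD;
    by apply: Cinf_differentiable Ux.
move=> _ v {f g fC gC} [f [g [fC gC ->]]].
exists (fun x => 'D_v f x + 'D_v g x).
  by exists ('D_v f), ('D_v g); split => //; exact: Cinf_derive.
move=> x Ux; rewrite deriveD//; apply: diff_derivable;
    by apply: Cinf_differentiable Ux.
Qed.

Lemma Cinf_cst U (c : W) : open U -> Cinf U (fun=> c).
Proof.
move=> Uo; apply: (Cinf_coind Uo (P := fun h => exists c, h = fun=> c));
  last by exists c.
  by move=> _ [{}c ->] x _; exact: differentiable_cst.
by move=> _ v [{}c ->]; exists (fun=> 0); [exists 0|move=> x _; rewrite derive_cst].
Qed.

Lemma Cinf_linear U (f : {linear V -> W}) : open U -> continuous f -> Cinf U f.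
Proof.
move=> Uo fc n; case: n => [|n] /=; first by move=> x _; exact: fc.
split=> [x _|v]; first exact: linear_differentiable.
apply: (@class_C_ext _ _ _ _ _ (fun=> f v)) => //; last exact: Cinf_cst.
by move=> x _; rewrite deriveE ?diff_lin//; exact: linear_differentiable.
Qed.

Lemma Cinf_linear_comp (X : normedModType R) U (f : {linear W -> X}) (g : V -> W) :
  open U -> continuous f -> Cinf U g -> Cinf U (fun x => f (g x)).
Proof.
move=> Uo fc gC.
apply: (Cinf_coind Uo (P := fun h => exists2 g, Cinf U g & h = fun x => f (g x)));
  last by exists g.
  move=> _ {g gC} [g gC ->] x Ux; apply: differentiable_comp.
    exact: Cinf_differentiable Ux.
  exact: linear_differentiable.
move=> _ v {g gC} [g gC ->]; exists (fun x => f ('D_v g x)).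
  by exists ('D_v g) => //; exact: Cinf_derive.
move=> x Ux; have dg : differentiable g x by exact: Cinf_differentiable Ux.
have df y : differentiable f y by exact: linear_differentiable.
rewrite (derive_comp _ dg (df _)) [RHS](deriveE _ (df _)).
by rewrite (diff_lin _ fc).
Qed.

End Linear.

Section Frames.
Context {R : realType}.

(** A finite family of vectors with continuous coordinate forms.  Composition
    preserves the class C^n, defined by directional derivatives, only when the
    derivative in a varying direction is a finite combination of derivatives
    in fixed directions. *)
Definition finite_frame (W : normedModType R) := exists n (e : 'I_n -> W)
  (l : 'I_n -> {linear W -> R}),
  (forall i, continuous (l i)) /\ (forall w, w = \sum_i l i w *: e i).

Lemma finite_frame_field : finite_frame R.
Proof.
exists 1%N, (fun=> 1), (fun=> idfun); split; first by move=> i x; exact: cvg_id.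
by move=> w; rewrite big_ord1 /= [_ *: _]mulr1.
Qed.

Lemma finite_frame_prod (W1 W2 : normedModType R) :
  finite_frame W1 -> finite_frame W2 -> finite_frame (W1 * W2)%type.
Proof.
move=> [n1 [e1 [l1 [c1 E1]]]] [n2 [e2 [l2 [c2 E2]]]].
exists (n1 + n2)%N, (fun i : 'I_(n1 + n2) => match fintype.split i with
  inl i => (e1 i, 0) | inr i => (0, e2 i) end : (W1 * W2)%type).
exists (fun i : 'I_(n1 + n2) => match fintype.split i with
  inl i => (l1 i \o fst)%FUN : {linear (W1 * W2)%type -> R}
  | inr i => (l2 i \o snd)%FUN : {linear (W1 * W2)%type -> R} end).
split=> [i|w].
  case: fintype.split => j x.
    by apply: continuous_comp; [exact: cvg_fst|exact: c1].
  by apply: continuous_comp; [exact: cvg_snd|exact: c2].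
rewrite big_split_ord /=.
under eq_bigr => i _ do rewrite (unsplitK (inl i)) /=.
under [X in _ + X]eq_bigr => i _ do rewrite (unsplitK (inr i)) /=.
case: w => w1 w2 /=.
rewrite [in LHS](E1 w1) [in LHS](E2 w2).
rewrite (_ : (_, _) = (\sum_i l1 i w1 *: e1 i, 0) + (0, \sum_i l2 i w2 *: e2 i)).
  congr (_ + _).
    by elim/big_rec2: _ => // i a b _ <-; congr (_, _) => /=; rewrite scaler0 addr0.
  by elim/big_rec2: _ => // i a b _ <-; congr (_, _) => /=; rewrite scaler0 addr0.
by congr (_, _) => /=; rewrite ?addr0 ?add0r.
Qed.

End Frames.

(** * Composition of smooth maps *)

Section Composition.
Context {R : realType} {V W : normedModType R}.
Implicit Types (U : set V).

(** The smallest family that contains [g o f] and is stable under derivation: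
    the chain rule multiplies derivatives of [g], taken at [f x], by smooth
    scalar factors. *)
Inductive chain_family U (U' : set W) (f : V -> W) : (V -> R) -> Prop :=
| Chain_family (a : V -> R) (g : W -> R) : Cinf U a -> Cinf U' g ->
    chain_family U U' f (fun x => a x * g (f x))
| Chain_family0 : chain_family U U' f (fun=> 0)
| Chain_family_add h k : chain_family U U' f h -> chain_family U U' f k ->
    chain_family U U' f (fun x => h x + k x).

Lemma chain_family_sum U (U' : set W) (f : V -> W) n (h : 'I_n -> V -> R) :
  (forall i, chain_family U U' f (h i)) ->
  chain_family U U' f (fun x => \sum_i h i x).
Proof.
elim: n h => [|n IH] h hP.
  by under eq_fun do rewrite big_ord0; exact: Chain_family0.
by under eq_fun do rewrite big_ord_recl; apply: Chain_family_add => //; exact: IH.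
Qed.

Lemma chain_family_differentiable U (U' : set W) (f : V -> W) h x : Cinf U f ->
  (forall x, U x -> U' (f x)) -> U x -> chain_family U U' f h ->
  differentiable h x.
Proof.
move=> fC fU Ux; elim=> {h} [a g aC gC||h k _ hd _ kd].
- apply: differentiableM; first exact: Cinf_differentiable Ux.
  apply: differentiable_comp; first exact: Cinf_differentiable Ux.
  by apply: Cinf_differentiable gC _; exact: fU.
- exact: differentiable_cst.
- exact: differentiableD.
Qed.

Lemma derive_comp_frame n (e : 'I_n -> W) (l : 'I_n -> {linear W -> R})
  (X : normedModType R) (f : V -> W) (g : W -> X) x v :
  (forall w, w = \sum_i l i w *: e i) ->
  differentiable f x -> differentiable g (f x) ->
  'D_v (fun x => g (f x)) x = \sum_i l i ('D_v f x) *: 'D_(e i) g (f x).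
Proof.
move=> lE df dg; rewrite (derive_comp _ df dg) (deriveE _ dg).
rewrite [X in 'd g _ X = _]lE linear_sum.
by apply: eq_bigr => i _; rewrite linearZ /= -(deriveE _ dg).
Qed.

Lemma Cinf_comp_scalar U (U' : set W) (f : V -> W) (g : W -> R) : finite_frame W ->
  open U -> Cinf U f -> Cinf U' g -> (forall x, U x -> U' (f x)) ->
  Cinf U (fun x => g (f x)).
Proof.
move=> [n [e [l [lc lE]]]] Uo fC gC fU.
suff : Cinf U (fun x => cst 1 x * g (f x)).
  by apply: Cinf_ext => // x _; rewrite /= mul1r.
apply: (Cinf_coind Uo (P := chain_family U U' f)).
- by move=> h Ph x Ux; exact: chain_family_differentiable Ph.
- move=> h v; elim=> {h} [a k aC kC||h k Ph [h' Ph' hE] Pk [k' Pk' kE]].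
  + exists (fun x => 'D_v a x * k (f x) +
        \sum_i (a x * l i ('D_v f x)) * 'D_(e i) k (f x)).
      apply: Chain_family_add.
        by apply: Chain_family => //; exact: Cinf_derive.
      apply: chain_family_sum => i.
      apply: (@Chain_family U U' f (fun x => a x * l i ('D_v f x)) ('D_(e i) k));
        last exact: Cinf_derive.
      apply: CinfM => //; by apply: Cinf_linear_comp => //; exact: Cinf_derive.
    move=> x Ux.
    have fd : differentiable f x by exact: Cinf_differentiable Ux.
    have ad : differentiable a x by exact: Cinf_differentiable Ux.
    have kd : differentiable k (f x) by apply: Cinf_differentiable kC _; exact: fU.
    rewrite deriveM; [|exact: diff_derivable|]; last first.
      by apply: diff_derivable; exact: differentiable_comp.
    rewrite (derive_comp_frame _ lE)// addrC; congr (_ + _).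
      rewrite scaler_sumr; apply: eq_bigr => i _.
      by rewrite -mulrA.
    by rewrite [RHS]mulrC.
  + exists (fun=> 0); first exact: Chain_family0.
    by move=> x _; rewrite derive_cst.
  + exists (fun x => h' x + k' x); first exact: Chain_family_add.
    move=> x Ux; rewrite hE// kE// deriveD//; apply: diff_derivable;
      exact: (@chain_family_differentiable U U' f).
- by apply: Chain_family => //; exact: Cinf_cst.
Qed.

Lemma Cinf_sum (X : normedModType R) U n (F : 'I_n -> V -> X) : open U ->
  (forall i, Cinf U (F i)) -> Cinf U (fun x => \sum_i F i x).
Proof.
move=> Uo; elim: n F => [|n IH] F FC.
  by under eq_fun do rewrite big_ord0; exact: Cinf_cst.
by under eq_fun do rewrite big_ord_recl; apply: CinfD => //; exact: IH.
Qed.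

Lemma Cinf_comp (X : normedModType R) U (U' : set W) (f : V -> W) (g : W -> X) :
  finite_frame W -> finite_frame X ->
  open U -> Cinf U f -> Cinf U' g -> (forall x, U x -> U' (f x)) -> open U' ->
  Cinf U (fun x => g (f x)).
Proof.
move=> frW [n [e [l [lc lE]]]] Uo fC gC fU Uo'.
rewrite (_ : (fun x => _) = fun x => \sum_i (l i (g (f x)) *: e i)); last first.
  by apply/funext => x; exact: lE.
have : forall i, Cinf U (fun x => l i (g (f x)) *: e i).
  move=> i.
  have : Cinf U (fun x => l i (g (f x))).
    by apply: (@Cinf_comp_scalar U U' f (fun y => l i (g y))) => //; exact: Cinf_linear_comp.
  pose s := GRing.scale^~ (e i) : R -> X.
  have sl : linear s by move=> a x y; rewrite /s scalerDl scalerA.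
  pose sL : {linear R -> X} := HB.pack s (GRing.isLinear.Build _ _ _ _ _ sl).
  move=> hC; apply: (@Cinf_linear_comp R V R X U sL) => //.
  exact: scalel_continuous.
exact: (@Cinf_sum X U n (fun i x => l i (g (f x)) *: e i)).
Qed.

Lemma smooth_at_comp (X : normedModType R) (f : V -> W) (g : W -> X) x :
  finite_frame W -> finite_frame X -> smooth_at f x -> smooth_at g (f x) ->
  smooth_at (fun x => g (f x)) x.
Proof.
move=> frW frX fs [U' [Uo' U'fx gC]].
have fc := smooth_at_continuous fs; case: fs => U [Uo Ux fC].
have [A [[Ao Ax] AU]] : exists A, open_nbhs x A /\ (A `<=` [set y | U y /\ U' (f y)]).
  have : nbhs x [set y | U y /\ U' (f y)].
    apply: filterI; first by apply: open_nbhs_nbhs.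
    by apply: fc; apply: open_nbhs_nbhs.
  by rewrite nbhsE => -[A ? ?]; exists A.
exists A; split => //; apply: (@Cinf_comp X A U' f g) => //.
  by apply: Cinf_sub fC => y /AU[].
by move=> y /AU[].
Qed.

End Composition.

(** * Calculus of smooth germs *)

Section SmoothAt.
Context {R : realType} {V : normedModType R}.
#[local] Hint Resolve finite_frame_field finite_frame_prod : core.

Lemma smooth_atD (W : normedModType R) (f g : V -> W) x :
  smooth_at f x -> smooth_at g x -> smooth_at (fun x => f x + g x) x.
Proof.
move=> [A [Ao Ax fC]] [B [Bo Bx gC]]; exists (A `&` B); split=> //.
  exact: openI.
by apply: CinfD; [exact: openI| |];
  [apply: Cinf_sub fC; exact: subIsetl|apply: Cinf_sub gC; exact: subIsetr].
Qed.

Lemma smooth_atM (f g : V -> R) x :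
  smooth_at f x -> smooth_at g x -> smooth_at (fun x => f x * g x) x.
Proof.
move=> [A [Ao Ax fC]] [B [Bo Bx gC]]; exists (A `&` B); split=> //.
  exact: openI.
by apply: CinfM; [exact: openI| |];
  [apply: Cinf_sub fC; exact: subIsetl|apply: Cinf_sub gC; exact: subIsetr].
Qed.

Lemma smooth_at_cst (W : normedModType R) (c : W) x : smooth_at (fun _ : V => c) x.
Proof. by exists setT; split => //; [exact: openT|apply: Cinf_cst; exact: openT]. Qed.

Lemma smooth_at_linear (W : normedModType R) (f : {linear V -> W}) x :
  continuous f -> smooth_at f x.
Proof.
by move=> fc; exists setT; split => //; [exact: openT|apply: Cinf_linear => //; exact: openT].
Qed.

Lemma smooth_at_id (x : V) : smooth_at (fun x : V => x) x.
Proof. by apply: (@smooth_at_linear _ idfun) => y; exact: cvg_id. Qed.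

Lemma smooth_atN (W : normedModType R) (f : V -> W) x :
  smooth_at f x -> smooth_at (fun x => - f x) x.
Proof.
move=> [A [Ao Ax fC]]; exists A; split=> //.
by apply: (@Cinf_linear_comp R V W W A (@GRing.opp W)) => // y; exact: opp_continuous.
Qed.

Lemma smooth_atB (W : normedModType R) (f g : V -> W) x :
  smooth_at f x -> smooth_at g x -> smooth_at (fun x => f x - g x) x.
Proof. by move=> fs gs; apply: smooth_atD => //; exact: smooth_atN. Qed.

Lemma smooth_atX (f : V -> R) n x :
  smooth_at f x -> smooth_at (fun x => f x ^+ n) x.
Proof.
move=> fs; elim: n => [|n IH]; first exact: smooth_at_cst.
by under eq_fun do rewrite exprS; exact: smooth_atM.
Qed.

Lemma smooth_at_fst (W X : normedModType R) (f : V -> W * X) x :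
  smooth_at f x -> smooth_at (fun x => (f x).1) x.
Proof.
move=> [A [Ao Ax fC]]; exists A; split=> //.
by apply: (@Cinf_linear_comp R V _ W A (@fst W X)) => // y; exact: cvg_fst.
Qed.

Lemma smooth_at_snd (W X : normedModType R) (f : V -> W * X) x :
  smooth_at f x -> smooth_at (fun x => (f x).2) x.
Proof.
move=> [A [Ao Ax fC]]; exists A; split=> //.
by apply: (@Cinf_linear_comp R V _ X A (@snd W X)) => // y; exact: cvg_snd.
Qed.

Lemma smooth_at_pair (W X : normedModType R) (f : V -> W) (g : V -> X) x :
  smooth_at f x -> smooth_at g x -> smooth_at (fun x => (f x, g x)) x.
Proof.
move=> fs gs.
have inlin : linear (fun w : W => (w, 0 : X)).
  by move=> a u v; congr (_, _) => /=; rewrite scaler0 addr0.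
have inrin : linear (fun w : X => (0 : W, w)).
  by move=> a u v; congr (_, _) => /=; rewrite scaler0 addr0.
pose inlL : {linear W -> (W * X)%type} := HB.pack (fun w : W => (w, 0 : X))
  (GRing.isLinear.Build _ _ _ _ _ inlin).
pose inrL : {linear X -> (W * X)%type} := HB.pack (fun w : X => (0 : W, w))
  (GRing.isLinear.Build _ _ _ _ _ inrin).
rewrite (_ : (fun x => _) = fun x => inlL (f x) + inrL (g x)); last first.
  by apply/funext => y; congr (_, _) => /=; rewrite ?addr0 ?add0r.
apply: smooth_atD.
  case: fs => A [Ao Ax fC]; exists A; split => //.
  apply: Cinf_linear_comp => // y; apply: cvg_pair; [exact: cvg_id|exact: cvg_cst].
case: gs => A [Ao Ax gC]; exists A; split => //.
by apply: Cinf_linear_comp => // y; apply: cvg_pair; [exact: cvg_cst|exact: cvg_id].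
Qed.

Lemma smooth_at_comp1 (f : V -> R) (g : R -> R) x :
  smooth_at f x -> smooth_at g (f x) -> smooth_at (fun x => g (f x)) x.
Proof. exact: smooth_at_comp. Qed.

End SmoothAt.

Section OneVariable.
Context {R : realType}.
Implicit Types (U : set R) (f g : R -> R).

Lemma derive_dir f x v : differentiable f x -> 'D_v f x = v * 'D_1 f x.
Proof.
move=> df; rewrite !(deriveE _ df) -{1}[v]mulr1.
by rewrite -[v * 1]/(v *: 1) linearZ.
Qed.

Lemma Cinf_coind1 U (P : (R -> R) -> Prop) : open U ->
  (forall f, P f -> exists2 g, P g & forall x, U x -> is_derive x 1 f (g x)) ->
  forall f, P f -> Cinf U f.
Proof.
move=> Uo PD f Pf.
suff : Cinf U (fun x => 1 * f x) by apply: Cinf_ext => // x _; rewrite mul1r.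
apply: (Cinf_coind Uo (P := fun h => exists c f, P f /\ h = fun x => c * f x)).
- move=> _ {f Pf} [c [f [Pf ->]]] x Ux; have [g _ /(_ x Ux) fg] := PD f Pf.
  by apply/derivable1_diffP; apply: derivableZ.
- move=> _ v {f Pf} [c [f [Pf ->]]]; have [g Pg fg] := PD f Pf.
  exists (fun x => (v * c) * g x); first by exists (v * c), g.
  move=> x Ux; have fx := fg x Ux.
  have dfx : derivable f x 1 by [].
  rewrite derive_dir; last by apply/derivable1_diffP; exact: derivableZ.
  rewrite [in RHS](_ : (fun x => _) = c *: f)// deriveZ//= derive_val.
  by rewrite -mulrA.
- by exists 1, f.
Qed.

Lemma Cinf_primitive U f g : open U ->
  (forall x, U x -> is_derive x 1 f (g x)) -> Cinf U g -> Cinf U f.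
Proof.
move=> Uo fg gC; apply: (Cinf_coind1 Uo (P := fun h => h = f \/ Cinf U h));
  last by left.
move=> h [->|hC]; first by exists g => //; right.
exists ('D_1 h); first by right; exact: Cinf_derive.
move=> x Ux; apply: derivableP; apply: diff_derivable.
exact: Cinf_differentiable Ux.
Qed.

Lemma smooth_at_expR (x : R) : smooth_at expR x.
Proof.
exists setT; split => //; first exact: openT.
apply: (Cinf_coind1 openT (P := fun h => h = expR)) => // _ ->.
by exists expR => // y _; exact: is_derive_expR.
Qed.

Lemma smooth_at_sin_cos (x : R) : smooth_at sin x /\ smooth_at cos x.
Proof.
suff H h : (exists a b : R, h = fun x => a * sin x + b * cos x) -> smooth_at h x.
  split; apply: H.
    by exists 1, 0; apply/funext => y; rewrite mul1r mul0r addr0.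
  by exists 0, 1; apply/funext => y; rewrite mul1r mul0r add0r.
move=> hP; exists setT; split => //; first exact: openT.
move: h hP; apply: (Cinf_coind1 openT) => _ [a [b ->]].
exists (fun y => - b * sin y + a * cos y); first by exists (- b), a.
move=> y _; rewrite (_ : _ + _ = a * cos y + b * - sin y); last by ring.
by apply: is_deriveD; apply: is_deriveZ.
Qed.

Lemma smooth_at_sin (x : R) : smooth_at sin x.
Proof. by have [] := smooth_at_sin_cos x. Qed.

Lemma smooth_at_cos (x : R) : smooth_at cos x.
Proof. by have [] := smooth_at_sin_cos x. Qed.

Lemma open_nonzero : open [set x : R | x != 0].
Proof.
rewrite (_ : [set _ | _] = ~` [set 0]); last first.
  by apply/seteqP; split => y /=; move=> /eqP.
by apply: closed_openC; exact: closed_eq.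
Qed.

Lemma Cinf_inv : Cinf [set x : R | x != 0] (fun x => x^-1).
Proof.
apply: (Cinf_coind1 open_nonzero
  (P := fun h => exists (c : R) n, h = fun x : R => c * (x^-1) ^+ n)); last first.
  by exists 1, 1%N; apply/funext => x; rewrite mul1r expr1.
move=> _ [c [n ->]].
exists (fun x => (- c * n%:R) * (x^-1) ^+ n.+1); first by eexists _, n.+1.
move=> x /= x0.
have h1 : is_derive x 1 (fun y : R => y^-1) (- x ^- 2 *: 1).
  by apply: (@is_deriveV _ id).
rewrite (_ : (fun x => _) = c *: ((fun y : R => y^-1) ^+ n)); last first.
  by apply/funext => y; rewrite !fctE.
apply: is_derive_eq.
rewrite /GRing.scale /= mulr1 -exprVn; case: n {h1} => [|n] /=.
  by rewrite !(mul0r, mulr0).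
by rewrite !exprS expr0; ring.
Qed.

Lemma smooth_at_inv (x : R) : x != 0 -> smooth_at (fun y : R => y^-1) x.
Proof. by move=> x0; exists [set x | x != 0]; split; [exact: open_nonzero| |exact: Cinf_inv]. Qed.

Lemma smooth_at_ln (x : R) : 0 < x -> smooth_at (@ln R) x.
Proof.
move=> x0; exists [set y : R | 0 < y]; split => //.
apply: (@Cinf_primitive _ _ (fun x : R => x^-1)); first exact: (@open_gt R 0).
by apply: Cinf_sub Cinf_inv => y /= /gt_eqF ->.
Qed.

Lemma smooth_at_derive1 f x : smooth_at f x -> smooth_at (f^`()) x.
Proof.
move=> fs; rewrite (_ : f^`() = 'D_1 f); last by apply/funext => y; rewrite derive1E.
exact: smooth_at_derive.
Qed.

Lemma smooth_at_is_derive f x : smooth_at f x -> is_derive x 1 f (f^`() x).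
Proof.
by move=> /smooth_at_differentiable/diff_derivable/derivableP; rewrite derive1E.
Qed.

End OneVariable.

Lemma smooth_atV (R : realType) (V : normedModType R) (f : V -> R) x :
  smooth_at f x -> f x != 0 -> smooth_at (fun x => (f x)^-1) x.
Proof. by move=> fs f0; apply: smooth_at_comp1 => //; exact: smooth_at_inv. Qed.

(** * A-equivalence of germs *)

Section Equivalence.
Context {R : realType}.
Implicit Types V W : normedModType R.

Lemma near_comp V W (f : V -> W) p (P : W -> Prop) : {for p, continuous f} ->
  (\forall y \near f p, P y) -> \forall x \near p, P (f x).
Proof. by move=> fc Pfp; exact: fc _ Pfp. Qed.

Lemma inverse_germs_sym V W (p : V) (q : W) phi psi :
  inverse_germs p q phi psi -> inverse_germs q p psi phi.
Proof. by move=> [[? ?] [? ?] ? ?]; split. Qed.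

Lemma inverse_germs_comp V W (X : normedModType R) (p : V) (q : W) (r : X)
    (f : V -> W) (f' : W -> V) (g : W -> X) (g' : X -> W) :
  finite_frame V -> finite_frame W -> finite_frame X ->
  inverse_germs p q f f' -> inverse_germs q r g g' ->
  inverse_germs p r (g \o f) (f' \o g').
Proof.
move=> fV fW fX [[fp f'q] [fs f's] ff' f'f] [[gq g'r] [gs g's] gg' g'g].
have fc := smooth_at_continuous fs; have g'c := smooth_at_continuous g's.
split.
- by rewrite /= fp g'r.
- by split; [apply: (@smooth_at_comp _ _ _ _ f g)|apply: (@smooth_at_comp _ _ _ _ g' f')];
    rewrite ?fp ?g'r.
- have h : \forall x \near p, g' (g (f x)) = f x by apply: (near_comp (P := fun y => g' (g y) = y) fc); rewrite fp.
  by near=> x; rewrite /= (near h x)// (near ff' x).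
- have h : \forall x \near r, f (f' (g' x)) = g' x by apply: (near_comp (P := fun y => f (f' y) = y) g'c); rewrite g'r.
  by near=> x; rewrite /= (near h x)// (near g'g x).
Unshelve. all: by end_near. Qed.

Lemma A_equivalent_sym V1 W1 V2 W2 (f : V1 -> W1) p (g : V2 -> W2) q :
  {for p, continuous f} ->
  A_equivalent f p g q -> A_equivalent g q f p.
Proof.
move=> fc [phi [Phi [[psi hphi] [Psi hPhi] E]]].
exists psi, Psi; split.
- by exists phi; exact: inverse_germs_sym.
- by exists Phi; exact: inverse_germs_sym.
have [[phip psiq] [_ psis] _ phipsi] := hphi.
have [_ _ PsiPhi _] := hPhi.
have psic := smooth_at_continuous psis.
have h1 : \forall y \near q, Phi (f (psi y)) = g (phi (psi y)).
  by apply: (near_comp (P := fun x => Phi (f x) = g (phi x)) psic); rewrite psiq.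
have h2 : \forall y \near q, Psi (Phi (f (psi y))) = f (psi y).
  apply: (near_comp (P := fun x => Psi (Phi (f x)) = f x) psic); rewrite psiq.
  exact: (near_comp (P := fun y => Psi (Phi y) = y) fc).
by near=> y; rewrite -(near h2 y)// (near h1 y)// (near phipsi y).
Unshelve. all: by end_near. Qed.

Lemma A_equivalent_trans V1 W1 V2 W2 V3 W3 (f : V1 -> W1) p (g : V2 -> W2) q
    (h : V3 -> W3) r :
  finite_frame V1 -> finite_frame V2 -> finite_frame V3 ->
  finite_frame W1 -> finite_frame W2 -> finite_frame W3 ->
  A_equivalent f p g q -> A_equivalent g q h r -> A_equivalent f p h r.
Proof.
move=> fV1 fV2 fV3 fW1 fW2 fW3.
move=> [phi [Phi [[psi hphi] [Psi hPhi] E]]].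
move=> [phi' [Phi' [[psi' hphi'] [Psi' hPhi'] E']]].
exists (phi' \o phi), (Phi' \o Phi); split.
- by exists (psi \o psi'); exact: inverse_germs_comp hphi hphi'.
- by exists (Psi \o Psi'); exact: inverse_germs_comp hPhi hPhi'.
have [[phip _] [phis _] _ _] := hphi.
have h1 : \forall x \near p, Phi' (g (phi x)) = h (phi' (phi x)).
  apply: (near_comp (P := fun y => Phi' (g y) = h (phi' y))
      (smooth_at_continuous phis)).
  by rewrite phip.
by near=> x; rewrite /= (near E x)// (near h1 x).
Unshelve. all: by end_near. Qed.

End Equivalence.

(** * Division of smooth functions by powers of the variable *)

Section Division.
Context {R : realType}.
Implicit Types (U : set R) (f g P : R -> R).

(** When [P' = t^k f] and [P 0 = 0], the quotient [P / t^(k+1)] extends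
    continuously by [f 0 / (k+1)].  For [k = 0] this is the mean of [f] on the
    segment from 0 to [t]. *)
Definition quotient k P f : R -> R :=
  fun t => if t == 0 then f 0 / k.+1%:R else P t / t ^+ k.+1.

(** By the rule of de l Hospital applied to [P - t^(k+1) f 0 / (k+1)] over
    [t^(k+2)]: the ratio of the derivatives is [(f t - f 0) / ((k+2) t)]. *)
Lemma is_derive_quotient0 U k P f : open U -> U 0 -> P 0 = 0 ->
  (forall t, U t -> is_derive t (1 : R) P (t ^+ k * f t)) ->
  derivable f (0 : R) (1 : R) ->
  is_derive (0 : R) (1 : R) (quotient k P f) ('D_1 f 0 / k.+2%:R).
Proof.
move=> Uo U0 P0 dP df.
have /is_derive1_caratheodory [g [fE gc g0]] := derivableP df.
have gE t : f t = f 0 + t * g t by rewrite [t * _]mulrC -[X in g t * X]subr0 -fE; ring.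
have k1 : k.+1%:R != 0 :> R by rewrite pnatr_eq0.
have k2 : k.+2%:R != 0 :> R by rewrite pnatr_eq0.
have [e e0 eU] : exists2 e : R, 0 < e & forall t, - e < t < e -> U t.
  have /nbhs_ballP [e /= e0 eU] := open_nbhs_nbhs (conj Uo U0).
  by exists e => // t; rewrite -ltr_norml => te; apply: eU; rewrite /ball /= sub0r normrN.
pose N t := P t - t ^+ k.+1 * (f 0 / k.+1%:R).
pose df' t := if t == 0 then g 0 / k.+2%:R else t ^+ k * (f t - f 0).
pose D t : R := t ^+ k.+2.
pose dD t : R := if t == 0 then 1 else k.+2%:R * t ^+ k.+1.
have dpow n (t : R) : is_derive t (1 : R) (fun t : R => t ^+ n) (n%:R * t ^+ n.-1).
  split; first exact: exprn_derivable.
  by rewrite exp_derive /GRing.scale /= mulr1 mulr_natl.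
have Nd t : U t -> t != 0 -> is_derive t (1:R) N (df' t).
  move=> Ut t0; rewrite /df' (negbTE t0).
  have := is_deriveB (dP t Ut) (is_deriveM (dpow k.+1 t) (is_derive_cst (f 0 / k.+1%:R) t 1)).
  rewrite [X in is_derive _ _ X _](_ : _ = N); last by apply/funext => s; rewrite !fctE.
  move=> H; apply: (is_derive_eq H).
  rewrite /GRing.scale /= mulr0 add0r; field.
by apply: lt0r_neq0; have := ler0n R k; lra.
have Nc : {for 0, continuous N}.
  apply: differentiable_continuous; apply/derivable1_diffP.
  apply: derivableB; first by have [] := dP 0 U0.
  by apply: derivableM => //; apply: exprn_derivable.
have cin : 0 \in `]-e, e[%R by rewrite in_itv /= oppr_lt0 e0.
have ratio : N t / D t @[t --> 0^'] --> g 0 / k.+2%:R.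
  apply: (@lhopital R N df' D dD (- e) e 0 _ cin).
  - move=> t; rewrite inE /= in_itv /= => -[/eU Ut /eqP t0]; exact: Nd.
  - move=> t; rewrite inE /= => -[_ /eqP t0]; rewrite /dD (negbTE t0); exact: dpow.
  - move: Nc; rewrite /prop_for /continuous_at /N P0 expr0n /= mul0r subr0; exact.
  - by have := @exprn_continuous R k.+2 0; rewrite /continuous_at expr0n.
  - move=> t; rewrite inE /= => -[_ /eqP t0]; rewrite /dD (negbTE t0) mulf_neq0// expf_neq0//.
  - rewrite [X in X @ _ --> _](_ : _ = fun t => g t / k.+2%:R); last first.
      apply/funext => t; rewrite /df' /dD; case: eqVneq => [->|t0]; first by rewrite divr1.
      have kR := ler0n R k; rewrite (gE t) addrAC subrr add0r exprS; field; rewrite ?expf_neq0 ?t0 //= ?andbT. by apply: lt0r_neq0; lra.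
    by apply: cvgMl => //; exact: gc.
have cv : h^-1 *: (quotient k P f (h *: 1 + 0) - quotient k P f 0) @[h --> 0^'] --> g 0 / k.+2%:R.
  apply: cvg_trans ratio; apply: near_eq_cvg.
  near=> h.
  have h0 : h != 0 by near: h; exact: nbhs_dnbhs_neq.
  rewrite /quotient eqxx addr0 [h *: 1]mulr1 (negbTE h0) /N /D /GRing.scale /=.
  have kR := ler0n R k; rewrite [h ^+ k.+2]exprS; field; rewrite ?expf_neq0 ?h0 //= ?andbT; apply: lt0r_neq0; lra.
rewrite -g0; split; first by apply/cvg_ex; eexists; exact: cv.
exact: cvg_lim cv.
Unshelve. all: by end_near. Qed.

Lemma is_derive_expn n (t : R) :
  is_derive t (1 : R) (fun t : R => t ^+ n) (n%:R * t ^+ n.-1).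
Proof.
split; first exact: exprn_derivable.
by rewrite exp_derive /GRing.scale /= mulr1 mulr_natl.
Qed.

(** The derivative of such a quotient is one of the same kind, with [k+1], the
    numerator [P2 = t^(k+1) f - (k+1) P] and [f'] in place of [f]; so smoothness
    follows by coinduction, without any integral. *)
Lemma Cinf_quotient U k P f : open U -> U 0 -> P 0 = 0 ->
  (forall t, U t -> is_derive t (1 : R) P (t ^+ k * f t)) -> Cinf U f ->
  Cinf U (quotient k P f).
Proof.
move=> Uo U0 P0 dP fC.
apply: (Cinf_coind1 Uo (P := fun q => exists k P f, [/\ P 0 = 0,
  forall t, U t -> is_derive t (1 : R) P (t ^+ k * f t), Cinf U f &
  q = quotient k P f])); last by exists k, P, f.
move=> _ {k P f P0 dP fC} [k [P [f [P0 dP fC ->]]]].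
pose P2 t := t ^+ k.+1 * f t - k.+1%:R * P t.
have fd t : U t -> is_derive t (1 : R) f ('D_1 f t).
  move=> Ut; apply: derivableP; apply: diff_derivable; exact: Cinf_differentiable Ut.
have P2d t : U t -> is_derive t (1 : R) P2 (t ^+ k.+1 * 'D_1 f t).
  move=> Ut.
  have H := is_deriveB (is_deriveM (is_derive_expn k.+1 t) (fd t Ut))
    (is_deriveZ k.+1%:R (dP t Ut)).
  rewrite (_ : P2 = (fun t : R => t ^+ k.+1) * f - k.+1%:R *: P); last first.
    by apply/funext => s; rewrite !fctE.
  by apply: (is_derive_eq H); rewrite /GRing.scale /=; ring.
exists (quotient k.+1 P2 ('D_1 f)).
  exists k.+1, P2, ('D_1 f); split => //; last exact: Cinf_derive.
  by rewrite /P2 P0 expr0n /= mul0r mulr0 subr0.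
move=> x Ux; have [->|x0] := eqVneq x 0.
  rewrite {2}/quotient eqxx; apply: (is_derive_quotient0 Uo) => //.
  by have [] := fd 0 U0.
rewrite {2}/quotient (negbTE x0).
have xk : x ^+ k.+1 != 0 by rewrite expf_neq0.
have H := is_deriveM (dP x Ux) (@is_deriveV _ (fun t : R => t ^+ k.+1) _ _ _ xk (is_derive_expn k.+1 x)).
apply: (@near_eq_is_derive _ _ _ (P * (fun y => (y ^+ k.+1)^-1))).
  near=> y; have y0 : y != 0 by near: y; apply: open_nbhs_nbhs; split => //; exact: open_neq.
  by rewrite /quotient (negbTE y0) fctE.
apply: (is_derive_eq H); rewrite /GRing.scale /= /P2.
by rewrite !exprS; field; rewrite ?expf_neq0 ?x0.
Unshelve. all: by end_near. Qed.

(** Integrating [t^k f] gains exactly one order of vanishing.  All orders of the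
    coordinates of the section curve are computed with this lemma. *)
Lemma smooth_divide k P f : P 0 = 0 ->
  (\forall t \near (0 : R), is_derive t (1 : R) P (t ^+ k * f t)) ->
  smooth_at f (0 : R) ->
  exists q, [/\ smooth_at q (0 : R), q 0 = f 0 / k.+1%:R &
               forall t, P t = t ^+ k.+1 * q t].
Proof.
move=> P0 dP [U [Uo U0 fC]]; exists (quotient k P f); split.
- pose U' := U `&` [set t : R | is_derive t (1 : R) P (t ^+ k * f t)]°.
  have Uo' : open U' by apply: openI => //; exact: open_interior.
  exists U'; split => //; apply: Cinf_quotient => //.
    by move=> t [_ /interior_subset].
  by apply: Cinf_sub fC; exact: subIsetl.
- by rewrite /quotient eqxx.
- move=> t; rewrite /quotient; case: eqVneq => [->|t0]; first by rewrite P0 expr0n /= mul0r.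
  by rewrite mulrC divfK// expf_neq0.
Qed.

(** Removes the constant term and divides by [t]; iterating it [n] times and
    evaluating at 0 reads off the [n]-th Taylor coefficient. *)
Definition dq f : R -> R := fun t => if t == 0 then 'D_1 f 0 else (f t - f 0) / t.

Lemma dqE f t : f t = f 0 + t * dq f t.
Proof.
rewrite /dq; case: eqVneq => [->|t0]; first by rewrite mul0r addr0.
by rewrite mulrC divfK// addrC subrK.
Qed.

Lemma Cinf_dq U f : open U -> U 0 -> Cinf U f -> Cinf U (dq f).
Proof.
move=> Uo U0 fC.
rewrite (_ : dq f = quotient 0 (fun t => f t - f 0) ('D_1 f)); last first.
  by apply/funext => t; rewrite /dq /quotient; case: eqP; rewrite ?divr1.
apply: Cinf_quotient => //; [by rewrite subrr| |exact: Cinf_derive].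
move=> t Ut; rewrite expr0 mul1r -[X in is_derive _ _ _ X]subr0.
apply: is_deriveB; apply: derivableP; apply: diff_derivable.
exact: Cinf_differentiable Ut.
Qed.

Lemma smooth_dq f : smooth_at f (0 : R) -> smooth_at (dq f) (0 : R).
Proof. by move=> [U [Uo U0 fC]]; exists U; split => //; exact: Cinf_dq. Qed.

Lemma hadamard f : smooth_at f (0 : R) ->
  exists q, [/\ smooth_at q (0 : R), q 0 = f^`() 0 & forall t, f t = f 0 + t * q t].
Proof.
move=> fs; exists (dq f); split; [exact: smooth_dq| |exact: dqE].
by rewrite /dq eqxx derive1E.
Qed.

Lemma dq_expS n g : {for 0, continuous g} ->
  dq (fun t => t ^+ n.+1 * g t) = fun t => t ^+ n * g t.
Proof.
move=> gc; apply/funext => t; rewrite /dq expr0n /= mul0r subr0.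
case: eqVneq => [->|t0]; last by rewrite exprS; field.
suff : is_derive (0 : R) (1 : R) (fun t => t ^+ n.+1 * g t) (0 ^+ n * g 0).
  by move=> ?; rewrite derive_val.
apply/is_derive1_caratheodory; exists (fun t => t ^+ n * g t); split => //.
  by move=> z; rewrite expr0n /= mul0r !subr0 exprS; ring.
by apply: continuousM => //; exact: exprn_continuous.
Qed.

Lemma Cinf_derive1n U f n : Cinf U f -> Cinf U (f^`(n)).
Proof.
move=> fC; elim: n => [|n IH] //; rewrite derive1nS.
rewrite (_ : _^`() = 'D_1 (f^`(n))); first exact: Cinf_derive.
by apply/funext => y; rewrite derive1E.
Qed.

Lemma Cinf_derivable U f t : Cinf U f -> U t -> derivable f t 1.
Proof. by move=> fC Ut; apply: diff_derivable; exact: Cinf_differentiable Ut. Qed.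

Lemma Cinf_is_derive U f t : Cinf U f -> U t -> is_derive t (1 : R) f (f^`() t).
Proof. by move=> fC Ut; rewrite derive1E; apply: derivableP; exact: Cinf_derivable Ut. Qed.

Lemma derive1n_dq f n : Cinf setT f -> f^`(n.+1) 0 = n.+1%:R * derive1n n (dq f) 0.
Proof.
move=> fC; have qC := Cinf_dq openT I fC; set q := dq f in qC *.
suff -> : f^`(n.+1) = fun t => t * derive1n n.+1 q t + n.+1%:R * derive1n n q t.
  by rewrite mul0r add0r.
have dI (h : R -> R) (a : R -> R) : (forall t : R, is_derive t (1 : R) h (a t)) ->
    h^`() = a.
  by move=> ha; apply/funext => t; have := ha t; rewrite derive1E => ?; rewrite derive_val.
have qd m t : is_derive t (1 : R) (q^`(m)) (q^`(m.+1) t).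
  by rewrite derive1nS; apply: (@Cinf_is_derive setT) => //; exact: Cinf_derive1n.
elim: n => [|n IH].
  rewrite derive1n1; apply: dI => t.
  have H := is_deriveD (is_derive_cst (f 0) t 1) (is_deriveM (is_derive_id t 1) (qd 0%N t)).
  rewrite (_ : f = cst (f 0) + id * derive1n 0 q); last first.
    by apply/funext => s; rewrite !fctE (dqE f s).
  by apply: (is_derive_eq H); rewrite /GRing.scale /=; ring.
rewrite derive1nS IH; apply: dI => t.
have H := is_deriveD (is_deriveM (is_derive_id t 1) (qd n.+1 t)) (is_deriveZ n.+1%:R (qd n t)).
rewrite (_ : (fun t => _) = id * derive1n n.+1 q + n.+1%:R *: derive1n n q); last first.
  by apply/funext => s; rewrite !fctE.
by apply: (is_derive_eq H); rewrite /GRing.scale /=; ring.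
Qed.

Lemma iter_dq f n : Cinf setT f -> f^`(n) 0 = n`!%:R * iter n dq f 0.
Proof.
elim: n f => [|n IH] f fC; first by rewrite mul1r derive1n0.
rewrite derive1n_dq// IH; last by apply: Cinf_dq => //; exact: openT.
by rewrite -iterSr factS natrM mulrA.
Qed.

End Division.

(** * Limits of geometrically convergent sequences of functions *)

Section GeometricLimits.
Context {R : realType}.
Implicit Types (S dS : nat -> R -> R).

Lemma half_expn_small (e : R) N : 0 < e ->
  exists2 n, (N <= n)%N & 2 * 2^-1 ^+ n < e.
Proof.
move=> e0; have : geometric 2 (2^-1 : R) n @[n --> \oo] --> 0.
  by apply: cvg_geometric; rewrite ger0_norm ?invr_ge0// invf_lt1// ltr1n.
move=> /cvgrPdist_lt/(_ e e0) h.
near \oo => n; exists n; first by near: n; exists N.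
have : `|0 - geometric 2 2^-1 n| < e by near: n.
by rewrite sub0r normrN /geometric /=; apply: le_lt_trans; exact: ler_norm.
Unshelve. all: by end_near. Qed.

Lemma geometric_limit (u : nat -> R) N :
  (forall n, (N <= n)%N -> `|u n.+1 - u n| <= 2^-1 ^+ n) ->
  cvgn u /\ forall n, (N <= n)%N -> `|limn u - u n| <= 2 * 2^-1 ^+ n.
Proof.
move=> uN.
have step n m : (N <= n)%N -> `|u (n + m)%N - u n| <= 2 * (2^-1 ^+ n - 2^-1 ^+ (n + m)).
  move=> Nn; elim: m => [|m IH]; first by rewrite addn0 !subrr normr0 mulr0.
  have -> : u (n + m.+1)%N - u n = (u (n + m).+1 - u (n + m)%N) + (u (n + m)%N - u n).
    by rewrite addnS; ring.
  apply: le_trans (ler_normD _ _) _.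
  apply: le_trans (lerD (uN (n + m)%N (leq_trans Nn (leq_addr _ _))) IH) _.
  rewrite addnS exprS; lra.
have pos n : 0 <= (2^-1 : R) ^+ n by apply: exprn_ge0; rewrite invr_ge0.
have step' n m : (N <= n)%N -> (n <= m)%N -> `|u m - u n| <= 2 * 2^-1 ^+ n.
  move=> Nn nm; have := step n (m - n)%N Nn; rewrite subnKC// => h.
  by apply: (le_trans h); have := pos m; lra.
have cu : cvgn u.
  apply/cauchy_cvgP/cauchy_exP => e e0.
  have [n Nn ne] := half_expn_small N e0.
  exists (u n); exists n => // m /= nm.
  by rewrite /ball /= distrC; apply: le_lt_trans ne; exact: step'.
split => // n Nn.
have : limn (fun m => `|u m - u n|) <= 2 * 2^-1 ^+ n.
  apply: limr_le; last by exists n => // m /= nm; exact: step'.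
  by apply: is_cvg_norm; apply: is_cvgB => //; exact: is_cvg_cst.
rewrite (_ : limn _ = `|limn u - u n|)//.
by apply/cvg_lim => //; apply: cvg_norm; apply: cvgB => //; exact: cvg_cst.
Qed.

Lemma limit_continuous S N (x : R) : (forall n, {for x, continuous (S n)}) ->
  (forall n z, (N <= n)%N -> `|S n.+1 z - S n z| <= 2^-1 ^+ n) ->
  {for x, continuous (fun z => limn (S^~ z))}.
Proof.
move=> Sc SN; apply/cvgrPdist_lt => e e0.
have e3 : 0 < e / 3 by lra.
have [n Nn ne] := half_expn_small N e3.
have lN z : `|limn (S^~ z) - S n z| < e / 3.
  by apply: le_lt_trans ne; have [_] := geometric_limit (SN^~ z); apply.
have /cvgrPdist_lt/(_ _ e3) := Sc n.
apply: filterS => z Sz.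
have -> : limn (S^~ x) - limn (S^~ z) =
    (limn (S^~ x) - S n x) + (S n x - S n z) - (limn (S^~ z) - S n z) by ring.
have := ler_normB (limn (S^~ x) - S n x + (S n x - S n z)) (limn (S^~ z) - S n z).
have := ler_normD (limn (S^~ x) - S n x) (S n x - S n z).
have := lN x; have := lN z; move: Sz; lra.
Qed.

Lemma mean_value_bound (f df : R -> R) B (x z : R) :
  (forall y, is_derive y (1 : R) f (df y)) -> (forall y, `|df y| <= B) ->
  `|f z - f x| <= B * `|z - x|.
Proof.
move=> fd dB; wlog xz : x z / x <= z.
  move=> H; case: (leP x z) => [/H//|/ltW/H]; by rewrite distrC (distrC z).
have [|c _ ->] := @MVT_segment R f df x z xz.
  apply: continuous_subspaceT => y.
  by apply: differentiable_continuous; apply/derivable1_diffP.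
by rewrite normrM ler_wpM2r.
Qed.

(** The difference quotients at [x] of the functions [S n] again form a
    geometrically convergent sequence of functions continuous at [x], by the
    mean value theorem; their limit is the difference quotient of the limit. *)
Lemma limit_derive S dS N (x : R) :
  (forall n y, is_derive y (1 : R) (S n) (dS n y)) ->
  (forall n z, (N <= n)%N -> `|S n.+1 z - S n z| <= 2^-1 ^+ n) ->
  (forall n z, (N <= n)%N -> `|dS n.+1 z - dS n z| <= 2^-1 ^+ n) ->
  is_derive x (1 : R) (fun z => limn (S^~ z)) (limn (dS^~ x)).
Proof.
move=> Sd SN dSN; apply/is_derive1_caratheodory.
have slopes n : exists g, [/\ forall z, S n z - S n x = g z * (z - x),
    {for x, continuous g} & g x = dS n x].
  by apply/is_derive1_caratheodory.
pose g n := xget (cst 0) [set g | [/\ forall z, S n z - S n x = g z * (z - x),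
    {for x, continuous g} & g x = dS n x]].
have gP n : [/\ forall z, S n z - S n x = g n z * (z - x),
    {for x, continuous (g n)} & g n x = dS n x].
  by have [h hP] := slopes n; rewrite /g; case: xgetP => [_ ->//|/(_ h)]; case.
have gE n z : S n z - S n x = g n z * (z - x) by have [] := gP n.
have gx n : g n x = dS n x by have [] := gP n.
have gN n z : (N <= n)%N -> `|g n.+1 z - g n z| <= 2^-1 ^+ n.
  move=> Nn; have [->|zx] := eqVneq z x; first by rewrite !gx; exact: dSN.
  rewrite -(ler_pM2r (_ : 0 < `|z - x|)); last by rewrite normr_gt0 subr_eq0.
  rewrite -normrM mulrBl -!gE.
  have := @mean_value_bound (S n.+1 - S n) (dS n.+1 - dS n) (2^-1 ^+ n) x z.
  rewrite !fctE; set a := S n.+1 z; set b := S n.+1 x; set c := S n z; set d := S n x.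
  rewrite (_ : a - b - (c - d) = a - c - (b - d)); last by ring.
  by apply=> y; exact: dSN.
exists (fun z => limn (g^~ z)); split.
- move=> z.
  have [cz _] := geometric_limit (SN^~ z); have [cx _] := geometric_limit (SN^~ x).
  have [cg _] := geometric_limit (gN^~ z).
  have h1 : (S n z - S n x) @[n --> \oo] --> limn (S^~ z) - limn (S^~ x).
    exact: cvgB.
  have h2 : (g n z * (z - x)) @[n --> \oo] --> limn (g^~ z) * (z - x).
    by apply: cvgM => //; exact: cvg_cst.
  have gzE : (fun n => g n z * (z - x)) = fun n => S n z - S n x.
    by apply/funext => n; rewrite gE.
  rewrite gzE in h2.
  by rewrite -(cvg_lim (@Rhausdorff R) h1) -(cvg_lim (@Rhausdorff R) h2).
- by apply: (@limit_continuous _ N) => // n; have [] := gP n.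
- by congr (limn _); apply/funext => n; exact: gx.
Qed.

End GeometricLimits.

(** * The lemma of Borel *)

Section Borel.
Context {R : realType}.

(** Used in place of bump functions: the powers of the sine vanish at 0 to
    prescribed order, and all their derivatives are bounded on the line. *)
Inductive trig_polynomial : (R -> R) -> Prop :=
| Trig_cst c : trig_polynomial (fun=> c)
| Trig_sin : trig_polynomial sin
| Trig_cos : trig_polynomial cos
| Trig_add f g : trig_polynomial f -> trig_polynomial g ->
    trig_polynomial (fun x => f x + g x)
| Trig_mul f g : trig_polynomial f -> trig_polynomial g ->
    trig_polynomial (fun x => f x * g x).

Lemma trig_derive f : trig_polynomial f ->
  exists2 g, trig_polynomial g & forall x : R, is_derive x (1 : R) f (g x).
Proof.
elim=> {f} [c|||f g _ [f' Tf' fd] _ [g' Tg' gd]|f g Tf [f' Tf' fd] Tg [g' Tg' gd]].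
- by exists (fun=> 0); [exact: Trig_cst|move=> x; exact: is_derive_cst].
- by exists cos; [exact: Trig_cos|move=> x; exact: is_derive_sin].
- exists (fun x => -1 * sin x); first by apply: Trig_mul; [exact: Trig_cst|exact: Trig_sin].
  by move=> x; rewrite mulN1r; exact: is_derive_cos.
- by exists (fun x => f' x + g' x); [exact: Trig_add|move=> x; exact: is_deriveD].
- exists (fun x => f x * g' x + g x * f' x).
    by apply: Trig_add; exact: Trig_mul.
  by move=> x; exact: is_deriveM.
Qed.

Lemma trig_bounded f : trig_polynomial f -> exists B, forall x, `|f x| <= B.
Proof.
elim=> {f} [c|||f g _ [B fB] _ [C gC]|f g _ [B fB] _ [C gC]].
- by exists `|c|.
- by exists 1 => x; rewrite ler_norml sin_geN1 sin_le1.
- by exists 1 => x; rewrite ler_norml cos_geN1 cos_le1.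
- by exists (B + C) => x; apply: le_trans (ler_normD _ _) _; exact: lerD.
- by exists (B * C) => x; rewrite normrM; apply: ler_pM.
Qed.

Lemma derive1_eq (f g : R -> R) : (forall x : R, is_derive x (1 : R) f (g x)) ->
  derive1 f = g.
Proof. by move=> fg; apply/funext => x; have := fg x; rewrite derive1E => ?; rewrite derive_val. Qed.

Lemma trig_derive1n f n : trig_polynomial f -> trig_polynomial (derive1n n f).
Proof.
move=> Tf; elim: n => [|n IH] //; rewrite derive1nS.
by have [g Tg gE] := trig_derive IH; rewrite (derive1_eq gE).
Qed.

Lemma trig_sin_expn n : trig_polynomial (fun x : R => @sin R x ^+ n).
Proof.
elim: n => [|n IH]; first exact: Trig_cst.
by under eq_fun do rewrite exprS; apply: Trig_mul => //; exact: Trig_sin.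
Qed.

Lemma trig_Cinf f : trig_polynomial f -> Cinf setT f.
Proof.
apply: (Cinf_coind1 openT) => {}f /trig_derive[g Tg fg].
by exists g.
Qed.

Lemma sin_expn_common_bound n : exists2 B, 0 <= B & forall m x, (m <= n)%N ->
  `|derive1n m (fun x : R => @sin R x ^+ n) x| <= B.
Proof.
have := trig_derive1n _ (trig_sin_expn n); move: (fun x => _) => f Tf.
elim: n => [|n [B B0 fB]].
  have [B fB] := trig_bounded (Tf 0%N); exists B.
    by apply: le_trans (fB 0); exact: normr_ge0.
  by move=> m x; rewrite leqn0 => /eqP ->; exact: fB.
have [C fC] := trig_bounded (Tf n.+1).
exists (B + C); first by rewrite addr_ge0//; apply: le_trans (fC 0); exact: normr_ge0.
have C0 : 0 <= C by apply: le_trans (fC 0); exact: normr_ge0.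
move=> m x; rewrite leq_eqVlt => /predU1P[->|mn].
  by apply: le_trans (fC x) _; rewrite lerDr.
by apply: le_trans (fB m x mn) _; rewrite lerDl.
Qed.

Lemma sin_expn_jet n : (forall m, (m < n)%N -> derive1n m (fun x : R => @sin R x ^+ n) 0 = 0) /\
  derive1n n (fun x : R => @sin R x ^+ n) 0 != 0.
Proof.
have fC := trig_Cinf (trig_sin_expn n).
have sC := trig_Cinf Trig_sin.
have qC := Cinf_dq openT I sC.
have q0 : dq (@sin R) 0 = 1 :> R by rewrite /dq eqxx derive_val cos0.
have sE (t : R) : sin t = t * dq (@sin R) t by rewrite {1}(dqE (@sin R)) sin0 add0r.
have fE : (fun x : R => @sin R x ^+ n) = fun t => t ^+ n * dq (@sin R) t ^+ n.
  by apply/funext => t; rewrite sE exprMn.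
have gc : {for 0, continuous (fun t : R => dq (@sin R) t ^+ n)}.
  apply: smooth_at_continuous; apply: smooth_atX.
  by exists setT; split => //; exact: openT.
have it m : (m <= n)%N -> iter m dq (fun x : R => @sin R x ^+ n) = fun t => t ^+ (n - m) * dq (@sin R) t ^+ n.
  elim: m => [|m IH] mn; first by rewrite subn0.
  by rewrite iterS IH 1?ltnW// -(subnSK mn) dq_expS.
split=> [m mn|].
  by rewrite iter_dq// it 1?ltnW// expr0n subn_eq0 leqNgt mn /= mul0r mulr0.
by rewrite iter_dq// it// subnn expr0 mul1r q0 expr1n mulr1 pnatr_eq0 -lt0n fact_gt0.
Qed.

Lemma derive1n_scale (f : R -> R) (c M : R) m : Cinf setT f ->
  derive1n m (fun x => c * f (M * x)) = fun x => c * M ^+ m * derive1n m f (M * x).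
Proof.
move=> fC; elim: m => [|m IH]; first by apply/funext => x; rewrite expr0 mulr1.
rewrite derive1nS IH; apply: derive1_eq => x.
have H1 : is_derive (M * x) (1 : R) (derive1n m f) (derive1n m.+1 f (M * x)).
  by apply: (@Cinf_is_derive _ setT) => //; exact: Cinf_derive1n.
have H2 : is_derive x (1 : R) (fun y : R => M * y) (M * 1).
  by apply: is_deriveZ.
have H := is_deriveZ (c * M ^+ m) (@is_derive1_comp _ (derive1n m f) (fun y : R => M * y) x _ _ H1 H2).
rewrite (_ : (fun x => _) = (c * M ^+ m) \*: (derive1n m f \o (fun y : R => M * y))); last first.
  by apply/funext => s; rewrite !fctE.
by apply: (is_derive_eq H); rewrite /GRing.scale /= exprS; ring.
Qed.

Lemma Cinf_trig_scale f (c M : R) : trig_polynomial f -> Cinf setT (fun x => c * f (M * x)).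
Proof.
move=> Tf; apply: CinfM; [exact: openT|exact: (Cinf_cst c openT)|].
apply: (@Cinf_comp _ _ _ _ setT setT (fun x => M * x) f) => //.
- exact: finite_frame_field.
- exact: finite_frame_field.
- exact: openT.
- by apply: CinfM; [exact: openT|exact: (Cinf_cst M openT)|move=> n; exact: (@Cinf_linear _ _ _ setT idfun openT (fun x => cvg_id))].
- exact: trig_Cinf.
- exact: openT.
Qed.

(** Take [f x = b / (d M^n) sin (M x)^n], where [d] is the [n]-th derivative of
    [sin^n] at 0.  The [n]-th derivative at 0 is [b] for every [M], while the
    derivatives of order [m < n] are of size [M^(m - n)], hence small for large
    [M]. *)
Lemma derivative_correction n (b : R) : exists f : R -> R, [/\ Cinf setT f,
  forall m, (m < n)%N -> derive1n m f 0 = 0, derive1n n f 0 = b &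
  forall m x, (m < n)%N -> `|derive1n m f x| <= 2^-1 ^+ n].
Proof.
have [j0 jn] := sin_expn_jet n.
have [B B0 fB] := sin_expn_common_bound n.
have Tf := trig_sin_expn n; set f := (fun x : R => @sin R x ^+ n) in j0 jn fB Tf.
have fC := trig_Cinf Tf.
set d := derive1n n f 0 in jn.
pose M := 1 + 2 ^+ n * `|b / d| * B.
have M1 : 1 <= M by rewrite lerDl !mulr_ge0// exprn_ge0.
have M0 : 0 < M by apply: lt_le_trans M1.
have MN : M != 0 by rewrite gt_eqF.
exists (fun x => b / d / M ^+ n * f (M * x)); split.
- exact: Cinf_trig_scale.
- by move=> m mn; rewrite derive1n_scale// mulr0 j0// mulr0.
- by rewrite derive1n_scale// mulr0 -/d; field; rewrite jn expf_neq0.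
- move=> m x mn; rewrite derive1n_scale// normrM.
  have h1 := fB m (M * x) (ltnW mn).
  have -> : b / d / M ^+ n * M ^+ m = b / d / M ^+ (n - m).
    by rewrite -{1}(subnK (ltnW mn)) exprD; field; rewrite jn !expf_neq0.
  rewrite normrM normfV (ger0_norm (exprn_ge0 _ (ltW M0))).
  have h2 : (M ^+ (n - m))^-1 <= M^-1.
    by rewrite lef_pV2 ?posrE ?exprn_gt0// -[X in X <= _]expr1 ler_weXn2l// subn_gt0.
  apply: le_trans (_ : `|b / d| * M^-1 * B <= _).
    by apply: ler_pM => //; [rewrite mulr_ge0// invr_ge0 exprn_ge0// ltW|rewrite ler_wpM2l].
  rewrite exprVn mulrAC ler_pdivrMr// ler_pdivlMl ?exprn_gt0//.
  by rewrite /M mulrA lerDr ler01.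
Qed.

(** A function with prescribed derivatives at 0 is the sum of corrections; the
    [n]-th one repairs the [n]-th derivative of the previous partial sum and
    leaves the lower ones unchanged. *)
Theorem borel (b : nat -> R) : exists2 F : R -> R, Cinf setT F &
  forall n, derive1n n F 0 = b n.
Proof.
pose c n (v : R) := xget (cst 0) [set f : R -> R | [/\ Cinf setT f,
  forall m, (m < n)%N -> derive1n m f 0 = 0, derive1n n f 0 = v &
  forall m x, (m < n)%N -> `|derive1n m f x| <= 2^-1 ^+ n]].
have cP n v : [/\ Cinf setT (c n v),
  forall m, (m < n)%N -> derive1n m (c n v) 0 = 0, derive1n n (c n v) 0 = v &
  forall m x, (m < n)%N -> `|derive1n m (c n v) x| <= 2^-1 ^+ n].
  by have [f fP] := derivative_correction n v; rewrite /c; case: xgetP => [_ ->//|/(_ f)].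
pose S := fix S n : R -> R := if n is m.+1 then
  fun x => S m x + c m (b m - derive1n m (S m) 0) x else fun=> 0.
pose T n := c n (b n - derive1n n (S n) 0).
have SC n : Cinf setT (S n).
  elim: n => [|n IH]; first exact: (Cinf_cst 0 openT).
  by apply: CinfD => //; [exact: openT|have [] := cP n (b n - derive1n n (S n) 0)].
have TC n : Cinf setT (T n) by have [] := cP n (b n - derive1n n (S n) 0).
have SS m n x : derive1n m (S n.+1) x = derive1n m (S n) x + derive1n m (T n) x.
  suff -> : derive1n m (S n.+1) = fun x => derive1n m (S n) x + derive1n m (T n) x by [].
  elim: m => [|m IH] //; rewrite derive1nS IH; apply: derive1_eq => y.
  by apply: is_deriveD; apply: (@Cinf_is_derive _ setT) => //; exact: Cinf_derive1n.
have bound m n x : (m < n)%N -> `|derive1n m (S n.+1) x - derive1n m (S n) x| <= 2^-1 ^+ n.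
  move=> mn; rewrite SS addrAC subrr add0r.
  by have [_ _ _] := cP n (b n - derive1n n (S n) 0); apply.
pose F m x := limn (fun n => derive1n m (S n) x).
have FD m x : is_derive x (1 : R) (F m) (F m.+1 x).
  apply: (@limit_derive _ (fun n => derive1n m (S n)) (fun n => derive1n m.+1 (S n)) m.+2).
  - move=> n y; rewrite derive1nS; apply: (@Cinf_is_derive _ setT) => //.
    exact: Cinf_derive1n.
  - by move=> n z mn; apply: bound; exact: ltnW.
  - by move=> n z mn; exact: bound.
have FE m : derive1n m (F 0%N) = F m.
  by elim: m => [|m IH] //; rewrite derive1nS IH; apply: derive1_eq => x.
exists (F 0%N).
  apply: (Cinf_coind1 openT (P := fun h => exists m, h = F m)); last by exists 0%N.
  by move=> _ [m ->]; exists (F m.+1) => //; exists m.+1.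
move=> n; rewrite FE /F.
apply/cvg_lim => //; apply: cvg_near_cst; exists n.+1 => // m /= nm.
elim: m nm => // m IH; rewrite ltnS leq_eqVlt => /predU1P[<-|/[dup] nm /IH E].
  by rewrite SS /T; have [_ _ -> _] := cP n (b n - derive1n n (S n) 0); rewrite addrC subrK.
have [_ h0 _ _] := cP m (b m - derive1n m (S m) 0).
by rewrite SS E /T (h0 n nm) addr0.
Qed.

Corollary borel_dq (a : nat -> R) : exists2 F : R -> R, Cinf setT F &
  forall n, iter n dq F 0 = a n.
Proof.
have [F FC Fb] := borel (fun n => n`!%:R * a n); exists F => // n.
have := Fb n; rewrite iter_dq//; apply: mulfI.
by rewrite pnatr_eq0 -lt0n fact_gt0.
Qed.

End Borel.

(** * Flat functions composed with roots *)

Lemma Cinf_local (R : realType) (V W : normedModType R) (U : set V) (f : V -> W) :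
  (forall x, U x -> smooth_at f x) -> Cinf U f.
Proof.
move=> fs n.
have : forall x, U x -> exists A, [/\ open A, A x & class_C n A f].
  by move=> x /fs [A [Ao Ax /(_ n)]]; exists A.
elim: n f {fs} => [|n IH] f fl /=; first by move=> x /fl [A [_ Ax]]; apply.
split=> [x /fl [A [_ Ax [+ _]]]|v]; first exact.
by apply: IH => x /fl [A [Ao Ax [_ /(_ v)]]]; exists A.
Qed.

Lemma Cinf_smooth_at (R : realType) (V W : normedModType R) (U : set V) (f : V -> W) x :
  open U -> U x -> Cinf U f -> smooth_at f x.
Proof. by move=> Uo Ux fC; exists U. Qed.

Section Flat.
Context {R : realType}.
Implicit Types (U : set R) (r rho : R -> R).

(** Flatness at 0 stated as divisibility by every power of [t], a form that
    survives derivation and division at once. *)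
Definition flat U r := forall n, exists2 g, Cinf U g &
  forall t, U t -> r t = t ^+ n * g t.

Lemma flat_Cinf U r : open U -> flat U r -> Cinf U r.
Proof.
move=> Uo /(_ 0%N)[g gC gE]; apply: Cinf_ext gC => // t Ut.
by rewrite gE// expr0 mul1r.
Qed.

(** This quotient is the derivative of [r o rho] read at [t = rho x], when [rho]
    is a root of order [i + 2]. *)
Lemma flat_derive_quotient U r i : open U -> flat U r ->
  flat U (fun t => 'D_1 r t / (i.+2%:R * t ^+ i.+1)).
Proof.
move=> Uo rF n; have [g gC gE] := rF (n + i.+2).+1%N.
exists (fun t => t * ((n + i.+2).+1%:R * g t + t * 'D_1 g t) / i.+2%:R).
  apply: Cinf_local => t Ut; have gs := Cinf_smooth_at Uo Ut gC.
  apply: smooth_atM; last exact: smooth_at_cst.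
  apply: smooth_atM; first exact: smooth_at_id.
  apply: smooth_atD; apply: smooth_atM; [exact: smooth_at_cst|exact: gs|exact: smooth_at_id|].
  exact: smooth_at_derive.
move=> t Ut; have gd := Cinf_is_derive gC Ut; rewrite derive1E in gd.
have H := is_deriveM (is_derive_expn (n + i.+2).+1 t) gd.
have -> : 'D_1 r t = t ^+ (n + i.+2) * ((n + i.+2).+1%:R * g t + t * 'D_1 g t).
  have rd : is_derive t (1 : R) r (t ^+ (n + i.+2) * ((n + i.+2).+1%:R * g t + t * 'D_1 g t)).
    apply: (@near_eq_is_derive _ _ _ ((fun t => t ^+ (n + i.+2).+1) * g)).
      by apply: open_eq_near Uo Ut _ => s Us; rewrite fctE gE.
    by apply: (is_derive_eq H); rewrite /GRing.scale /= exprS; ring.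
  by rewrite derive_val.
have [->|t0] := eqVneq t 0; first by rewrite !expr0n /= !(mulr0, invr0, mul0r).
rewrite exprD (exprS t i.+1); field.
by rewrite expf_neq0// andbT; apply: lt0r_neq0; have := ler0n R i; lra.
Qed.

Lemma is_derive_squeeze (f k : R -> R) : f 0 = 0 -> (forall x, 0 <= k x) ->
  (\forall x \near (0 : R), `|f x| <= `|x| * k x) -> k x @[x --> (0 : R)] --> 0 ->
  is_derive (0 : R) (1 : R) f 0.
Proof.
move=> f0 kp fk k0; apply/is_derive1_caratheodory.
exists (fun x => f x / x); rewrite f0 mul0r; split => //.
  move=> z; rewrite !subr0; have [->|z0] := eqVneq z 0; first by rewrite mulr0 f0.
  by rewrite divfK.
rewrite /prop_for /continuous_at f0 mul0r.
apply: (@squeeze_cvgr _ _ _ _ (fun x => - k x) k) => //; last first.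
  by rewrite -[X in _ --> X]oppr0; exact: cvgN.
near=> x; have := near fk x; rewrite -ler_norml => /(_ _) h.
have [->|x0] := eqVneq x 0.
  by rewrite f0 mul0r normr0.
rewrite normrM normfV ler_pdivrMr ?normr_gt0// mulrC; exact: h.
Unshelve. all: by end_near. Qed.

(** What is needed of the root of order [i + 2]: it may vanish on an open set, as
    the square root, set to 0 on the negative axis, does; elsewhere it has the
    derivative of a root. *)
Definition flat_root i rho := [/\ continuous rho, rho 0 = 0,
  (forall x, `|rho x| ^+ i.+2 <= `|x|) &
  (forall x, x != 0 -> (\forall y \near x, rho y = 0) \/
    (rho x != 0 /\ is_derive x (1 : R) rho (i.+2%:R * rho x ^+ i.+1)^-1))].

(** The functions [r o rho] with [r] flat form a family stable under derivation.
    At 0 the flatness of [r] beats the singularity of the root. *)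
Lemma flat_comp_root U i r rho : open U -> U 0 -> flat U r -> flat_root i rho ->
  smooth_at (fun x => r (rho x)) (0 : R).
Proof.
move=> Uo U0 rF [rhoc rho0 rhoN rhod].
pose U' := rho @^-1` U.
have Uo' : open U' by apply: open_comp => // x _; exact: rhoc.
exists U'; split => //; first by rewrite /U' /preimage /= rho0.
apply: (Cinf_coind1 Uo' (P := fun h => exists2 r, flat U r & h = fun x => r (rho x)));
  last by exists r.
move=> _ {r rF} [r rF ->].
exists (fun x => 'D_1 r (rho x) / (i.+2%:R * rho x ^+ i.+1)).
  by eexists; first exact: (flat_derive_quotient i Uo rF).
have rC := flat_Cinf Uo rF.
move=> x Ux; have [->|x0] := eqVneq x 0.
  rewrite rho0 expr0n /= mulr0 invr0 mulr0.
  have [g gC gE] := rF i.+3.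
  apply: (@is_derive_squeeze _ (fun x => `|rho x * g (rho x)|)).
  - by rewrite rho0 gE// expr0n /= mul0r.
  - by move=> y; exact: normr_ge0.
  - near=> y; have Uy : U (rho y).
      by near: y; apply: open_nbhs_nbhs; split => //; rewrite /U' /preimage /= rho0.
    rewrite gE// exprSr -mulrA normrM normrX ler_wpM2r//.
  - suff : {for 0, continuous (fun y => `|rho y * g (rho y)|)}.
      by rewrite /prop_for /continuous_at rho0 mul0r normr0.
    apply: continuous_comp; last exact: norm_continuous.
    apply: continuousM; first exact: rhoc.
    apply: continuous_comp; first exact: rhoc.
    apply: differentiable_continuous; apply: Cinf_differentiable gC _.
    by rewrite rho0.
have [near0|[rx0 drho]] := rhod x x0.
  rewrite (nbhs_singleton near0) expr0n /= mulr0 invr0 mulr0.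
  apply: (@near_eq_is_derive _ _ _ (cst (r 0))). 
  by near=> y; rewrite (near near0 y).
have rd : is_derive (rho x) (1 : R) r ('D_1 r (rho x)).
  by apply: derivableP; exact: Cinf_derivable rC _.
exact: (@is_derive1_comp _ r rho x _ _ rd drho).
Unshelve. all: by end_near. Qed.

Lemma flat_root_sqrt : flat_root 0 (@Num.sqrt R).
Proof.
split.
- exact: sqrt_continuous.
- exact: sqrtr0.
- move=> x; case: (lerP 0 x) => [x0|/ltW x0]; last by rewrite ler0_sqrtr// normr0 expr0n.
  by rewrite -normrX sqr_sqrtr.
- move=> x x0; have [xp|xn|xe] := ltrgtP x 0.
  + left; near=> y; apply: ler0_sqrtr; apply: ltW.
    by near: y; apply: open_nbhs_nbhs; split => //; exact: open_lt.
  + right; split; first by rewrite gt_eqF// sqrtr_gt0.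
    by rewrite expr1; exact: is_derive1_sqrt.
  + by rewrite xe eqxx in x0.
Unshelve. all: by end_near. Qed.

Definition cbrt (x : R) : R := Num.sg x * `|x| `^ (3^-1).

Lemma cbrtK x : cbrt x ^+ 3 = x.
Proof.
rewrite /cbrt exprMn -(powR_mulrn 3 (powR_ge0 `|x| 3^-1)) -powRrM mulVf ?pnatr_eq0// powRr1//.
rewrite [X in _ = X]numEsg; congr (_ * _).
have [x0|x0|->] := ltrgtP x 0; [rewrite (ltr0_sg x0)|rewrite (gtr0_sg x0)|rewrite sgr0]; by ring.
Qed.

Lemma cube_inj : injective (fun t : R => t ^+ 3).
Proof.
move=> x y /= /eqP; rewrite -subr_eq0 => /eqP xy.
have : (x - y) * (x ^+ 2 + x * y + y ^+ 2) = 0 by rewrite -[RHS]xy; ring.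
move=> /eqP; rewrite mulf_eq0 subr_eq0 => /orP[/eqP//|/eqP h].
have : (x + y / 2) ^+ 2 + 3 / 4 * y ^+ 2 = 0 by rewrite -[RHS]h; field.
have := sqr_ge0 (x + y / 2); have y2 := sqr_ge0 y => x2 e.
have /eqP : y ^+ 2 = 0 by lra.
rewrite sqrf_eq0 => /eqP y0; have /eqP : x ^+ 2 = 0.
  by move: h; rewrite y0 mulr0 expr0n /= !addr0.
by rewrite sqrf_eq0 y0 => /eqP.
Qed.

Lemma cubeK x : cbrt (x ^+ 3) = x.
Proof. by apply: cube_inj; exact: cbrtK. Qed.

Lemma flat_root_cbrt : flat_root 1 cbrt.
Proof.
have ncan : forall x : R, {near x, cancel (fun t : R => t ^+ 3) cbrt}.
  by move=> x; near=> t; exact (cubeK t).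
have ncc : forall x : R, {near x, continuous (fun t : R => t ^+ 3)}.
  by move=> x; near=> t; exact (@exprn_continuous R 3 t).
split.
- move=> x.
  have h : {near (fun t : R => t ^+ 3) (cbrt x), continuous cbrt}.
    exact: near_can_continuous (ncan _) (ncc _).
  by have := nbhs_singleton h; rewrite /= cbrtK.
- by rewrite /cbrt sgr0 mul0r.
- by move=> x; rewrite -normrX cbrtK.
- move=> x x0; right; have c0 : cbrt x != 0.
    by apply: contra_neq x0 => c0; rewrite -[x]cbrtK c0 expr0n.
  split => //; rewrite -{1}[x]cbrtK.
  apply: (@is_derive_inverse _ (fun t => t ^+ 3) cbrt).
  + exact: ncan.
  + exact: ncc.
  + exact: is_derive_expn.
  + by rewrite mulf_neq0 ?expf_neq0// pnatr_eq0.
Unshelve. all: by end_near. Qed.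

End Flat.

(** * Smooth functions as modules over functions of a power *)

Section Decomposition.
Context {R : realType}.

Lemma Cinf_iter_dq U (f : R -> R) n : open U -> U 0 -> Cinf U f -> Cinf U (iter n dq f).
Proof. by move=> Uo U0 fC; elim: n => // n IH; exact: Cinf_dq. Qed.

Lemma iter_dqE (f : R -> R) n t : iter n dq f t = iter n dq f 0 + t * iter n.+1 dq f t.
Proof. exact: dqE. Qed.

Lemma smooth_comp_expn (A : R -> R) (k : nat) (t : R) : Cinf setT A -> smooth_at (fun t : R => A (t ^+ k)) t.
Proof.
move=> AC; apply: (@smooth_at_comp1 _ _ (fun t : R => t ^+ k)).
  by apply: smooth_atX; exact: smooth_at_id.
by exists setT; split => //; exact: openT.
Qed.

(** The formal identity holds when the Taylor coefficients of [A], [B], [C] are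
    those of [f] in the residue classes 0, 1, 2 modulo 3.  The remainder is then
    flat, and a flat function of [t] is a smooth function of [t^3]. *)
Theorem decompose3 (f : R -> R) : smooth_at f (0 : R) ->
  exists A B C, [/\ smooth_at A (0 : R), smooth_at B (0 : R), smooth_at C (0 : R) &
    forall t, f t = A (t ^+ 3) + t * B (t ^+ 3) + t ^+ 2 * C (t ^+ 3)].
Proof.
move=> [U [Uo U0 fC]].
have ex j : exists2 A, Cinf setT A & forall n, iter n dq A 0 = iter (3 * n + j) dq f 0.
  exact: (borel_dq (fun n => iter (3 * n + j) dq f 0)).
have [A AC AE] := ex 0%N; have [B BC BE] := ex 1%N; have [C CC CE] := ex 2%N.
pose r n t := iter (3 * n) dq f t - (iter n dq A (t ^+ 3)
  + t * iter n dq B (t ^+ 3) + t ^+ 2 * iter n dq C (t ^+ 3)).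
have rC n : Cinf U (r n).
  have iC (h : R -> R) (t : R) : Cinf setT h -> smooth_at (fun t : R => iter n dq h (t ^+ 3)) t.
    by move=> hC; apply: smooth_comp_expn; apply: Cinf_iter_dq => //; exact: openT.
  apply: Cinf_local => t Ut; apply: smooth_atB.
    by apply: (Cinf_smooth_at Uo) => //; exact: Cinf_iter_dq.
  apply: smooth_atD; [apply: smooth_atD|]; [exact: iC| |].
    by apply: smooth_atM; [exact: smooth_at_id|exact: iC].
  by apply: smooth_atM; [apply: smooth_atX; exact: smooth_at_id|exact: iC].
have rS n t : r n t = t ^+ 3 * r n.+1 t.
  have F j := iter_dqE f j t.
  rewrite /r mulnS add3n (F (3 * n)%N) (F (3 * n).+1) (F (3 * n).+2).
  rewrite (iter_dqE A n (t ^+ 3)) (iter_dqE B n (t ^+ 3)) (iter_dqE C n (t ^+ 3)).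
  rewrite AE BE CE addn0 addn1 addn2; ring.
have r0 n t : r 0%N t = t ^+ (3 * n) * r n t.
  elim: n => [|n IH]; first by rewrite muln0 expr0 mul1r.
  by rewrite IH rS mulnS exprD; ring.
have rF : flat U (r 0%N).
  move=> n; exists (fun t => t ^+ (2 * n) * r n t).
    apply: Cinf_local => t Ut; apply: smooth_atM; first by apply: smooth_atX; exact: smooth_at_id.
    exact: (Cinf_smooth_at Uo).
  by move=> t Ut; rewrite (r0 n) mulrA -exprD -mulSn.
exists (fun x => A x + r 0%N (cbrt x)), B, C; split.
- apply: smooth_atD; first by apply: (Cinf_smooth_at openT).
  exact: (flat_comp_root Uo U0 rF flat_root_cbrt).
- exact: (Cinf_smooth_at openT).
- exact: (Cinf_smooth_at openT).
- by move=> t; rewrite cubeK /r /=; ring.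
Qed.

(** As in the cubic case, but [t^2] only determines [t] up to sign: the flat
    remainder is first split into its even part and its odd part divided by
    [t], which are functions of [sqrt (t^2)]. *)
Theorem decompose2 (f : R -> R) : smooth_at f (0 : R) ->
  exists A B, [/\ smooth_at A (0 : R), smooth_at B (0 : R) &
    forall t, f t = A (t ^+ 2) + t * B (t ^+ 2)].
Proof.
move=> [U [Uo U0 fC]].
have ex j : exists2 A, Cinf setT A & forall n, iter n dq A 0 = iter (2 * n + j) dq f 0.
  exact: (borel_dq (fun n => iter (2 * n + j) dq f 0)).
have [A AC AE] := ex 0%N; have [B BC BE] := ex 1%N.
pose r n t := iter (2 * n) dq f t - (iter n dq A (t ^+ 2) + t * iter n dq B (t ^+ 2)).
have rs n t : U t -> smooth_at (r n) t.
  have iC (h : R -> R) : Cinf setT h -> smooth_at (fun t : R => iter n dq h (t ^+ 2)) t.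
    by move=> hC; apply: smooth_comp_expn; apply: Cinf_iter_dq => //; exact: openT.
  move=> Ut; apply: smooth_atB.
    by apply: (Cinf_smooth_at Uo) => //; exact: Cinf_iter_dq.
  apply: smooth_atD; first exact: iC.
  by apply: smooth_atM; [exact: smooth_at_id|exact: iC].
have rS n t : r n t = t ^+ 2 * r n.+1 t.
  have F j := iter_dqE f j t.
  rewrite /r mulnS add2n (F (2 * n)%N) (F (2 * n).+1).
  rewrite (iter_dqE A n (t ^+ 2)) (iter_dqE B n (t ^+ 2)).
  rewrite AE BE addn0 addn1; ring.
have rn m n t : r m t = t ^+ (2 * n) * r (m + n)%N t.
  elim: n => [|n IH]; first by rewrite addn0 muln0 expr0 mul1r.
  by rewrite IH rS mulnS exprD addnS; ring.
pose U' := U `&` (-%R @^-1` U).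
have Uo' : open U' by apply: openI => //; apply: open_comp => // x _; exact: opp_continuous.
have U0' : U' 0 by split => //; rewrite /preimage /= oppr0.
have rs' n t : U' t -> smooth_at (fun t : R => r n (- t)) t.
  move=> [_ Ut]; apply: (@smooth_at_comp1 _ _ -%R); last exact: rs.
  by apply: smooth_atN; exact: smooth_at_id.
have eF : flat U' (fun t => (r 0%N t + r 0%N (- t)) / 2).
  move=> n; exists (fun t => t ^+ n * ((r n t + r n (- t)) / 2)).
    apply: Cinf_local => t Ut; apply: smooth_atM; first by apply: smooth_atX; exact: smooth_at_id.
    apply: smooth_atM; last exact: smooth_at_cst.
    by apply: smooth_atD; [apply: rs; case: Ut|exact: rs'].
  move=> t Ut; rewrite (rn 0%N n t) (rn 0%N n (- t)) mulrA -exprD addnn -mul2n.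
  rewrite !exprM sqrrN; ring.
have oF : flat U' (fun t => t * (r 1%N t - r 1%N (- t)) / 2).
  move=> n; exists (fun t => t ^+ n * (t * ((r n.+1 t - r n.+1 (- t)) / 2))).
    apply: Cinf_local => t Ut; apply: smooth_atM; first by apply: smooth_atX; exact: smooth_at_id.
    apply: smooth_atM; first exact: smooth_at_id.
    apply: smooth_atM; last exact: smooth_at_cst.
    by apply: smooth_atB; [apply: rs; case: Ut|exact: rs'].
  move=> t Ut; rewrite (rn 1%N n t) (rn 1%N n (- t)) mulrA -exprD addnn -mul2n.
  rewrite !exprM sqrrN; ring.
exists (fun x => A x + (r 0%N (Num.sqrt x) + r 0%N (- Num.sqrt x)) / 2),
  (fun x => B x + Num.sqrt x * (r 1%N (Num.sqrt x) - r 1%N (- Num.sqrt x)) / 2); split.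
- apply: smooth_atD; first by apply: (Cinf_smooth_at openT).
  exact: (flat_comp_root Uo' U0' eF flat_root_sqrt).
- apply: smooth_atD; first by apply: (Cinf_smooth_at openT).
  exact: (flat_comp_root Uo' U0' oF flat_root_sqrt).
- move=> t; rewrite sqrtr_sqr.
  have rt : r 0%N t = f t - (A (t ^+ 2) + t * B (t ^+ 2)) by [].
  have rS' := rS 0%N t; have := rS 0%N (- t); rewrite sqrrN.
  have -> : f t = A (t ^+ 2) + t * B (t ^+ 2) + r 0%N t by rewrite rt; ring.
  have [t0|/ltW t0] := lerP 0 t; [rewrite (ger0_norm t0)|rewrite (ler0_norm t0) opprK];
    by move=> rSN; rewrite !rS' !rSN; field.
Qed.

End Decomposition.

(** * Inverse functions and roots in one variable *)

Section InverseFunction.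
Context {R : realType}.

Lemma near0_interval (P : R -> Prop) : (\forall t \near (0 : R), P t) ->
  exists2 e : R, 0 < e & forall t, - e < t < e -> P t.
Proof.
move=> /nbhs_ballP [e /= e0 eP]; exists e => // t; rewrite -ltr_norml => te.
by apply: eP; rewrite /ball /= sub0r normrN.
Qed.

Lemma open_interval0 (e : R) : open [set t : R | - e < t < e].
Proof.
rewrite (_ : [set _ | _] = [set t : R | - e < t] `&` [set t : R | t < e]).
  by apply: openI; [exact: open_gt|exact: open_lt].
by apply/seteqP; split => t /=; [move=> /andP[]|move=> [-> ->]].
Qed.

(** The inverse [g] is smooth because the functions [k o g], [k] smooth, form a
    family stable under derivation: [(k o g)' = (k' / f') o g]. *)
Theorem inverse_function (f : R -> R) : smooth_at f (0 : R) -> f 0 = 0 ->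
  derive1 f 0 != 0 -> exists g, inverse_germs (0 : R) (0 : R) f g.
Proof.
move=> fs f0 df0.
have fs' := smooth_at_derive1 fs.
have near_reg : \forall t \near (0 : R), smooth_at f t /\ smooth_at (derive1 f) t /\ derive1 f t != 0.
  have h1 := smooth_near fs; have h2 := smooth_near fs'.
  have h3 : \forall t \near (0 : R), derive1 f t != 0.
    apply: (near_comp (P := fun x : R => x != 0) (smooth_at_continuous fs')).
    by apply: open_nbhs_nbhs; split => //; exact: open_neq.
  by near=> t; split; [near: t|split; near: t].
have [e e0 eP] := near0_interval near_reg.
have fd (t : R) : - e < t < e -> is_derive t (1 : R) f (derive1 f t).
  by move=> /eP[? _]; exact: smooth_at_is_derive.
have inj (x y : R) : - e < x < e -> - e < y < e -> f x = f y -> x = y.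
  wlog xy : x y / x <= y.
    by move=> H ? ? ?; case: (leP x y) => [|/ltW] ?; [|apply/esym]; apply: H.
  move=> xe ye fxy; apply/eqP; rewrite eq_le xy /= leNgt; apply/negP => xltey.
  have int t : x <= t <= y -> - e < t < e by move: xe ye; lra.
  have [||c] := @MVT R f (derive1 f) x y xltey.
  - by move=> t; rewrite in_itv /= => txy; apply: fd; apply: int; lra.
  - apply: derivable_within_continuous => t; rewrite in_itv /= => txy.
    by have [] := fd t (int t txy).
  rewrite in_itv /= => cxy /eqP; rewrite fxy subrr eq_sym mulf_eq0 => /orP[|].
    by apply/negP; have [_ [_]] := eP c (int c ltac:(lra)).
  by rewrite subr_eq0 gt_eqF.
pose g y := xget 0 [set t : R | - e < t < e /\ f t = y].
have fK (t : R) : - e < t < e -> g (f t) = t.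
  move=> te; rewrite /g; case: xgetP => [s _ [se sf]|/(_ t)[]//].
  exact: inj.
have near_int (x : R) : - e < x < e -> \forall t \near x, - e < t < e.
  by move=> xe; apply: open_nbhs_nbhs; split; [exact: open_interval0|].
have near_fK (x : R) : - e < x < e -> {near x, cancel f g}.
  by move=> xe; near=> t; apply: fK; near: t; exact: near_int.
have near_fc (x : R) : - e < x < e -> {near x, continuous f}.
  move=> xe; near=> t; apply: smooth_at_continuous.
  by have [] : smooth_at f t /\ smooth_at (derive1 f) t /\ derive1 f t != 0
    by apply: eP; near: t; exact: near_int.
have zero_e : - e < 0 < e by rewrite oppr_lt0 e0.
have [gc gK] := near_can_continuousAcan_sym (near_fK _ zero_e) (near_fc _ zero_e).
rewrite f0 in gc gK.
have g0 : g 0 = 0 by rewrite -{1}f0 fK.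
have gd : \forall y \near (0 : R), - e < g y < e /\ is_derive y (1 : R) g (derive1 f (g y))^-1.
  have gint : \forall y \near (0 : R), - e < g y < e.
    apply: (near_comp (P := fun t : R => - e < t < e) (nbhs_singleton gc)).
    by rewrite g0; exact: near_int.
  near=> y; have ge : - e < g y < e by near: y.
  split => //; have fgy : f (g y) = y by near: y.
  rewrite -[y in is_derive y]fgy.
  apply: is_derive_inverse; [exact: near_fK|exact: near_fc|exact: fd|].
  by have [_ []] := eP _ ge.
suff gs : smooth_at g (0 : R) by exists g; split => //; exact: near_fK zero_e.
have [d d0 dP] := near0_interval gd.
exists [set y : R | - d < y < d]; split; [exact: (@open_interval0 d)|by rewrite /= oppr_lt0 d0|].
apply: (Cinf_coind1 (@open_interval0 d) (P := fun h => exists2 k,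
  (forall t, - e < t < e -> smooth_at k t) & h = fun y => k (g y))); last first.
  by exists id => // t _; exact: smooth_at_id.
move=> _ [k ks ->].
exists (fun y => (derive1 k (g y)) / (derive1 f (g y))).
  exists (fun t => derive1 k t / derive1 f t) => // t te; have [_ [f's f'0]] := eP t te.
  by apply: smooth_atM; [exact: smooth_at_derive1 (ks t te)|exact: smooth_atV].
move=> y /dP[ge gdy].
exact: (@is_derive1_comp _ k g y _ _ (smooth_at_is_derive (ks _ ge)) gdy).
Unshelve. all: by end_near. Qed.

Definition root i (x : R) : R := expR (ln x / i%:R).

Lemma root_expn i x : (0 < i)%N -> 0 < x -> root i x ^+ i = x.
Proof.
move=> i0 x0; rewrite /root -expRM_natl mulrC divfK ?lnK//.
by rewrite pnatr_eq0 -lt0n.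
Qed.

Lemma root_gt0 i x : 0 < root i x.
Proof. exact: expR_gt0. Qed.

Lemma root1 i : root i 1 = 1.
Proof. by rewrite /root ln1 mul0r expR0. Qed.

Lemma smooth_root (V : normedModType R) i (g : V -> R) x : smooth_at g x -> 0 < g x ->
  smooth_at (fun t => root i (g t)) x.
Proof.
move=> gs g0; apply: (@smooth_at_comp1 _ _ (fun t => ln (g t) / i%:R) expR).
  apply: smooth_atM; last exact: smooth_at_cst.
  by apply: smooth_at_comp1 => //; exact: smooth_at_ln.
exact: smooth_at_expR.
Qed.

Lemma near_cancel (X Y : R -> R) : {for 0, continuous X} -> {for 0, continuous Y} ->
  (\forall t \near (0 : R), t * X t = t * Y t) -> \forall t \near (0 : R), X t = Y t.
Proof.
move=> Xc Yc XY.
have XY0 : X 0 = Y 0.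
  have h1 : X t @[t --> 0^'] --> X 0 by exact: cvg_within_filter Xc.
  have h2 : Y t @[t --> 0^'] --> Y 0 by exact: cvg_within_filter Yc.
  have h3 : X t @[t --> 0^'] --> Y 0.
    apply: cvg_trans h2; apply: near_eq_cvg; near=> t.
    have t0 : t != 0 by near: t; exact: nbhs_dnbhs_neq.
    apply: (mulfI t0); apply/esym; near: t; apply: nbhs_dnbhs; exact: XY.
  by rewrite -(cvg_lim (@Rhausdorff R) h1) (cvg_lim (@Rhausdorff R) h3).
near=> t; have [->//|t0] := eqVneq t 0.
by apply: (mulfI t0); near: t.
Unshelve. all: by end_near. Qed.

End InverseFunction.

(** * Reparametrizations and shears of plane curves *)

Ltac smooth := repeat first
  [ assumption | exact: smooth_at_cst | exact: smooth_at_id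
  | apply: smooth_at_pair | apply: smooth_atB | apply: smooth_atD | apply: smooth_atN
  | apply: smooth_atX | apply: smooth_atM
  | apply: smooth_at_fst | apply: smooth_at_snd ].

Section CurveEquivalence.
Context {R : realType}.
Implicit Types c d e : R -> R * R.

Lemma curve_equiv_trans c d e : A_equivalent c 0 d 0 -> A_equivalent d 0 e 0 ->
  A_equivalent c 0 e 0.
Proof.
have F1 := @finite_frame_field R; have F2 := finite_frame_prod F1 F1.
exact: (A_equivalent_trans F1 F1 F1 F2 F2 F2).
Qed.

Lemma A_equivalent_reparam (V W X : normedModType R) (f : V -> W) p (g : X -> W) q phi :
  diffeo_germ p q phi -> (\forall x \near p, f x = g (phi x)) -> A_equivalent f p g q.
Proof.
move=> dphi fg; exists phi, id; split => //.
have -> : f p = g q by rewrite (nbhs_singleton fg); case: dphi => psi [[-> _] _ _ _].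
by exists id; split => //; [split; exact: smooth_at_id|exact: nearW|exact: nearW].
Qed.

Lemma A_equivalent_target (V W X : normedModType R) (f : V -> W) p (g : V -> X) Phi :
  diffeo_germ (f p) (g p) Phi -> (\forall x \near p, Phi (f x) = g x) ->
  A_equivalent f p g p.
Proof.
move=> dPhi fg; exists id, Phi; split => //.
by exists id; split => //; [split; exact: smooth_at_id|exact: nearW|exact: nearW].
Qed.

Lemma A_equivalent_target_bij (V W X : normedModType R) (f : V -> W) p
    (F : W -> X) (G : X -> W) :
  smooth_at F (f p) -> smooth_at G (F (f p)) -> cancel F G -> cancel G F ->
  A_equivalent f p (fun x => F (f x)) p.
Proof.
move=> Fs Gs FG GF; apply: (@A_equivalent_target _ _ _ f p _ F); last exact: nearW.
by exists G; split => //; exact: nearW.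
Qed.

Lemma linear_shear_equiv (a b al : R) (z y : R -> R) : a != 0 -> b != 0 ->
  A_equivalent (fun t => (z t, y t)) 0
    (fun t => (a * (z t + al * y t), b * y t)) 0.
Proof.
move=> a0 b0.
apply: (@A_equivalent_target_bij _ _ _ _ _
  (fun p : R * R => (a * (p.1 + al * p.2), b * p.2))
  (fun p : R * R => (a^-1 * p.1 - al * (b^-1 * p.2), b^-1 * p.2))).
- by smooth.
- by smooth.
- by move=> [u v] /=; congr (_, _); field; rewrite ?a0 ?b0.
- by move=> [u v] /=; congr (_, _); field; rewrite ?a0 ?b0.
Qed.

Lemma quadratic_shear_equiv (ka : R) (z y : R -> R) :
  A_equivalent (fun t => (z t, y t)) 0 (fun t => (z t, y t + ka * z t ^+ 2)) 0.
Proof.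
apply: (@A_equivalent_target_bij _ _ _ _ _
  (fun p : R * R => (p.1, p.2 + ka * p.1 ^+ 2))
  (fun p : R * R => (p.1, p.2 - ka * p.1 ^+ 2))).
- by smooth.
- by smooth.
- by move=> [u v] /=; congr (_, _); ring.
- by move=> [u v] /=; congr (_, _); ring.
Qed.

(** The new parameter is [t h], where [h^i = g].  The equation for [q'] is kept
    in the old parameter, which is all that is needed to compare Taylor
    coefficients of [q] and [q']. *)
Lemma straighten i j (g q : R -> R) : (0 < i)%N ->
  smooth_at g (0 : R) -> smooth_at q (0 : R) -> g 0 = 1 ->
  exists h q' : R -> R, [/\ smooth_at h (0 : R) /\ h 0 = 1,
    (\forall t \near (0 : R), h t ^+ i = g t),
    smooth_at q' (0 : R),
    (\forall t \near (0 : R), q' (t * h t) * h t ^+ j = q t) &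
    A_equivalent (fun t : R => (t ^+ i * g t, t ^+ j * q t)) 0
                 (fun t : R => (t ^+ i, t ^+ j * q' t)) 0].
Proof.
move=> i0 gs qs g0.
pose h t := root i (g t).
have hs : smooth_at h (0 : R) by apply: smooth_root => //; rewrite g0.
have h0 : h 0 = 1 by rewrite /h g0 root1.
have gpos : \forall t \near (0 : R), 0 < g t.
  apply: (near_comp (P := fun x : R => 0 < x) (smooth_at_continuous gs)).
  by apply: open_nbhs_nbhs; split; [exact: open_gt|rewrite /= g0].
have hg : \forall t \near (0 : R), h t ^+ i = g t.
  by near=> t; rewrite /h root_expn//; near: t.
have ts : smooth_at (fun t : R => t * h t) (0 : R) by smooth.
have dt : derive1 (fun t : R => t * h t) 0 = 1.
  have H := is_deriveM (is_derive_id (0 : R) 1) (smooth_at_is_derive hs).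
  by rewrite derive1E (@derive_val _ _ _ _ _ _ _ H) h0 scale0r add0r scale1r.
have dt0 : derive1 (fun t : R => t * h t) 0 != 0 by rewrite dt oner_eq0.
have [s sP] := inverse_function ts (mul0r (h 0)) dt0.
case: (sP) => [[_ s0] [_ ss] st ts'].
have hpos t : h t != 0 by rewrite gt_eqF// root_gt0.
pose q' t := q (s t) / h (s t) ^+ j.
exists h, q'; split => //.
- apply: smooth_atM; first by apply: smooth_at_comp1 => //; rewrite s0.
  apply: smooth_atV; last by rewrite expf_neq0.
  by apply: smooth_atX; apply: smooth_at_comp1 => //; rewrite s0.
- by near=> t; rewrite /q' (near st t)// divfK// expf_neq0.
- apply: (@A_equivalent_reparam _ _ _ _ _ _ _ (fun t : R => t * h t)); first by exists s.
  near=> t; congr (_, _); first by rewrite exprMn (near hg t).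
  by rewrite /q' (near st t)// exprMn mulrACA mulfV ?mulr1// expf_neq0.
Unshelve. all: by end_near. Qed.

End CurveEquivalence.

(** * Normal forms of cusps *)

Section NormalForms.
Context {R : realType}.

(** With [w = (y - al) / be] the equation [y = al + Y be + Y^2 ka] reads
    [Y + (ka / be) Y^2 = w]; the root close to 0 is [2 w / (1 + sqrt D)] with
    [D = 1 + 4 (ka / be) w], a form that stays smooth where [ka] vanishes. *)
Lemma quadratic_target (al be ka : R -> R) :
  smooth_at al (0 : R) -> smooth_at be (0 : R) -> smooth_at ka (0 : R) ->
  al 0 = 0 -> be 0 != 0 ->
  diffeo_germ ((0, 0) : R * R) ((0, 0) : R * R)
    (fun p => (p.1, al p.1 + p.2 * be p.1 + p.2 ^+ 2 * ka p.1)).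
Proof.
move=> als bes kas al0 be0.
have fs (k : R -> R) : smooth_at k (0 : R) -> smooth_at (fun p : R * R => k p.1) ((0, 0) : R * R).
  by move=> ks; apply: (@smooth_at_comp1 _ _ fst k) => //; smooth.
have alf := fs _ als; have bef := fs _ bes; have kaf := fs _ kas.
pose w (p : R * R) := (p.2 - al p.1) / be p.1.
pose D (p : R * R) := 1 + 4 * (ka p.1 / be p.1 * w p).
have ws : smooth_at w ((0, 0) : R * R).
  by apply: smooth_atM; [smooth|exact: smooth_atV].
have w0 : w (0, 0) = 0 by rewrite /w /= al0 subrr mul0r.
have Ds : smooth_at D ((0, 0) : R * R).
  apply: smooth_atD; first exact: smooth_at_cst.
  apply: smooth_atM; first exact: smooth_at_cst.
  by apply: smooth_atM => //; apply: smooth_atM => //; exact: smooth_atV.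
have D0 : D (0, 0) = 1 by rewrite /D w0 !mulr0 addr0.
have rs : smooth_at (fun p => root 2 (D p)) ((0, 0) : R * R).
  by apply: smooth_root => //; rewrite D0.
pose phi (p : R * R) := (p.1, al p.1 + p.2 * be p.1 + p.2 ^+ 2 * ka p.1).
pose psi (p : R * R) := (p.1, w p * 2 / (1 + root 2 (D p))).
have rp p : 1 + root 2 (D p) != 0 by rewrite gt_eqF// addr_gt0// root_gt0.
have phis : smooth_at phi ((0, 0) : R * R).
  apply: smooth_at_pair; first by smooth.
  by apply: smooth_atD; [apply: smooth_atD => //|]; apply: smooth_atM => //; smooth.
have psis : smooth_at psi ((0, 0) : R * R).
  apply: smooth_at_pair; first by smooth.
  apply: smooth_atM; first by smooth.
  by apply: smooth_atV => //; apply: smooth_atD => //; exact: smooth_at_cst.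
have phi0 : phi (0, 0) = (0, 0) by rewrite /phi /= al0 !mul0r expr0n /= mul0r !addr0.
have psi0 : psi (0, 0) = (0, 0) by rewrite /psi /= w0 !mul0r.
have near_be : \forall p \near ((0, 0) : R * R), be p.1 != 0.
  apply: (near_comp (P := fun x : R => x != 0) (smooth_at_continuous bef)).
  by apply: open_nbhs_nbhs; split; [exact: open_neq|].
exists psi; split => //.
- pose L (p : R * R) := 1 + 2 * (ka p.1 / be p.1 * p.2).
  have Ls : smooth_at L ((0, 0) : R * R).
    apply: smooth_atD; first exact: smooth_at_cst.
    apply: smooth_atM; first exact: smooth_at_cst.
    by apply: smooth_atM; [apply: smooth_atM => //; exact: smooth_atV|smooth].
  have Lpos : \forall p \near ((0, 0) : R * R), 0 < L p.
    apply: (near_comp (P := fun x : R => 0 < x) (smooth_at_continuous Ls)).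
    by apply: open_nbhs_nbhs; split; [exact: open_gt|rewrite /L /= !mulr0 addr0].
  near=> p.
  have bp : be p.1 != 0 by near: p.
  have Lp : 0 < L p by near: p.
  have DL : D (phi p) = L p ^+ 2.
    by rewrite /D /w /phi /L /=; field.
  have rL : root 2 (D (phi p)) = L p.
    apply/eqP; rewrite -(@eqrXn2 _ 2)// ?ltW ?root_gt0// root_expn// DL// exprn_gt0//.
  have L1 : be p.1 + ka p.1 * p.2 != 0.
    have -> : be p.1 + ka p.1 * p.2 = (1 + L p) / 2 * be p.1 by rewrite /L; field.
    by rewrite mulf_neq0// mulf_neq0// ?invr_eq0 ?pnatr_eq0// gt_eqF// addr_gt0.
  rewrite /psi rL [RHS]surjective_pairing; congr (_, _).
  rewrite /w /phi /L /=; field; rewrite bp /=.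
  by rewrite (_ : be p.1 + _ = 2 * (be p.1 + ka p.1 * p.2)) ?mulf_neq0 ?pnatr_eq0//; ring.
- have Dpos : \forall p \near ((0, 0) : R * R), 0 < D p.
    apply: (near_comp (P := fun x : R => 0 < x) (smooth_at_continuous Ds)).
    by apply: open_nbhs_nbhs; split; [exact: open_gt|rewrite /= D0].
  near=> p.
  have bp : be p.1 != 0 by near: p.
  have Dp : 0 < D p by near: p.
  have := root_expn (isT : (0 < 2)%N) Dp; have := rp p; set r := root 2 (D p).
  move=> r1; rewrite {1}/D => rE; rewrite /psi [RHS]surjective_pairing; congr (_, _) => /=.
  rewrite -/r.
  have kE : ka p.1 * w p = (r ^+ 2 - 1) / 4 * be p.1 by rewrite rE; field.
  have wE : p.2 = al p.1 + w p * be p.1 by rewrite /w; field.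
  rewrite [RHS]wE -!addrA; congr (_ + _).
  transitivity (w p * 2 / (1 + r) * be p.1 + 4 * w p / (1 + r) ^+ 2 * (ka p.1 * w p)).
    by field.
  by rewrite kE; field.
Unshelve. all: by end_near. Qed.

Definition model_curve i j : R -> R * R := fun t : R => (t ^+ i, t ^+ j).

Lemma smooth_model_curve i j (t : R) : smooth_at (model_curve i j) t.
Proof. by rewrite /model_curve; smooth. Qed.

Lemma quadratic_normal_form i j (al be ka y : R -> R) : (0 < i)%N -> (0 < j)%N ->
  smooth_at al (0 : R) -> smooth_at be (0 : R) -> smooth_at ka (0 : R) ->
  al 0 = 0 -> be 0 != 0 ->
  (\forall t \near (0 : R),
    y t = al (t ^+ i) + t ^+ j * be (t ^+ i) + (t ^+ j) ^+ 2 * ka (t ^+ i)) ->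
  A_equivalent (fun t : R => (t ^+ i, y t)) 0 (model_curve i j) 0.
Proof.
move=> i0 j0 als bes kas al0 be0 yE.
apply: A_equivalent_sym; first exact: smooth_at_continuous (smooth_model_curve _ _ _).
have := quadratic_target als bes kas al0 be0.
set F := (fun p : R * R => _) => dF.
apply: (@A_equivalent_target R _ _ _ _ _ _ F).
  rewrite /model_curve !expr0n (gtn_eqF i0) (gtn_eqF j0) /= (_ : y 0 = 0) //.
  by rewrite (nbhs_singleton yE) !expr0n (gtn_eqF i0) (gtn_eqF j0) /= al0 expr0n /= !mul0r !addr0.
by near=> t; rewrite /model_curve /F /= (near yE t).
Unshelve. all: by end_near. Qed.

Lemma normalize_first (z y : R -> R) a : a != 0 ->
  A_equivalent (fun t => (z t, y t)) 0 (fun t => (a^-1 * z t, y t)) 0.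
Proof.
move=> a0; have := linear_shear_equiv 0 z y (invr_neq0 a0) (oner_neq0 _).
rewrite (_ : (fun t => (_ * (_ + _), _)) = fun t => (a^-1 * z t, y t))//.
by apply/funext => t; rewrite mul0r addr0 mul1r.
Qed.

Lemma straighten_curve i j (p q : R -> R) : (0 < i)%N ->
  smooth_at p (0 : R) -> smooth_at q (0 : R) -> p 0 != 0 ->
  exists q' : R -> R, [/\ smooth_at q' (0 : R), q' 0 = q 0 &
    A_equivalent (fun t : R => (t ^+ i * p t, t ^+ j * q t)) 0
                 (fun t : R => (t ^+ i, t ^+ j * q' t)) 0].
Proof.
move=> i0 ps qs p0.
have gs : smooth_at (fun t => (p 0)^-1 * p t) (0 : R) by smooth.
have [h [q' [[hs h0] _ qs' qq' E]]] := straighten j i0 gs qs (mulVf p0).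
exists q'; split => //.
  by have := nbhs_singleton qq'; rewrite h0 expr1n mul0r mulr1.
apply: curve_equiv_trans E.
have := normalize_first (fun t : R => t ^+ i * p t) (fun t : R => t ^+ j * q t) p0.
by rewrite (_ : (fun t => (_ * (_ * _), _)) = fun t : R => (t ^+ i * ((p 0)^-1 * p t), t ^+ j * q t))//;
  apply/funext => t; rewrite mulrCA.
Qed.

(** An odd cusp of order 2 needs no linear change: the semigroup generated by 2
    and [2 m + 1] contains every exponent from [2 m] on. *)
Lemma cusp2_normal_form m (p q : R -> R) :
  smooth_at p (0 : R) -> smooth_at q (0 : R) -> p 0 != 0 -> q 0 != 0 ->
  A_equivalent (fun t : R => (t ^+ 2 * p t, t ^+ m.*2.+1 * q t)) 0 (model_curve 2 m.*2.+1) 0.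
Proof.
move=> ps qs p0 q0.
have [q1 [q1s q10 E1]] := straighten_curve m.*2.+1 (isT : (0 < 2)%N) ps qs p0.
apply: curve_equiv_trans E1 _.
have [A [B [As Bs AB]]] := decompose2 q1s.
have A0 : A 0 = q1 0 by rewrite AB expr0n /= mul0r addr0.
apply: (@quadratic_normal_form _ _ (fun x => x ^+ m.+1 * B x) A (fun=> 0)) => //.
- by smooth.
- by smooth.
- by rewrite expr0n /= mul0r.
- by rewrite A0 q10.
- near=> t; rewrite mulr0 addr0 {1}AB -exprM mul2n doubleS !exprS; ring.
Unshelve. all: by end_near. Qed.

Lemma second_difference (q : R -> R) : smooth_at q (0 : R) ->
  exists a1 q2, smooth_at q2 (0 : R) /\ forall t, q t = q 0 + a1 * t + t ^+ 2 * q2 t.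
Proof.
move=> /hadamard [q1 [/hadamard [q2 [q2s _ q2E]] _ q1E]].
by exists (q1 0), q2; split => // t; rewrite q1E q2E; ring.
Qed.

(** Without a term of order 5, the last gap of the semigroup of 3 and 4, the orders 6,
    7, 8 of the remaining terms are those of [z^2], [z Y], [Y^2]. *)
Lemma cusp34_reduced a (q : R -> R) : smooth_at q (0 : R) -> a != 0 ->
  A_equivalent (fun t : R => (t ^+ 3, t ^+ 4 * (a + t ^+ 2 * q t))) 0 (model_curve 3 4) 0.
Proof.
move=> qs a0; have [A [B [C [As Bs Cs E]]]] := decompose3 qs.
apply: (@quadratic_normal_form _ _ (fun x => x ^+ 2 * A x) (fun x => a + x * B x) C) => //.
- by smooth.
- by smooth.
- by rewrite expr0n /= mul0r.
- by rewrite mul0r addr0.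
- by near=> t; rewrite E; ring.
Unshelve. all: by end_near. Qed.

(** Without a term of order 7, the last gap of the semigroup of 3 and 5, the
    orders 6, 8, 9, 10 are those of [z^2], [z Y], [z^3], [Y^2]. *)
Lemma cusp35_reduced a b (q : R -> R) : smooth_at q (0 : R) -> a != 0 ->
  A_equivalent (fun t : R => (t ^+ 3, t ^+ 5 * (a + b * t + t ^+ 3 * q t))) 0 (model_curve 3 5) 0.
Proof.
move=> qs a0; have [A [B [C [As Bs Cs E]]]] := decompose3 qs.
apply: (@quadratic_normal_form _ _ (fun x => b * x ^+ 2 + x ^+ 3 * B x)
  (fun x => a + x * A x) C) => //.
- by smooth.
- by smooth.
- by rewrite !expr0n /= mulr0 mul0r addr0.
- by rewrite mul0r addr0.
- by near=> t; rewrite E; ring.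
Unshelve. all: by end_near. Qed.

Lemma shear_first i j k al (q : R -> R) : j = (i + k)%N ->
  A_equivalent (fun t : R => (t ^+ i, t ^+ j * q t)) 0
    (fun t : R => (t ^+ i * (1 + al * (t ^+ k * q t)), t ^+ j * q t)) 0.
Proof.
move=> ->.
have := linear_shear_equiv al (fun t : R => t ^+ i) (fun t : R => t ^+ (i + k) * q t) (oner_neq0 _) (oner_neq0 _).
rewrite (_ : (fun t => (_ * (_ + _), _)) = fun t : R => (t ^+ i * (1 + al * (t ^+ k * q t)), t ^+ (i + k) * q t))//.
by apply/funext => t; rewrite !mul1r exprD; congr (_, _); ring.
Qed.

(** Adding [al y] to the first coordinate changes the parameter to
    [t (1 + al a0 t / 3 + ...)], which changes the coefficient [a1] of [t^5] in
    the second coordinate to [a1 - 4 al a0^2 / 3]; this is 0 for the chosen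
    [al]. *)
Theorem cusp34_normal_form (p q : R -> R) :
  smooth_at p (0 : R) -> smooth_at q (0 : R) -> p 0 != 0 -> q 0 != 0 ->
  A_equivalent (fun t : R => (t ^+ 3 * p t, t ^+ 4 * q t)) 0 (model_curve 3 4) 0.
Proof.
move=> ps qs p0 q0.
have [q1 [q1s q10 E1]] := straighten_curve 4 (isT : (0 < 3)%N) ps qs p0.
apply: curve_equiv_trans E1 _; rewrite -q10 in q0.
have [c [c_s c0 cE]] := hadamard q1s; set a1 := c 0; set a0 := q1 0 in q0 cE.
pose al := 3 * a1 / (4 * a0 ^+ 2).
apply: curve_equiv_trans (shear_first al q1 (erefl : 4%N = (3 + 1)%N)) _.
have gs : smooth_at (fun t : R => 1 + al * (t ^+ 1 * q1 t)) (0 : R) by smooth.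
have g0 : 1 + al * ((0:R) ^+ 1 * q1 0) = 1 by rewrite expr1 mul0r mulr0 addr0.
have [h [q2 [[hs h0] h3 q2s q2E E2]]] := straighten 4 (isT : (0 < 3)%N) gs q1s g0.
apply: curve_equiv_trans E2 _.
have [k [ks k_ kE]] := hadamard hs; rewrite h0 in kE.
have [b [bs b_ bE]] := hadamard q2s.
have q20 : q2 0 = a0 by have := nbhs_singleton q2E; rewrite mul0r h0 expr1n mulr1.
rewrite q20 in bE.
have bhs : smooth_at (fun t : R => b (t * h t)) (0 : R).
  by apply: (@smooth_at_comp1 _ _ (fun t : R => t * h t)); [smooth|rewrite mul0r].
have k0 : 3 * k 0 = al * a0.
  have : \forall t \near (0 : R),
      3 * k t + 3 * t * k t ^+ 2 + t ^+ 2 * k t ^+ 3 = al * q1 t.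
    apply: near_cancel; [by apply: smooth_at_continuous; smooth|by apply: smooth_at_continuous; smooth|].
    near=> t; have : h t ^+ 3 = 1 + al * (t ^+ 1 * q1 t) by near: t.
    rewrite kE => e; apply/eqP; rewrite -subr_eq0; apply/eqP.
    by move/eqP: e; rewrite -subr_eq0 => /eqP <-; ring.
  by move=> /nbhs_singleton; rewrite !mulr0 !mul0r expr0n /= mul0r !addr0.
have b0 : b 0 = 0.
  have : \forall t \near (0 : R),
      h t * b (t * h t) * h t ^+ 4 + a0 * (4 * k t + 6 * t * k t ^+ 2
        + 4 * t ^+ 2 * k t ^+ 3 + t ^+ 3 * k t ^+ 4) = c t.
    apply: near_cancel; [by apply: smooth_at_continuous; smooth|exact: smooth_at_continuous|].
    near=> t; have : q2 (t * h t) * h t ^+ 4 = q1 t by near: t.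
    rewrite bE cE => e; apply/eqP; rewrite -subr_eq0; apply/eqP.
    by move/eqP: e; rewrite -subr_eq0 => /eqP <-; rewrite kE; ring.
  move=> /nbhs_singleton; rewrite !(mulr0, mul0r) h0 expr1n !expr0n /= !(mul0r, mulr0, addr0, mul1r, mulr1) -/a1 => e.
  have : b 0 = a1 - a0 * (4 * k 0) by rewrite -e; ring.
  have -> : k 0 = al * a0 / 3 by rewrite -k0; field.
  by move=> ->; rewrite /al; field.
have [b1 [b1s _ b1E]] := hadamard bs; rewrite b0 in b1E.
have -> : (fun t : R => (t ^+ 3, t ^+ 4 * q2 t)) = fun t : R => (t ^+ 3, t ^+ 4 * (a0 + t ^+ 2 * b1 t)).
  by apply/funext => t; congr (_, _); rewrite bE b1E; ring.
exact: cusp34_reduced.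
Unshelve. all: by end_near. Qed.

(** Adding [al y] to the first coordinate changes the parameter to
    [t (1 + al a0 t^2 / 3 + ...)], which keeps the coefficient of [t^6] and
    changes the coefficient [a2] of [t^7] to [a2 - 5 al a0^2 / 3]; this is 0 for
    the chosen [al]. *)
Theorem cusp35_normal_form (p q : R -> R) :
  smooth_at p (0 : R) -> smooth_at q (0 : R) -> p 0 != 0 -> q 0 != 0 ->
  A_equivalent (fun t : R => (t ^+ 3 * p t, t ^+ 5 * q t)) 0 (model_curve 3 5) 0.
Proof.
move=> ps qs p0 q0.
have [q1 [q1s q10 E1]] := straighten_curve 5 (isT : (0 < 3)%N) ps qs p0.
apply: curve_equiv_trans E1 _; rewrite -q10 in q0.
have [a1 [c [c_s cE]]] := second_difference q1s; set a2 := c 0; set a0 := q1 0 in q0 cE.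
pose al := 3 * a2 / (5 * a0 ^+ 2).
apply: curve_equiv_trans (shear_first al q1 (erefl : 5%N = (3 + 2)%N)) _.
have gs : smooth_at (fun t : R => 1 + al * (t ^+ 2 * q1 t)) (0 : R) by smooth.
have g0 : 1 + al * ((0:R) ^+ 2 * q1 0) = 1 by rewrite expr0n /= mul0r mulr0 addr0.
have [h [q2 [[hs h0] h3 q2s q2E E2]]] := straighten 5 (isT : (0 < 3)%N) gs q1s g0.
apply: curve_equiv_trans E2 _.
have [k [ks _ kE]] := hadamard hs; rewrite h0 in kE.
have kE3 : \forall t \near (0 : R),
    3 * k t + 3 * t * k t ^+ 2 + t ^+ 2 * k t ^+ 3 = al * t * q1 t.
  apply: near_cancel; [by apply: smooth_at_continuous; smooth|by apply: smooth_at_continuous; smooth|].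
  near=> t; have : h t ^+ 3 = 1 + al * (t ^+ 2 * q1 t) by near: t.
  rewrite kE => e; apply/eqP; rewrite -subr_eq0; apply/eqP.
  by move/eqP: e; rewrite -subr_eq0 => /eqP <-; ring.
have k0 : k 0 = 0.
  have := nbhs_singleton kE3; rewrite !(mulr0, mul0r) expr0n /= mul0r !addr0 => /eqP.
  by rewrite mulf_eq0 pnatr_eq0 => /eqP.
have [m [ms _ mE]] := hadamard ks; rewrite k0 in mE.
have m0 : 3 * m 0 = al * a0.
  have : \forall t \near (0 : R),
      3 * m t + 3 * t ^+ 2 * m t ^+ 2 + t ^+ 4 * m t ^+ 3 = al * q1 t.
    apply: near_cancel; [by apply: smooth_at_continuous; smooth|by apply: smooth_at_continuous; smooth|].
    near=> t; have : 3 * k t + 3 * t * k t ^+ 2 + t ^+ 2 * k t ^+ 3 = al * t * q1 t by near: t.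
    rewrite mE => e; apply/eqP; rewrite -subr_eq0; apply/eqP.
    by move/eqP: e; rewrite -subr_eq0 => /eqP <-; ring.
  by move=> /nbhs_singleton; rewrite !expr0n /= !(mulr0, mul0r) !addr0.
have [b1 [b [bs bE]]] := second_difference q2s.
have q20 : q2 0 = a0 by have := nbhs_singleton q2E; rewrite mul0r h0 expr1n mulr1.
rewrite q20 in bE.
have bhs : smooth_at (fun t : R => b (t * h t)) (0 : R).
  by apply: (@smooth_at_comp1 _ _ (fun t : R => t * h t)); [smooth|rewrite mul0r].
pose G t := 5 * m t + 10 * t ^+ 2 * m t ^+ 2 + 10 * t ^+ 4 * m t ^+ 3
  + 5 * t ^+ 6 * m t ^+ 4 + t ^+ 8 * m t ^+ 5.
have Gs : smooth_at G (0 : R) by rewrite /G; smooth.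
have h5 t : h t ^+ 5 = 1 + t ^+ 2 * G t by rewrite kE mE /G; ring.
have eq1 : \forall t \near (0 : R),
    (b1 * h t + t * h t ^+ 2 * b (t * h t)) * h t ^+ 5 + t * (a0 * G t) = a1 + t * c t.
  apply: near_cancel; [by apply: smooth_at_continuous; smooth|by apply: smooth_at_continuous; smooth|].
  near=> t; have : q2 (t * h t) * h t ^+ 5 = q1 t by near: t.
  rewrite bE cE => e; apply/eqP; rewrite -subr_eq0; apply/eqP.
  by move/eqP: e; rewrite -subr_eq0 => /eqP <-; rewrite !h5; ring.
have b1E : b1 = a1.
  by have := nbhs_singleton eq1; rewrite h0 !expr1n !(mul0r, mulr1, addr0).
have b0 : b 0 = 0.
  have : \forall t \near (0 : R),
      h t ^+ 2 * b (t * h t) * h t ^+ 5 + a0 * G t + b1 * t * (m t + h t * G t) = c t.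
    apply: near_cancel; [by apply: smooth_at_continuous; smooth|exact: smooth_at_continuous|].
    near=> t; have : (b1 * h t + t * h t ^+ 2 * b (t * h t)) * h t ^+ 5 + t * (a0 * G t) = a1 + t * c t by near: t.
    rewrite -b1E => e; apply/eqP; rewrite -subr_eq0; apply/eqP.
    by move/eqP: e; rewrite -subr_eq0 => /eqP <-; rewrite !h5 (kE t) mE; ring.
  move=> /nbhs_singleton; rewrite /G h0 !expr1n !expr0n /= !(mul0r, mulr0, addr0, mul1r, mulr1) -/a2 => e.
  have : b 0 = a2 - a0 * (5 * m 0) by rewrite -e; ring.
  have -> : m 0 = al * a0 / 3 by rewrite -m0; field.
  by move=> ->; rewrite /al; field.
have [b2 [b2s _ b2E]] := hadamard bs; rewrite b0 in b2E.
have -> : (fun t : R => (t ^+ 3, t ^+ 5 * q2 t)) = fun t : R => (t ^+ 3, t ^+ 5 * (a0 + b1 * t + t ^+ 3 * b2 t)).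
  by apply/funext => t; congr (_, _); rewrite bE b2E; ring.
exact: cusp35_reduced.
Unshelve. all: by end_near. Qed.

End NormalForms.

(** * Helicoidal surfaces as cylinders *)

Section Cylinders.
Context {R : realType}.

Definition lift (s : R) (y : R * R) : R * R * R := (s, y.1, y.2).

Definition cylinder (c : R -> R * R) : R * R -> R * R * R := fun p => lift p.1 (c p.2).

Definition plane_part (q : R * R * R) : R * R := (q.1.2, q.2).

Lemma smooth_plane_fun (V : normedModType R) (X : normedModType R) (f : V -> R * R) (g : R * R -> X) p :
  finite_frame X -> smooth_at f p -> smooth_at g (f p) -> smooth_at (fun x => g (f x)) p.
Proof.
move=> FX; have F1 := @finite_frame_field R.
exact: smooth_at_comp (finite_frame_prod F1 F1) FX.
Qed.

Lemma inverse_germs_lift_source (t s : R -> R) : inverse_germs (0 : R) (0 : R) t s ->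
  inverse_germs ((0, 0) : R * R) ((0, 0) : R * R) (fun p => (p.1, t p.2)) (fun p => (p.1, s p.2)).
Proof.
move=> [[t0 s0] [ts ss] st ts'].
have near2 (P : R -> Prop) : (\forall x \near (0 : R), P x) ->
    \forall p \near ((0, 0) : R * R), P p.2.
  move=> P0; apply: (near_comp (f := snd) (p := ((0, 0) : R * R)) (P := P)) P0.
  exact: cvg_snd.
split => /=.
- by rewrite t0 s0.
- by split; (apply: smooth_at_pair; [smooth|apply: (@smooth_at_comp1 _ _ snd) => //; smooth]).
- by apply: filterS (near2 _ st) => -[x y] /= ->.
- by apply: filterS (near2 _ ts') => -[x y] /= ->.
Qed.

Lemma inverse_germs_lift_target (y z : R * R) F G : inverse_germs y z F G ->
  inverse_germs (lift 0 y) (lift 0 z)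
    (fun q => lift q.1.1 (F (plane_part q))) (fun q => lift q.1.1 (G (plane_part q))).
Proof.
move=> [[Fy Gz] [Fs Gs] GF FG].
have pl (w : R * R) : plane_part (lift 0 w) = w by case: w.
have F1 := @finite_frame_field R; have F2 := finite_frame_prod F1 F1.
have pls q : smooth_at plane_part (q : R * R * R) by rewrite /plane_part; smooth.
have near2 (P : R * R -> Prop) w : (\forall x \near w, P x) ->
    \forall q \near lift 0 w, P (plane_part q).
  move=> Pw; apply: (near_comp (smooth_at_continuous (pls _))); by rewrite pl.
split => /=.
- by rewrite !pl Fy Gz.
- by split; apply: smooth_at_pair; [apply: smooth_at_pair; [smooth|]| |apply: smooth_at_pair; [smooth|]|];
    [apply: smooth_at_fst|apply: smooth_at_snd|apply: smooth_at_fst|apply: smooth_at_snd];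
    apply: smooth_plane_fun => //; rewrite pl.
- apply: filterS (near2 _ _ GF) => -[[s a] b] /= ; rewrite /plane_part /lift /= -surjective_pairing => ->//.
- apply: filterS (near2 _ _ FG) => -[[s a] b] /= ; rewrite /plane_part /lift /= -surjective_pairing => ->//.
Qed.

Lemma cylinder_equiv c d : A_equivalent c (0 : R) d (0 : R) ->
  A_equivalent (cylinder c) ((0, 0) : R * R) (cylinder d) ((0, 0) : R * R).
Proof.
move=> [phi [Phi [[psi dphi] [Psi dPhi] E]]].
exists (fun p => (p.1, phi p.2)), (fun q => lift q.1.1 (Phi (plane_part q))); split.
- by exists (fun p => (p.1, psi p.2)); exact: inverse_germs_lift_source.
- by eexists; exact: (inverse_germs_lift_target dPhi).
- have near2 : \forall p \near ((0, 0) : R * R), Phi (c p.2) = d (phi p.2).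
    by apply: (near_comp (f := snd) (p := ((0, 0) : R * R)) (P := fun x => Phi (c x) = d (phi x))) E;
      exact: cvg_snd.
  by apply: filterS near2 => -[s t] /= h; rewrite /cylinder /lift /plane_part /= -surjective_pairing h.
Qed.

Definition polar_curve (xi chi : R -> R) (lambda : R) : R -> R * R := fun t =>
  (chi t * cos (xi t / lambda), chi t * sin (xi t / lambda)).

Definition section_curve (lambda : R) (gamma : R -> R * R) u0 : R -> R * R :=
  polar_curve (fun t => (gamma (u0 + t)).1 - (gamma u0).1) (fun t => (gamma (u0 + t)).2) lambda.

(** In the source, replace [v] by the displacement [s] along the axis; then
    [v = w - theta] with [w = v0 + s / lambda].  The rotation by [w] of the last
    two target coordinates, a function of the target point, leaves the angle
    [theta], which depends on [u] alone. *)
Lemma helicoidal_cylinder lambda gamma (u0 v0 : R) : lambda != 0 -> smooth_at gamma u0 ->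
  A_equivalent (helicoidal1 lambda gamma) ((u0, v0) : R * R)
    (cylinder (section_curve lambda gamma u0)) ((0, 0) : R * R).
Proof.
move=> l0 gs.
have F1 := @finite_frame_field R; have F2 := finite_frame_prod F1 F1.
have [x1 x1E x1s] : exists2 x1, (forall u, (gamma u).1 = x1 u) & smooth_at x1 u0.
  by exists (fun u => (gamma u).1) => //; smooth.
pose phi (p : R * R) : R * R := (x1 p.1 - x1 u0 + lambda * (p.2 - v0), p.1 - u0).
pose psi (p : R * R) : R * R := (u0 + p.2, v0 + (p.1 - (x1 (u0 + p.2) - x1 u0)) / lambda).
pose X0 := x1 u0 + lambda * v0.
pose om (s : R) := v0 + s / lambda.
pose Phi (q : R * R * R) : R * R * R := let w := om (q.1.1 - X0) in
  (q.1.1 - X0, q.2 * cos w + q.1.2 * sin w, q.2 * sin w - q.1.2 * cos w).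
pose Psi (q : R * R * R) : R * R * R := let w := om q.1.1 in
  (q.1.1 + X0, q.1.2 * sin w - q.2 * cos w, q.1.2 * cos w + q.2 * sin w).
have oms (f : R * R * R -> R) q : smooth_at f q ->
    smooth_at (fun q => sin (om (f q))) q /\ smooth_at (fun q => cos (om (f q))) q.
  by move=> fs; split; [apply: (@smooth_at_comp1 _ _ (fun q => om (f q)) sin)
      |apply: (@smooth_at_comp1 _ _ (fun q => om (f q)) cos)];
    rewrite /om; smooth; [exact: smooth_at_sin|exact: smooth_at_cos].
have c0 : section_curve lambda gamma u0 0 = (x1 u0 * 0 + (gamma u0).2, 0).
  by rewrite /section_curve /polar_curve addr0 subrr mul0r cos0 sin0 mulr1 !mulr0 add0r.
have PhiK : cancel Phi Psi.
  move=> [[X Y] Z]; rewrite /Phi /Psi /=; set w := om _.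
  have := cos2Dsin2 w; set c := cos w; set s := sin w => cs.
  congr (_, _, _); first by rewrite subrK.
    by rewrite -[RHS]mulr1 -cs; ring.
  by rewrite -[RHS]mulr1 -cs; ring.
have PsiK : cancel Psi Phi.
  move=> [[X Y] Z]; rewrite /Phi /Psi /= addrK; set w := om _.
  have := cos2Dsin2 w; set c := cos w; set s := sin w => cs.
  congr (_, _, _).
    by rewrite -[RHS]mulr1 -cs; ring.
  by rewrite -[RHS]mulr1 -cs; ring.
have E p : Phi (helicoidal1 lambda gamma p) = cylinder (section_curve lambda gamma u0) (phi p).
  case: p => u v; rewrite /Phi /helicoidal1 /cylinder /section_curve /polar_curve /lift /phi /=.
  rewrite !x1E; set w := om _.
  have -> : u0 + (u - u0) = u by ring.
  have -> : (x1 u - x1 u0) / lambda = w - v by rewrite /w /om /X0; field.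
  rewrite cosB sinB; congr (_, _, _); last by ring.
    by rewrite /X0; ring.
  by ring.
have phi0 : phi (u0, v0) = (0, 0) by rewrite /phi /= !subrr mulr0 addr0.
exists phi, Phi; split; last by near=> p; exact: E.
- exists psi; split.
  + by split => //; rewrite /psi /= !addr0 !subrr mul0r addr0.
  + split; rewrite /phi /psi; smooth.
      by apply: (@smooth_at_comp1 _ _ fst x1) => //; smooth.
    apply: (@smooth_at_comp1 _ _ (fun p : R * R => u0 + p.2) x1); smooth.
    by rewrite /= addr0.
  + near=> p; rewrite /phi /psi /= [RHS]surjective_pairing.
    rewrite (_ : u0 + (p.1 - u0) = p.1); last by ring.
    by congr (_, _); field.
  + near=> p; rewrite /phi /psi /= [RHS]surjective_pairing.
    by congr (_, _); [field|ring].
- exists Psi; split.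
  + by split; [rewrite E phi0|rewrite -phi0 -E PhiK].
  + have fs q : smooth_at (fun q : R * R * R => q.1.1 - X0) q by smooth.
    have fs' q : smooth_at (fun q : R * R * R => q.1.1) q by smooth.
    split; [have [ss cs] := oms _ _ (fs (helicoidal1 lambda gamma (u0, v0)))|have [ss cs] := oms _ _ (fs' (cylinder (section_curve lambda gamma u0) (0, 0)))].
      rewrite /Phi /=; apply: smooth_at_pair; first (apply: smooth_at_pair; first by smooth).
        by apply: smooth_atD; apply: smooth_atM => //; smooth.
      by apply: smooth_atB; apply: smooth_atM => //; smooth.
    rewrite /Psi /=; apply: smooth_at_pair; first (apply: smooth_at_pair; first by smooth).
      by apply: smooth_atB; apply: smooth_atM => //; smooth.
    by apply: smooth_atD; apply: smooth_atM => //; smooth.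
  + by near=> q; exact: PhiK.
  + by near=> q; exact: PsiK.
Unshelve. all: by end_near. Qed.

End Cylinders.

(** * Order of vanishing as an invariant of cylinders *)

Section Contact.
Context {R : realType}.

Definition vanishing {V : normedModType R} m (f : R -> V) :=
  exists C : R, \forall t \near (0 : R), `|f t| <= C * `|t| ^+ m.

Lemma vanishing_pos {V : normedModType R} m (f : R -> V) : vanishing m f ->
  exists2 C : R, 0 < C & \forall t \near (0 : R), `|f t| <= C * `|t| ^+ m.
Proof.
move=> [C Cf]; exists (`|C| + 1); first by rewrite ltr_wpDl.
apply: filterS Cf => t /le_trans; apply; rewrite ler_wpM2r ?exprn_ge0//.
by apply: le_trans (ler_norm _) _; rewrite lerDl.
Qed.

Lemma vanishing0 {V : normedModType R} m (f : R -> V) : vanishing m.+1 f -> f 0 = 0.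
Proof.
move=> [C /nbhs_singleton]; rewrite normr0 expr0n /= mulr0 normr_le0.
by move=> /eqP.
Qed.

Lemma near_comp_at (V W : normedModType R) (f : V -> W) x y (P : W -> Prop) :
  {for x, continuous f} -> f x = y -> (\forall z \near y, P z) -> \forall z \near x, P (f z).
Proof. by move=> fc <-; exact: near_comp. Qed.

Lemma diff_error (V W : normedModType R) (f : V -> W) (e : R) : differentiable f 0 -> f 0 = 0 ->
  0 < e -> \forall x \near (0 : V), `|f x - 'd f 0 x| <= e * `|x|.
Proof.
move=> fd f0 e0; have /eqaddoP/(_ e e0) := diff_locally fd.
by apply: filterS => x; rewrite !fctE /= addr0 f0 add0r.
Qed.

Lemma diff_lipschitz (V W : normedModType R) (f : V -> W) : differentiable f 0 -> f 0 = 0 ->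
  exists2 K : R, 0 < K & \forall x \near (0 : V), `|f x| <= K * `|x|.
Proof.
move=> fd f0; have [K K0 fK] := linear_lipschitz (diff_continuous fd).
exists (K + 1); first by rewrite addr_gt0.
apply: filterS (diff_error fd f0 ltr01) => x fx.
rewrite -[f x](subrK ('d f 0 x)); apply: le_trans (ler_normD _ _) _.
by rewrite mulrDl addrC mul1r lerD//; move: fx; rewrite mul1r.
Qed.

Lemma norm_lift (s : R) (y : R * R) : `|lift s y| = Num.max `|s| `|y|.
Proof. by case: y => a b; rewrite /lift /= !prod_normE /= maxA. Qed.

Lemma norm_plane_part (q : R * R * R) : `|plane_part q| <= `|q|.
Proof.
by case: q => [[s a] b]; rewrite -[(s, a, b)]/(lift s (a, b)) norm_lift le_max lexx orbT.
Qed.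

Lemma cylinder0 c : c 0 = 0 -> cylinder c (0 : R * R) = 0 :> R * R * R.
Proof. by move=> c0; rewrite /cylinder /= c0. Qed.

Lemma cont_pair (V W X : normedModType R) (f : V -> W) (g : V -> X) x :
  {for x, continuous f} -> {for x, continuous g} -> {for x, continuous (fun y => (f y, g y))}.
Proof. by move=> fc gc; exact: cvg_pair fc gc. Qed.

Lemma cont_fst (V W X : normedModType R) (f : V -> W * X) x :
  {for x, continuous f} -> {for x, continuous (fun y => (f y).1)}.
Proof. by move=> fc; apply: continuous_comp fc _; exact: cvg_fst. Qed.

Lemma cont_snd (V W X : normedModType R) (f : V -> W * X) x :
  {for x, continuous f} -> {for x, continuous (fun y => (f y).2)}.
Proof. by move=> fc; apply: continuous_comp fc _; exact: cvg_snd. Qed.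

Lemma cont_lift (V : normedModType R) (f : V -> R) (g : V -> R * R) x :
  {for x, continuous f} -> {for x, continuous g} ->
  {for x, continuous (fun t => lift (f t) (g t))}.
Proof.
by move=> fc gc; apply: cont_pair; [apply: cont_pair => //; exact: cont_fst|exact: cont_snd].
Qed.

Lemma cont_cst (V W : normedModType R) (w : W) (x : V) : {for x, continuous (fun _ : V => w)}.
Proof. exact: cvg_cst. Qed.

Lemma cont_id (V : normedModType R) (x : V) : {for x, continuous (fun y : V => y)}.
Proof. exact: cvg_id. Qed.

(** Along [(w, u) = psi (0, t)] the target diffeomorphism sends [(w, c u)] to
    [(0, d t)].  It moves the axis [(w, 0)] tangentially to itself, because both
    curves have order at least 2, so [d t] is bounded by a multiple of [c u]
    plus a small multiple of [w]; and [w], a function of [d t], is itself bounded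
    by a multiple of [d t], so that this second term can be absorbed. *)
Lemma vanishing_invariant m c d : smooth_at c (0 : R) -> smooth_at d (0 : R) ->
  vanishing 2 c -> vanishing 2 d ->
  A_equivalent (cylinder c) (0 : R * R) (cylinder d) (0 : R * R) ->
  vanishing m c -> vanishing m d.
Proof.
move=> cs ds c2 d2 [phi [Phi [[psi dphi] [Psi dPhi] E]]] cm.
have c0 := vanishing0 c2; have d0 := vanishing0 d2.
rewrite (cylinder0 c0) (cylinder0 d0) in dPhi.
have [[phi0 psi0] [phis psis] psiphi phipsi] := dphi.
have [[Phi0 Psi0] [Phis Psis] PsiPhi PhiPsi] := dPhi.
have cc := smooth_at_continuous cs; have dc := smooth_at_continuous ds.
have psis1 : smooth_at (fun t : R => psi (0, t)) (0 : R).
  apply: (@smooth_plane_fun _ _ _ (fun t : R => (0, t)) psi) => //; last by smooth.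
  exact: finite_frame_prod finite_frame_field finite_frame_field.
have phis1 : smooth_at (fun t : R => phi (t, 0)) (0 : R).
  apply: (@smooth_plane_fun _ _ _ (fun t : R => (t, 0)) phi) => //; last by smooth.
  exact: finite_frame_prod finite_frame_field finite_frame_field.
have psic1 := smooth_at_continuous psis1; have phic1 := smooth_at_continuous phis1.
have [K1 K10 psiK] := diff_lipschitz (smooth_at_differentiable psis1) psi0.
have [K4 K40 phiK] := diff_lipschitz (smooth_at_differentiable phis1) phi0.
have [K2 K20 PsiK] := diff_lipschitz (smooth_at_differentiable Psis) Psi0.
have Phid := smooth_at_differentiable Phis.
have [K3 K30 LK] := linear_lipschitz (diff_continuous Phid).
have [C C0 cC] := vanishing_pos cm; have [D D0 dD] := vanishing_pos d2.
pose w t := (psi (0, t)).1; pose u t := (psi (0, t)).2.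
have wc : {for 0, continuous w} by exact: cont_fst.
have uc : {for 0, continuous u} by exact: cont_snd.
have w0 : w 0 = 0 by rewrite /w psi0.
have u0 : u 0 = 0 by rewrite /u psi0.
have cuc : {for 0, continuous (fun t => c (u t))}.
  by apply: continuous_comp => //; rewrite u0.
have axc : {for 0, continuous (fun t : R => (0 : R, t))}.
  by apply: cont_pair; [exact: cont_cst|exact: cont_id].
have axc' : {for 0, continuous (fun t : R => (t, 0 : R))}.
  by apply: cont_pair; [exact: cont_id|exact: cont_cst].
have E1 : \forall t \near (0 : R), Phi (lift (w t) (c (u t))) = lift 0 (d t).
  have h1 : \forall t \near (0 : R), Phi (cylinder c (psi (0, t))) = cylinder d (phi (psi (0, t))).
    exact: (near_comp_at (P := fun p => Phi (cylinder c p) = cylinder d (phi p)) psic1 psi0 E).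
  have h2 : \forall t \near (0 : R), phi (psi (0, t)) = (0, t).
    exact: (near_comp_at (f := fun t : R => (0, t)) (P := fun p => phi (psi p) = p) axc erefl phipsi).
  by apply: filterS2 h1 h2 => t a b; move: a; rewrite b.
have E2 : \forall t \near (0 : R), `|w t| <= K2 * `|d t|.
  have h1 : \forall t \near (0 : R), Psi (Phi (lift (w t) (c (u t)))) = lift (w t) (c (u t)).
    apply: (near_comp_at (P := fun q => Psi (Phi q) = q)) PsiPhi; first exact: cont_lift.
    by rewrite w0 u0 c0.
  have h2 : \forall t \near (0 : R), `|Psi (lift 0 (d t))| <= K2 * `|lift 0 (d t)|.
    apply: (near_comp_at (P := fun q => `|Psi q| <= K2 * `|q|)) PsiK; last by rewrite d0.
    by apply: cont_lift => //; exact: cont_cst.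
  apply: filterS3 E1 h1 h2 => t -> ->; rewrite !norm_lift normr0.
  by rewrite (max_r (normr_ge0 _)) ge_max => /andP[].
have E3 : \forall s \near (0 : R), `|plane_part (Phi (lift s 0))| <= D * K4 ^+ 2 * `|s| ^+ 2.
  have h1 : \forall s \near (0 : R), Phi (cylinder c (s, 0)) = cylinder d (phi (s, 0)).
    exact: (near_comp_at (f := fun t : R => (t, 0)) (P := fun p => Phi (cylinder c p) = cylinder d (phi p)) axc' erefl E).
  have h2 : \forall s \near (0 : R), `|d (phi (s, 0)).2| <= D * `|(phi (s, 0)).2| ^+ 2.
    apply: (near_comp_at (f := fun s => (phi (s, 0)).2) (P := fun t => `|d t| <= D * `|t| ^+ 2)) dD.
      exact: cont_snd.
    by rewrite phi0.
  apply: filterS3 h1 h2 phiK => s; rewrite {1}/cylinder /= c0 => -> h2 h3.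
  rewrite /plane_part /cylinder /lift /= -surjective_pairing (le_trans h2)//.
  rewrite -mulrA -exprMn ler_wpM2l ?(ltW D0)//.
  apply: lerXn2r; rewrite ?nnegrE ?mulr_ge0 ?normr_ge0 ?(ltW K40)//.
  by apply: le_trans h3; rewrite prod_normE le_max lexx orbT.
(* as [e K2 = 1 / 8], the linear term in [w] costs a quarter of [d t]; the
   quadratic one costs another quarter close to 0 *)
pose e := (8 * K2)^-1.
have e0 : 0 < e by rewrite invr_gt0 mulr_gt0.
have eK : e * K2 = 8^-1 by rewrite /e invfM -mulrA mulVf ?gt_eqF// mulr1.
have err := diff_error Phid Phi0 e0.
have err1 : \forall t \near (0 : R), `|Phi (lift (w t) (c (u t))) - 'd Phi 0 (lift (w t) (c (u t)))|
    <= e * `|lift (w t) (c (u t))|.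
  apply: (near_comp_at (P := fun q => `|Phi q - 'd Phi 0 q| <= e * `|q|)) err.
    exact: cont_lift.
  by rewrite w0 u0 c0.
have err2 : \forall t \near (0 : R), `|Phi (lift (w t) 0) - 'd Phi 0 (lift (w t) 0)|
    <= e * `|lift (w t) (0 : R * R)|.
  apply: (near_comp_at (f := fun t => lift (w t) 0) (P := fun q => `|Phi q - 'd Phi 0 q| <= e * `|q|)) err.
    by apply: cont_lift => //; exact: cont_cst.
  by rewrite w0.
have E3w : \forall t \near (0 : R), `|plane_part (Phi (lift (w t) 0))| <= D * K4 ^+ 2 * `|w t| ^+ 2.
  exact: (near_comp_at (P := fun s => `|plane_part (Phi (lift s 0))| <= D * K4 ^+ 2 * `|s| ^+ 2) wc w0 E3).
have wsmall : \forall t \near (0 : R), D * K4 ^+ 2 * `|w t| <= 4^-1 / K2.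
  have dpos : 0 < 4^-1 / K2 / (D * K4 ^+ 2) by rewrite !divr_gt0// ?invr_gt0 ?mulr_gt0 ?exprn_gt0.
  have : \forall z \near (0 : R), `|z| < 4^-1 / K2 / (D * K4 ^+ 2) by exact: nbhs0_lt.
  move=> /(near_comp_at wc w0); apply: filterS => t h.
  by rewrite mulrC -ler_pdivlMr ?mulr_gt0 ?exprn_gt0// ltW.
have cu : \forall t \near (0 : R), `|c (u t)| <= C * `|u t| ^+ m.
  exact: (near_comp_at (P := fun t => `|c t| <= C * `|t| ^+ m) uc u0 cC).
exists (2 * (K3 + e) * (C * K1 ^+ m)).
near=> t.
have t1 : Phi (lift (w t) (c (u t))) = lift 0 (d t) by near: t.
have t2 : `|w t| <= K2 * `|d t| by near: t.
have t3 : `|plane_part (Phi (lift (w t) 0))| <= D * K4 ^+ 2 * `|w t| ^+ 2 by near: t.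
have t4 : `|Phi (lift (w t) (c (u t))) - 'd Phi 0 (lift (w t) (c (u t)))|
    <= e * `|lift (w t) (c (u t))| by near: t.
have t5 : `|Phi (lift (w t) 0) - 'd Phi 0 (lift (w t) 0)| <= e * `|lift (w t) (0 : R * R)| by near: t.
have t6 : D * K4 ^+ 2 * `|w t| <= 4^-1 / K2 by near: t.
have t7 : `|c (u t)| <= C * `|u t| ^+ m by near: t.
have t8 : `|psi (0, t)| <= K1 * `|t| by near: t.
have ut : `|u t| <= K1 * `|t|.
  by apply: le_trans t8; rewrite prod_normE le_max lexx orbT.
have cut : `|c (u t)| <= C * K1 ^+ m * `|t| ^+ m.
  apply: le_trans t7 _; rewrite -mulrA -exprMn ler_wpM2l ?(ltW C0)//.
  by apply: lerXn2r; rewrite ?nnegrE ?mulr_ge0 ?normr_ge0 ?(ltW K10).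
set A := Phi _ in t1 t4; set B := Phi _ in t3 t5.
have LE : 'd Phi 0 (lift (w t) (c (u t))) = 'd Phi 0 (lift (w t) 0) + 'd Phi 0 (lift 0 (c (u t))).
  by rewrite -linearD; congr ('d Phi 0 _); rewrite /lift; congr (_, _, _) => /=; rewrite ?addr0 ?add0r.
have AB : A - B = 'd Phi 0 (lift 0 (c (u t))) + (A - 'd Phi 0 (lift (w t) (c (u t))))
    - (B - 'd Phi 0 (lift (w t) 0)).
  rewrite LE; move: ('d Phi 0 (lift (w t) 0)) ('d Phi 0 (lift 0 (c (u t)))) => L2 L0.
  by rewrite opprB opprD (addrCA L0 A) (addrCA L0 (- L2)) subrr addr0 addrA subrK.
have dE : d t = plane_part (A - B) + plane_part B.
  have -> : plane_part (A - B) + plane_part B = plane_part A.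
    by rewrite /plane_part; congr (_, _) => /=; rewrite subrK.
  by rewrite t1; case: (d t).
have nAB : `|A - B| <= K3 * `|c (u t)| + e * (2 * `|w t| + `|c (u t)|).
  rewrite AB; apply: le_trans (ler_normB _ _) _.
  apply: le_trans (lerD (ler_normD _ _) t5) _.
  apply: le_trans (lerD (lerD (LK _) t4) (lexx _)) _.
  rewrite !norm_lift normr0 (max_r (normr_ge0 _)) normr0 (max_l (normr_ge0 _)).
  rewrite -addrA lerD2l -mulrDr ler_wpM2l ?(ltW e0)//.
  have : Num.max `|w t| `|c (u t)| <= `|w t| + `|c (u t)|.
    by rewrite ge_max lerDl lerDr !normr_ge0.
  lra.
have n1 : `|d t| <= K3 * `|c (u t)| + e * (2 * `|w t| + `|c (u t)|) + D * K4 ^+ 2 * `|w t| ^+ 2.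
  rewrite dE; apply: (le_trans (ler_normD _ _)); apply: lerD t3.
  by apply: le_trans nAB; exact: norm_plane_part.
have n2 : D * K4 ^+ 2 * `|w t| ^+ 2 <= 4^-1 * `|d t|.
  rewrite [`|w t| ^+ 2]expr2 mulrA; apply: (le_trans (ler_pM _ _ t6 t2)) => //.
    by rewrite !mulr_ge0 ?exprn_ge0 ?(ltW D0) ?(ltW K40).
  by rewrite mulrA divfK ?gt_eqF.
have n3 : e * (2 * `|w t|) <= 4^-1 * `|d t|.
  have -> : 4^-1 * `|d t| = e * (2 * (K2 * `|d t|)) by rewrite mulrCA mulrA mulrA -[2 * e * K2]mulrA eK; field.
  by rewrite ler_wpM2l ?(ltW e0)// ler_wpM2l.
have n4 : `|d t| <= 2 * (K3 + e) * `|c (u t)|.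
  by move: n1 n2 n3; rewrite mulrDr; lra.
apply: le_trans n4 _; rewrite -[leRHS]mulrA; apply: ler_wpM2l => //.
by rewrite mulr_ge0// addr_ge0// ltW.
Unshelve. all: by end_near. Qed.

End Contact.

(** * Contact with regular functions as an invariant of cylinders *)

Section ContactInvariance.
Context {R : realType}.

(** For a smooth [f] this says that [f] and its differential vanish at 0; the
    functions for which it fails are those that can measure a contact. *)
Definition littleo_id (V : normedModType R) (f : V -> R) :=
  forall e : R, 0 < e -> \forall x \near (0 : V), `|f x| <= e * `|x|.

Lemma vanishing_littleo_id m (f : R -> R) : vanishing m.+2 f -> littleo_id f.
Proof.
move=> /vanishing_pos[C C0 fC] e e0.
have : \forall t \near (0 : R), `|t| < Num.min 1 (e / C).
  by apply: nbhs0_lt; rewrite lt_min ltr01 divr_gt0.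
apply: filterS2 fC => t /le_trans h; rewrite lt_min => /andP[t1 te]; apply: h.
rewrite exprS mulrCA mulrC ler_wpM2r// exprS.
have t2 : `|t| ^+ m <= 1 by rewrite exprn_ile1// ltW.
apply: (@le_trans _ _ (C * `|t|)); last by rewrite mulrC -ler_pdivlMr// ltW.
by rewrite ler_wpM2l ?(ltW C0)// ler_piMr.
Qed.

Lemma littleo_linear_zero (V : normedModType R) (L : V -> R) :
  (forall (a : R) v, L (a *: v) = a * L v) -> littleo_id L -> forall v, L v = 0.
Proof.
move=> LZ L1 v; apply/eqP; rewrite -normr_le0 leNgt; apply/negP => Lv.
pose e := `|L v| / (2 * (`|v| + 1)).
have v1 : 0 < `|v| + 1 by rewrite ltr_wpDl.
have e0 : 0 < e by rewrite divr_gt0// mulr_gt0.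
have sc : {for 0, continuous (fun a : R => a *: v)} by exact: scalel_continuous.
have := near_comp_at (f := fun a : R => a *: v) (P := fun w => `|L w| <= e * `|w|) sc (scale0r v) (L1 e e0).
move=> /near0_interval[d d0].
have [x x0 xd] : exists2 x : R, 0 < x & x < d by exists (d / 2); lra.
move=> /(_ x); rewrite LZ normrM [`|x *: v|]normrZ (gtr0_norm x0) mulrCA ler_pM2l// => h.
have {h} : `|L v| <= e * `|v| by apply: h; rewrite xd andbT; lra.
apply/negP.
rewrite -ltNge /e mulrAC ltr_pdivrMr ?mulr_gt0// ltr_pM2l//.
by have := normr_ge0 v; lra.
Qed.

Lemma smooth_lift0 (y : R * R) : smooth_at (fun y : R * R => lift 0 y) y.
Proof. by rewrite /lift; smooth. Qed.

(** Transport [h], extended to the space independently of the first coordinate,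
    by the target diffeomorphism and restrict it to the plane [s = 0].  The
    differential survives the restriction: along the axis the transported
    function vanishes at least to the order of [h o c], so its derivative there
    is 0. *)
Lemma contact_invariant m c d (h : R * R -> R) :
  smooth_at c (0 : R) -> smooth_at d (0 : R) -> vanishing 2 c -> vanishing 2 d ->
  A_equivalent (cylinder c) (0 : R * R) (cylinder d) (0 : R * R) ->
  smooth_at h (0 : R * R) -> ~ littleo_id h -> vanishing m.+2 (fun t => h (c t)) ->
  exists k, [/\ smooth_at k (0 : R * R), ~ littleo_id k & vanishing m.+2 (fun t => k (d t))].
Proof.
move=> cs ds c2 d2 [phi [Phi [[psi dphi] [Psi dPhi] E]]] hs h1 hc.
have c0 := vanishing0 c2; have d0 := vanishing0 d2.
have h0 : h 0 = 0 by have := vanishing0 hc; rewrite c0.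
rewrite (cylinder0 c0) (cylinder0 d0) in dPhi.
have [[phi0 psi0] [phis psis] psiphi phipsi] := dphi.
have [[Phi0 Psi0] [Phis Psis] PsiPhi PhiPsi] := dPhi.
have cc := smooth_at_continuous cs; have dc := smooth_at_continuous ds.
have F1 := @finite_frame_field R; have F2 := finite_frame_prod F1 F1.
have F3 := finite_frame_prod F2 F1.
have axes (a b : R) : smooth_at (fun t : R => (t * a, t * b)) (0 : R) by smooth.
have psis_ax (a b : R) : smooth_at (fun t : R => psi (t * a, t * b)) (0 : R).
  apply: (@smooth_plane_fun _ _ _ (fun t : R => (t * a, t * b)) psi) => //.
  by rewrite /= !mul0r.
have psi00 (a b : R) : psi (0 * a, 0 * b) = 0 by rewrite !mul0r; exact: psi0.
have Eax (a b : R) : \forall t \near (0 : R),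
    Psi (cylinder d (t * a, t * b)) = cylinder c (psi (t * a, t * b)).
  have axc := smooth_at_continuous (axes a b).
  have ax0 : (0 * a, 0 * b) = 0 :> R * R by rewrite !mul0r.
  have psic := smooth_at_continuous (psis_ax a b).
  have e1 : \forall t \near (0 : R), phi (psi (t * a, t * b)) = (t * a, t * b).
    exact: (near_comp_at (P := fun p => phi (psi p) = p) axc ax0 phipsi).
  have e2 : \forall t \near (0 : R), Phi (cylinder c (psi (t * a, t * b))) = cylinder d (phi (psi (t * a, t * b))).
    exact: (near_comp_at (P := fun p => Phi (cylinder c p) = cylinder d (phi p)) psic (psi00 a b) E).
  have e3 : \forall t \near (0 : R), Psi (Phi (cylinder c (psi (t * a, t * b)))) = cylinder c (psi (t * a, t * b)).
    have cylc : {for 0, continuous (fun t : R => cylinder c (psi (t * a, t * b)))}.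
      apply: cont_lift; first exact: cont_fst.
      apply: (@continuous_comp _ _ _ (fun t : R => (psi (t * a, t * b)).2) c); first exact: cont_snd.
      by rewrite psi00.
    apply: (near_comp_at (P := fun q => Psi (Phi q) = q) cylc) PsiPhi.
    by rewrite psi00 cylinder0.
  by apply: filterS3 e1 e2 e3 => t a1 a2 a3; rewrite -a3 a2 a1.
pose K q := h (plane_part (Psi q)).
have Ks : smooth_at K (0 : R * R * R).
  apply: (@smooth_plane_fun _ _ _ (fun q => plane_part (Psi q)) h) => //.
    by rewrite /plane_part; smooth.
  by rewrite Psi0.
have K0 : K 0 = 0 by rewrite /K Psi0.
pose k y := K (lift 0 y).
have ks : smooth_at k (0 : R * R).
  by apply: (smooth_at_comp F3 F1 (smooth_lift0 _)).
have kline (a b : R) : vanishing m.+2 (fun t => K (cylinder d (t * a, t * b))).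
  have [M M0 psiM] := diff_lipschitz (smooth_at_differentiable (psis_ax a b)) (psi00 a b).
  have [C C0 hC] := vanishing_pos hc.
  exists (C * M ^+ m.+2).
  have uc : {for 0, continuous (fun t : R => (psi (t * a, t * b)).2)}.
    by apply: cont_snd; exact: smooth_at_continuous (psis_ax a b).
  have hu : \forall t \near (0 : R), `|h (c (psi (t * a, t * b)).2)| <= C * `|(psi (t * a, t * b)).2| ^+ m.+2.
    apply: (near_comp_at (P := fun u => `|h (c u)| <= C * `|u| ^+ m.+2) uc) hC.
    by rewrite psi00.
  apply: filterS3 (Eax a b) hu psiM => t e1 e2 e3.
  rewrite /K e1 /plane_part /cylinder /lift /= -surjective_pairing (le_trans e2)//.
  rewrite -mulrA -exprMn ler_wpM2l ?(ltW C0)//.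
  apply: lerXn2r; rewrite ?nnegrE ?mulr_ge0 ?normr_ge0 ?(ltW M0)//.
  by apply: le_trans e3; rewrite prod_normE le_max lexx orbT.
exists k; split => //; last first.
  have [C hC] := kline 0 1; exists C; apply: filterS hC => t.
  by rewrite mulr0 mulr1.
move=> k1; apply: h1.
have Kd := smooth_at_differentiable Ks.
have LZ (a : R) v : 'd K 0 (a *: v) = a * 'd K 0 v by rewrite linearZ.
have K1 : littleo_id K.
  have L1 y : 'd K 0 (lift 0 y) = 0.
    apply: (@littleo_linear_zero _ (fun y => 'd K 0 (lift 0 y))) => [a v|e e0].
      by rewrite -LZ; congr ('d K 0 _); rewrite /lift; congr (_, _, _) => /=; rewrite ?[RHS]mulr0.
    have e20 : 0 < e / 2 by rewrite divr_gt0.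
    have h2 : \forall y \near (0 : R * R), `|K (lift 0 y) - 'd K 0 (lift 0 y)| <= e / 2 * `|lift 0 y|.
      exact: (near_comp_at (P := fun q => `|K q - 'd K 0 q| <= e / 2 * `|q|)
        (smooth_at_continuous (smooth_lift0 0)) erefl (diff_error Kd K0 e20)).
    apply: filterS2 (k1 _ e20) h2 => z; rewrite /k norm_lift normr0 (max_r (normr_ge0 _)) => a1 a2.
    have := ler_normB (K (lift 0 z)) (K (lift 0 z) - 'd K 0 (lift 0 z)).
    rewrite opprB addrC subrK; lra.
  have L2 s : 'd K 0 (lift s 0) = 0.
    apply: (@littleo_linear_zero _ (fun s : R => 'd K 0 (lift s 0))) => [a v|e e0].
      by rewrite -LZ; congr ('d K 0 _); rewrite /lift; congr (_, _, _) => /=; rewrite ?[RHS]mulr0.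
    have e20 : 0 < e / 2 by rewrite divr_gt0.
    have lc : {for 0, continuous (fun s : R => lift s 0)} by apply: cont_lift; [exact: cont_id|exact: cont_cst].
    have h2 : \forall s \near (0 : R), `|K (lift s 0) - 'd K 0 (lift s 0)| <= e / 2 * `|lift s (0 : R * R)|.
      exact: (near_comp_at (P := fun q => `|K q - 'd K 0 q| <= e / 2 * `|q|) lc erefl (diff_error Kd K0 e20)).
    have h3 := vanishing_littleo_id (kline 1 0) e20.
    apply: filterS2 h3 h2 => z; rewrite norm_lift normr0 (max_l (normr_ge0 _)).
    rewrite mulr1 mulr0 /cylinder /= d0 => a1 a2.
    have := ler_normB (K (lift z 0)) (K (lift z 0) - 'd K 0 (lift z 0)).
    rewrite opprB addrC subrK; lra.
  have L0 q : 'd K 0 q = 0.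
    have -> : q = lift q.1.1 0 + lift 0 (plane_part q).
      by case: q => [[s y] z]; congr (_, _, _) => /=; rewrite ?addr0 ?add0r.
    by rewrite linearD L1 L2 addr0.
  move=> e e0; apply: filterS (diff_error Kd K0 e0) => q.
  by rewrite L0 subr0.
move=> e e0.
have Phil : smooth_at (fun y : R * R => Phi (lift 0 y)) (0 : R * R).
  by apply: (smooth_at_comp F3 F3 (smooth_lift0 _)).
have [M M0 PM] := diff_lipschitz (smooth_at_differentiable Phil) Phi0.
have eM : 0 < e / M by rewrite divr_gt0.
have h2 : \forall y \near (0 : R * R), `|K (Phi (lift 0 y))| <= e / M * `|Phi (lift 0 y)|.
  exact: (near_comp_at (P := fun q => `|K q| <= e / M * `|q|) (smooth_at_continuous Phil) Phi0 (K1 _ eM)).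
have h3 : \forall y \near (0 : R * R), Psi (Phi (lift 0 y)) = lift 0 y.
  exact: (near_comp_at (P := fun q => Psi (Phi q) = q) (smooth_at_continuous (smooth_lift0 0)) erefl PsiPhi).
apply: filterS3 h2 h3 PM => y; rewrite /K => a1 a2; rewrite a2 in a1.
move=> a3; move: a1; rewrite {1}/plane_part /lift /= -surjective_pairing => a1.
apply: le_trans a1 _; rewrite mulrAC ler_pdivrMr// -mulrA ler_wpM2l ?(ltW e0)//.
by rewrite mulrC.
Qed.

End ContactInvariance.

(** * Contact of regular functions with monomial curves *)

Section ModelContact.
Context {R : realType}.

Lemma mean_value_bound0 (f df : R -> R) B (z : R) :
  (forall y, `|y| <= `|z| -> is_derive y (1 : R) f (df y) /\ `|df y| <= B) ->
  `|f z - f 0| <= B * `|z|.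
Proof.
move=> H; have [z0|z0] := leP 0 z.
  have [||c] := @MVT_segment R f df 0 z z0.
  - by move=> y; rewrite in_itv /= => /andP[y0 yz]; apply: (H y _).1; rewrite !ger0_norm// ltW.
  - apply: derivable_within_continuous => y; rewrite in_itv /= => /andP[y0 yz].
    by have [[]] : is_derive y (1 : R) f (df y) /\ `|df y| <= B by apply: H; rewrite !ger0_norm.
  rewrite in_itv /= => /andP[c0 cz] ->; rewrite subr0 normrM ler_wpM2r//.
  by apply: (H c _).2; rewrite !ger0_norm// ltW.
have [||c] := @MVT_segment R f df z 0 (ltW z0).
- by move=> y; rewrite in_itv /= => /andP[y0 yz]; apply: (H y _).1; rewrite !ler0_norm ?lerN2// ltW.
- apply: derivable_within_continuous => y; rewrite in_itv /= => /andP[y0 yz].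
  by have [[]] : is_derive y (1 : R) f (df y) /\ `|df y| <= B by apply: H; rewrite !ler0_norm ?lerN2// ltW.
rewrite in_itv /= => /andP[c0 cz] e; rewrite distrC e sub0r normrM normrN ler_wpM2r//.
by apply: (H c _).2; rewrite !ler0_norm ?lerN2// ltW.
Qed.

Lemma is_derive_partial2 (k : R * R -> R) (y z : R) : differentiable k (y, z) ->
  is_derive z (1 : R) (fun z => k (y, z)) ('D_((0, 1) : R * R) k (y, z)).
Proof.
move=> kd; have := derivableP (@diff_derivable _ _ _ _ _ ((0, 1) : R * R) kd).
have E : (fun h : R => h^-1 *: (k (h *: ((0, 1) : R * R) + (y, z)) - k (y, z))) =
  (fun h : R => h^-1 *: (k (y, h *: 1 + z) - k (y, z))).
  apply/funext => h; congr (_ *: (k _ - _)).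
  by congr (_, _) => /=; rewrite /GRing.scale /= mulr0 add0r.
case=> kd' _; split; first by move: kd'; rewrite /derivable E.
by rewrite /derive E.
Qed.

Lemma strict_partial2 (k : R * R -> R) (e : R) : smooth_at k (0 : R * R) -> 0 < e ->
  \forall p \near (0 : R * R),
    `|k p - k (p.1, 0) - 'D_((0, 1) : R * R) k 0 * p.2| <= e * `|p.2|.
Proof.
move=> ks e0; set D := 'D_((0, 1) : R * R) k.
have Dc := smooth_at_continuous (smooth_at_derive ((0, 1) : R * R) ks).
have near1 : \forall p \near (0 : R * R), smooth_at k p /\ `|D 0 - D p| < e.
  have n1 := smooth_near ks; have n2 : \forall p \near (0 : R * R), `|D 0 - D p| < e.
    by move/cvgrPdist_lt: Dc; apply.
  by apply: filterS2 n1 n2.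
have [r r0 rP] : exists2 r : R, 0 < r & forall p : R * R, `|p| < r -> smooth_at k p /\ `|D 0 - D p| < e.
  move/nbhs_normP: near1 => [r /= r0 rP]; exists r => // p pr; apply: rP.
  by rewrite /= sub0r normrN.
have : \forall p \near (0 : R * R), `|p| < r by exact: nbhs0_lt.
apply: filterS => -[y z] /=; rewrite prod_normE /= gt_max => /andP[yr zr].
have [] := (@mean_value_bound0 (fun z => k (y, z) - D 0 * z) (fun z => D (y, z) - D 0) e z, tt).
rewrite mulr0 subr0 addrAC => h _; apply: h => x xz.
have xr : `|((y, x) : R * R)| < r by rewrite prod_normE /= gt_max yr /=; apply: le_lt_trans zr.
have [kx Dx] := rP _ xr; split; last by rewrite distrC ltW.
have H := is_deriveB (is_derive_partial2 (smooth_at_differentiable kx)) (is_deriveZ (D 0) (is_derive_id x (1 : R))).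
rewrite (_ : (fun _ => _) = (fun z => k (y, z)) - D 0 *: id); last by apply/funext => s; rewrite !fctE.
by apply: (is_derive_eq H); rewrite /GRing.scale /= mulr1.
Qed.

(** The quotient [X] is bounded by [C t^(b - a)] off 0, hence tends to 0. *)
Lemma leading_coefficient a b (X : R -> R) : (a < b)%N -> {for 0, continuous X} ->
  vanishing b (fun t => t ^+ a * X t) -> X 0 = 0.
Proof.
move=> ab Xc [C fC].
have near1 : \forall t \near (0 : R), `|t * X t - t * 0| <= `|t| * (C * `|t| ^+ (b - a)).
  apply: filterS fC => t; rewrite mulr0 subr0 !normrM normrX.
  have [->|t0] := eqVneq t 0; first by rewrite normr0 !mul0r.
  rewrite -(subnKC (ltnW ab)) exprD addKn mulrCA ler_pM2l ?exprn_gt0 ?normr_gt0// => h.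
  by rewrite ler_wpM2l.
have h1 : X t @[t --> 0^'] --> X 0 by exact: cvg_within_filter Xc.
suff h2 : X t @[t --> 0^'] --> 0 by rewrite -(cvg_lim (@Rhausdorff R) h1) (cvg_lim (@Rhausdorff R) h2).
have B0 : C * `|t| ^+ (b - a) @[t --> (0 : R)^'] --> 0.
  have Bc : {for 0, continuous (fun t : R => C * `|t| ^+ (b - a))}.
    apply: continuousM; first exact: (@cont_cst R).
    by apply: (@continuous_comp _ _ _ (fun t : R => `|t|) (fun x : R => x ^+ (b - a))); [exact: norm_continuous|exact: exprn_continuous].
  move: Bc; rewrite /prop_for /continuous_at normr0 expr0n subn_eq0 leqNgt ab /= mulr0 => Bc.
  exact: cvg_within_filter Bc.
apply: norm_cvg0; apply: (@squeeze_cvgr _ _ _ _ (fun=> 0) (fun t => C * `|t| ^+ (b - a))) => //; last exact: cvg_cst.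
near=> t; rewrite normr_ge0 /=.
have t0 : t != 0 by near: t; exact: nbhs_dnbhs_neq.
have : `|t * X t - t * 0| <= `|t| * (C * `|t| ^+ (b - a)) by near: t; exact: nbhs_dnbhs.
by rewrite mulr0 subr0 normrM ler_pM2l ?normr_gt0.
Unshelve. all: by end_near. Qed.

(** A function with differential [(a1, B)] has on the curve the expansion
    [a1 t^i + rho0 t^(2 i) + B t^j + ...], where the terms left out have order
    larger than [j] since [j < 3 i].  As [j <> 2 i], the three exponents are
    distinct, so the terms of order at most [j] must vanish one by one. *)
Lemma model_contact i j (k : R * R -> R) : (0 < i < j)%N -> (j < 3 * i)%N -> j != (2 * i)%N ->
  smooth_at k (0 : R * R) -> vanishing j.+1 (fun t => k (model_curve i j t)) -> littleo_id k.
Proof.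
move=> /andP[i0 ij] j3 j2 ks kv.
have j0 : (0 < j)%N by apply: leq_ltn_trans ij.
have m0 : model_curve i j 0 = 0 :> R * R by rewrite /model_curve !expr0n (gtn_eqF i0) (gtn_eqF j0).
have k0 : k 0 = 0 by have := vanishing0 kv; rewrite m0.
set B := 'D_((0, 1) : R * R) k 0.
have axs : smooth_at (fun y : R => k (y, 0)) (0 : R).
  by apply: (@smooth_plane_fun _ _ _ (fun y : R => (y, 0)) k) => //; [exact: finite_frame_field|smooth].
have [a1 [rho [rhos rhoE]]] := second_difference axs.
have ke y : k (y, 0) = y * (a1 + y * rho y).
  by rewrite rhoE (_ : k (0, 0) = k 0)// k0 add0r; ring.
pose D t := if t == 0 then B else (k (t ^+ i, t ^+ j) - k (t ^+ i, 0)) / t ^+ j.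
have DE t : k (t ^+ i, t ^+ j) = t ^+ i * (a1 + t ^+ i * rho (t ^+ i)) + t ^+ j * D t.
  rewrite /D; case: eqVneq => [->|t0].
    by rewrite !expr0n (gtn_eqF i0) (gtn_eqF j0) /= !mul0r addr0.
  by rewrite -ke mulrC divfK ?expf_neq0// addrC subrK.
have D0 : D 0 = B by rewrite /D eqxx.
have Dc : {for 0, continuous D}.
  apply/cvgrPdist_lt => e e0; rewrite D0.
  have e20 : 0 < e / 2 by rewrite divr_gt0.
  have := near_comp_at (smooth_at_continuous (smooth_model_curve i j (0 : R))) m0 (strict_partial2 ks e20).
  apply: filterS => t; rewrite -/B /model_curve /= /D => h.
  case: eqVneq => [_|t0]; first by rewrite subrr normr0.
  have tj : t ^+ j != 0 by rewrite expf_neq0.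
  rewrite -(ltr_pM2r (_ : 0 < `|t ^+ j|)) ?normr_gt0// -normrM mulrBl divfK// distrC.
  by apply: le_lt_trans h _; rewrite ltr_pM2r ?normr_gt0//; lra.
have ps n : smooth_at (fun t : R => t ^+ n) (0 : R) by smooth.
have rs : smooth_at (fun t : R => rho (t ^+ i)) (0 : R).
  by apply: (@smooth_at_comp1 _ _ (fun t : R => t ^+ i)) => //; rewrite expr0n (gtn_eqF i0).
have rc := smooth_at_continuous rs.
have pc n : {for 0, continuous (fun t : R => t ^+ n)} by exact: exprn_continuous.
have kvE (X : R -> R) b : (forall t, k (t ^+ i, t ^+ j) = t ^+ b * X t) -> (b < j.+1)%N ->
    {for 0, continuous X} -> X 0 = 0.
  move=> XE bj Xc; apply: (leading_coefficient bj Xc).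
  have [C kC] := kv; exists C; apply: filterS kC => t.
  by rewrite /model_curve XE.
have sub0 a b : (a < b)%N -> ((b - a)%N == 0%N) = false by move=> ab; rewrite subn_eq0; apply/negbTE; rewrite -ltnNge.
have a10 : a1 = 0.
  have := kvE (fun t => a1 + t ^+ i * rho (t ^+ i) + t ^+ (j - i) * D t) i.
  rewrite !expr0n (gtn_eqF i0) (sub0 _ _ ij) /= !mul0r !addr0; apply.
  - by move=> t; rewrite DE [RHS]mulrDr [X in _ = _ + X]mulrA -exprD subnKC// ltnW.
  - by rewrite ltnS ltnW.
  - apply: continuousD; first apply: continuousD; [exact: (@cont_cst R)| |].
      by apply: continuousM; [exact: pc|exact: rc].
    by apply: continuousM; [exact: pc|exact: Dc].
have DE2 t : k (t ^+ i, t ^+ j) = t ^+ (2 * i) * rho (t ^+ i) + t ^+ j * D t.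
  by rewrite DE a10 add0r mulrA -exprD addnn -mul2n.
have B0 : B = 0.
  rewrite -D0; case: (ltngtP j (2 * i)) j2 => // [ji _|ij2 _].
    have := kvE (fun t => t ^+ (2 * i - j) * rho (t ^+ i) + D t) j.
    rewrite !expr0n (sub0 _ _ ji) /= !mul0r !add0r; apply => //.
      by move=> t; rewrite DE2 mulrDr mulrA -exprD subnKC// ltnW.
    by apply: continuousD; [apply: continuousM; [exact: pc|exact: rc]|exact: Dc].
  have rho0 : rho 0 = 0.
    have := kvE (fun t => rho (t ^+ i) + t ^+ (j - 2 * i) * D t) (2 * i)%N.
    rewrite !expr0n (gtn_eqF i0) (sub0 _ _ ij2) /= !mul0r !addr0; apply.
    - by move=> t; rewrite DE2 mulrDr mulrA -exprD subnKC// ltnW.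
    - by rewrite ltnS ltnW.
    - by apply: continuousD; [exact: rc|apply: continuousM; [exact: pc|exact: Dc]].
  have [rho1 [rho1s _ rho1E]] := hadamard rhos.
  have r1s : smooth_at (fun t : R => rho1 (t ^+ i)) (0 : R).
    by apply: (@smooth_at_comp1 _ _ (fun t : R => t ^+ i)) => //; rewrite expr0n (gtn_eqF i0).
  have := kvE (fun t => t ^+ (3 * i - j) * rho1 (t ^+ i) + D t) j.
  rewrite !expr0n (sub0 _ _ j3) /= !mul0r !add0r; apply => //.
    move=> t; rewrite DE2 rho1E rho0 add0r mulrDr !mulrA -!exprD subnKC ?(ltnW j3)//.
    by rewrite mulSn addnC.
  by apply: continuousD; [apply: continuousM; [exact: pc|exact: smooth_at_continuous]|exact: Dc].
move=> e e0; have e20 : 0 < e / 2 by rewrite divr_gt0.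
have yr : \forall y \near (0 : R), `|y * rho y| <= e / 2.
  have yrc : {for 0, continuous (fun y : R => y * rho y)}.
    by apply: continuousM; [exact: (@cont_id R)|exact: smooth_at_continuous].
  move/cvgrPdist_lt: yrc => /(_ _ e20); apply: filterS => y.
  by rewrite mul0r sub0r normrN => /ltW.
have yr2 : \forall p \near (0 : R * R), `|p.1 * rho p.1| <= e / 2.
  apply: (near_comp_at (f := fst) (P := fun y : R => `|y * rho y| <= e / 2)) yr => //.
  exact: cvg_fst.
apply: filterS2 (strict_partial2 ks e20) yr2 => p; rewrite -/B B0 mul0r subr0 ke a10 add0r.
move=> h1 h2.
have h3 : `|p.1 * (p.1 * rho p.1)| <= e / 2 * `|p.1|.
  by rewrite normrM mulrC ler_wpM2r.
have p1 : `|p.1| <= `|p| by rewrite [leRHS]prod_normE le_max lexx.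
have p2 : `|p.2| <= `|p| by rewrite [leRHS]prod_normE le_max lexx orbT.
have := ler_normD (k p - p.1 * (p.1 * rho p.1)) (p.1 * (p.1 * rho p.1)).
rewrite subrK; move: h1 h3.
have : e / 2 * `|p.1| <= e / 2 * `|p| by rewrite ler_wpM2l ?(ltW e20).
have : e / 2 * `|p.2| <= e / 2 * `|p| by rewrite ler_wpM2l ?(ltW e20).
have : e * `|p| = e / 2 * `|p| + e / 2 * `|p| by field.
lra.
Qed.

End ModelContact.

(** * Cuspidal edges on cylinders *)

Section Edges.
Context {R : realType}.
Implicit Types c : R -> R * R.

Definition cylinder_edge i j c :=
  A_equivalent (cylinder c) (0 : R * R) (cylinder (model_curve i j)) (0 : R * R).

(** The pairs for which the orders [i] and [j] can be read off the cylinder over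
    [(t^i, t^j)]. *)
Definition admissible i j := [&& (1 < i)%N, (i < j)%N, (j < 3 * i)%N & j != (2 * i)%N].

Lemma vanishing_expnM n (p : R -> R) : smooth_at p (0 : R) -> vanishing n (fun t => t ^+ n * p t).
Proof.
move=> ps; exists (`|p 0| + 1).
have /cvgrPdist_lt/(_ _ ltr01) := smooth_at_continuous ps.
apply: filterS => t pt; rewrite normrM normrX mulrC ler_wpM2r ?exprn_ge0//.
rewrite -[p t](subrK (p 0)) addrC; apply: le_trans (ler_normD _ _) _.
by rewrite lerD2l distrC ltW.
Qed.

Lemma vanishing_pair n (f g : R -> R) : vanishing n f -> vanishing n g ->
  vanishing n (fun t => (f t, g t)).
Proof.
move=> /vanishing_pos[C C0 fC] /vanishing_pos[D D0 gD]; exists (C + D).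
apply: filterS2 fC gD => t h1 h2; rewrite prod_normE /= ge_max mulrDl.
have : 0 <= C * `|t| ^+ n by rewrite mulr_ge0 ?exprn_ge0// ltW.
have : 0 <= D * `|t| ^+ n by rewrite mulr_ge0 ?exprn_ge0// ltW.
by move=> ? ?; apply/andP; split; lra.
Qed.

Lemma vanishing_fst n c : vanishing n c -> vanishing n (fun t => (c t).1).
Proof.
move=> [C cC]; exists C; apply: filterS cC => t; apply: le_trans.
by rewrite [leRHS]prod_normE le_max lexx.
Qed.

Definition shape i j (p q : R -> R) c :=
  [/\ smooth_at p (0 : R), smooth_at q (0 : R) & forall t, c t = (t ^+ i * p t, t ^+ j * q t)].

Lemma shape_smooth i j p q c : shape i j p q c -> smooth_at c (0 : R).
Proof.
by move=> [ps qs /funext ->]; smooth.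
Qed.

Lemma shape_vanishing i j n p q c : shape i j p q c -> (n <= i)%N -> (n <= j)%N -> vanishing n c.
Proof.
move=> [ps qs /funext ->] ni nj; apply: vanishing_pair.
  have := @vanishing_expnM n (fun t => t ^+ (i - n) * p t).
  rewrite (_ : (fun t => _ * (_ * _)) = fun t => t ^+ i * p t); first by apply; smooth.
  by apply/funext => t; rewrite mulrA -exprD subnKC.
have := @vanishing_expnM n (fun t => t ^+ (j - n) * q t).
rewrite (_ : (fun t => _ * (_ * _)) = fun t => t ^+ j * q t); first by apply; smooth.
by apply/funext => t; rewrite mulrA -exprD subnKC.
Qed.

Lemma shape_not_vanishing i j p q c : shape i j p q c -> p 0 != 0 -> ~ vanishing i.+1 c.
Proof.
move=> [ps qs /funext ->] p0 /vanishing_fst /= v.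
by move/eqP: p0; apply; exact: leading_coefficient (ltnSn i) (smooth_at_continuous ps) v.
Qed.

Lemma shape_succ i j p q c : shape i j p q c -> p 0 = 0 -> exists p', shape i.+1 j p' q c.
Proof.
move=> [ps qs cE] p0; have [p' [p's _ p'E]] := hadamard ps.
exists p'; split => // t; rewrite cE p'E p0 add0r exprSr; congr (_, _).
by rewrite mulrA.
Qed.

Lemma shape_model i j : shape i j (fun=> 1) (fun=> 1) (@model_curve R i j).
Proof. by split => [||t]; [smooth|smooth|rewrite !mulr1]. Qed.

(** The functions whose contact is tested below: the second coordinate, corrected
    by a multiple of the square of the first one. *)
Lemma not_littleo_parabola (ka : R) : ~ littleo_id (fun p : R * R => p.2 + ka * p.1 ^+ 2).
Proof.
move=> /(_ 2^-1); rewrite invr_gt0 => /(_ (ltr0Sn _ _)).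
have ac : {for 0, continuous (fun t : R => ((0, t) : R * R))}.
  by apply: cont_pair; [exact: cont_cst|exact: cont_id].
move=> /(near_comp_at (f := fun t : R => ((0, t) : R * R)) (x := 0) ac erefl).
move=> /near0_interval [e e0 /(_ (e / 2))] /=.
rewrite expr0n /= mulr0 addr0 prod_normE /= normr0 (max_r (normr_ge0 _)).
have e2 : 0 < e / 2 by rewrite divr_gt0.
move=> H; have : `|e / 2| <= 2^-1 * `|e / 2| by apply: H; apply/andP; split; lra.
by rewrite gtr0_norm//; lra.
Qed.

Section OneCurve.
Variable c : R -> R * R.
Hypotheses (cs : smooth_at c (0 : R)) (c2 : vanishing 2 c).

Let model_smooth i j : smooth_at (@model_curve R i j) (0 : R) := smooth_model_curve i j 0.

Let model_vanishing i j : (i < j)%N -> vanishing i (@model_curve R i j).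
Proof. by move=> ij; apply: (shape_vanishing (shape_model i j)) => //; exact: ltnW. Qed.

Let model_vanishing2 i j : admissible i j -> vanishing 2 (@model_curve R i j).
Proof.
move=> /and4P[i1 ij _ _]; apply: (shape_vanishing (shape_model i j)) => //.
by apply: leq_trans (ltnW ij).
Qed.

Let cylinder_continuous d : smooth_at d (0 : R) -> {for (0 : R * R), continuous (cylinder d)}.
Proof.
move=> ds; apply: cont_lift; first by apply: cont_fst; exact: cont_id.
apply: (@continuous_comp _ _ _ snd d); first exact: cvg_snd.
exact: smooth_at_continuous.
Qed.

Lemma edge_lower i j : admissible i j -> cylinder_edge i j c -> vanishing i c.
Proof.
move=> adm E; have := adm => /and4P[_ ij _ _].
apply: (vanishing_invariant (model_smooth i j) cs (model_vanishing2 adm) c2) (model_vanishing ij).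
by apply: A_equivalent_sym => //; exact: cylinder_continuous.
Qed.

Lemma edge_upper i j : admissible i j -> cylinder_edge i j c -> ~ vanishing i.+1 c.
Proof.
move=> adm E v; have := vanishing_invariant cs (model_smooth i j) c2 (model_vanishing2 adm) E v.
by apply: (shape_not_vanishing (shape_model i j)); exact: oner_neq0.
Qed.

Lemma edge_contact i j (h : R * R -> R) : admissible i j -> cylinder_edge i j c ->
  smooth_at h (0 : R * R) -> ~ littleo_id h -> ~ vanishing j.+1 (fun t => h (c t)).
Proof.
move=> adm E hs h1 v; have /and4P[i1 ij j3 j2] := adm.
have j0 : (0 < j)%N by apply: leq_ltn_trans ij.
rewrite -(prednK j0) in v.
have [k [ks k1 kv]] := contact_invariant cs (model_smooth i j) c2 (model_vanishing2 adm) E hs h1 v.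
rewrite (prednK j0) in kv; apply: k1; apply: (@model_contact _ i j) => //.
by rewrite ij andbT ltnW.
Qed.

(** The second coordinate has contact [j] with the monomial curve [(t^i, t^j)];
    the equivalence carries it to a function with contact at least [j] with the
    other monomial curve, whose contacts are at most [j']. *)
Lemma edge_unique i j i' j' : admissible i j -> admissible i' j' ->
  cylinder_edge i j c -> cylinder_edge i' j' c -> (j <= j')%N.
Proof.
move=> adm adm' E E'; rewrite leqNgt; apply/negP => jj.
have F1 := @finite_frame_field R; have F2 := finite_frame_prod F1 F1.
have F3 := finite_frame_prod F2 F1.
have Es := A_equivalent_sym (cylinder_continuous cs) E.
have EE := A_equivalent_trans F2 F2 F2 F3 F3 F3 Es E'.
have := adm => /and4P[i1 ij j3 j2]; have := adm' => /and4P[i1' ij' j3' j2'].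
have j0' : (0 < j')%N by apply: leq_ltn_trans ij'.
have hs : smooth_at (fun p : R * R => p.2 + 0 * p.1 ^+ 2) (0 : R * R) by smooth.
have v : vanishing j'.+1 (fun t : R => (model_curve i j t).2 + 0 * (model_curve i j t).1 ^+ 2).
  rewrite (_ : (fun t => _) = fun t => t ^+ j'.+1 * t ^+ (j - j'.+1)).
    by apply: vanishing_expnM; smooth.
  by apply/funext => t; rewrite mul0r addr0 -exprD subnKC.
rewrite -(prednK j0') in v.
have [k [ks k1 kv]] := contact_invariant (model_smooth i j) (model_smooth i' j')
  (model_vanishing2 adm) (model_vanishing2 adm') EE hs (@not_littleo_parabola 0) v.
rewrite (prednK j0') in kv; apply: k1; apply: (@model_contact _ i' j') => //.
by rewrite ij' andbT ltnW.
Qed.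

End OneCurve.

End Edges.

(** * Edges read off the leading terms of a curve *)

Section ShapeEdges.
Context {R : realType}.
Implicit Types c : R -> R * R.

Lemma shape_near_edge i j c p q : shape i j p q c ->
  (A_equivalent (fun t : R => (t ^+ i * p t, t ^+ j * q t)) (0 : R) (model_curve i j) (0 : R)) ->
  cylinder_edge i j c.
Proof. by move=> [_ _ /funext ->] E; exact: cylinder_equiv. Qed.

Lemma shape_edge23 p q c : shape 2 3 p q c -> p 0 != 0 -> q 0 != 0 -> cylinder_edge 2 3 c.
Proof.
move=> S p0 q0; apply: (shape_near_edge S); case: S => ps qs _.
exact: (cusp2_normal_form 1).
Qed.

Lemma shape_edge34 p q c : shape 3 4 p q c -> p 0 != 0 -> q 0 != 0 -> cylinder_edge 3 4 c.
Proof.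
by move=> S p0 q0; apply: (shape_near_edge S); case: S => ps qs _; exact: cusp34_normal_form.
Qed.

Lemma shape_edge35 p q c : shape 3 5 p q c -> p 0 != 0 -> q 0 != 0 -> cylinder_edge 3 5 c.
Proof.
by move=> S p0 q0; apply: (shape_near_edge S); case: S => ps qs _; exact: cusp35_normal_form.
Qed.

Lemma shape_edge25 ka p q c (z y : R -> R) : (forall t, c t = (z t, y t)) ->
  shape 2 5 p q (fun t => (z t, y t + ka * z t ^+ 2)) -> p 0 != 0 -> q 0 != 0 ->
  cylinder_edge 2 5 c.
Proof.
move=> /funext -> [ps qs cE] p0 q0; apply: cylinder_equiv.
apply: curve_equiv_trans (quadratic_shear_equiv ka z y) _.
by rewrite (funext cE); exact: (cusp2_normal_form 2).
Qed.

Lemma vanishing_snd_shape i j n p q c : shape i j p q c -> (n <= j)%N ->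
  vanishing n (fun t => (c t).2 + 0 * (c t).1 ^+ 2).
Proof.
move=> [ps qs cE] nj.
rewrite (_ : (fun t => _) = fun t => t ^+ n * (t ^+ (j - n) * q t)).
  by apply: vanishing_expnM; smooth.
by apply/funext => t; rewrite mul0r addr0 cE /= mulrA -exprD subnKC.
Qed.

Lemma shape_no_edge i j i' j' p q c : admissible i' j' -> shape i j p q c ->
  (1 < i)%N -> (1 < j)%N -> (j' < j)%N -> ~ cylinder_edge i' j' c.
Proof.
move=> adm S i1 j1 jj E.
apply: (edge_contact (shape_smooth S) (shape_vanishing S i1 j1) adm E _ (@not_littleo_parabola R 0)).
  by smooth.
exact: (vanishing_snd_shape S).
Qed.

End ShapeEdges.

(** * The three kinds of singular points on the axis *)

Section Cases.
Context {R : realType}.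
Variables (xi chi A B beta l : R -> R) (lambda : R).
Hypothesis xis : smooth_at xi (0 : R).
Hypotheses (As : smooth_at A (0 : R)) (Bs : smooth_at B (0 : R)).
Hypotheses (betas : smooth_at beta (0 : R)) (ls : smooth_at l (0 : R)).
Hypothesis xid : \forall t \near (0 : R), is_derive t (1 : R) xi (beta t * B t).
Hypothesis chid : \forall t \near (0 : R), is_derive t (1 : R) chi (beta t * A t).
Hypothesis Ad : \forall t \near (0 : R), is_derive t (1 : R) A (l t * B t).
Hypothesis Bd : \forall t \near (0 : R), is_derive t (1 : R) B (l t * A t).
Hypotheses (xi0 : xi 0 = 0) (chi0 : chi 0 = 0) (lambda0 : lambda != 0).
Hypothesis AB0 : A 0 ^+ 2 - B 0 ^+ 2 != 0.

Local Notation c := (polar_curve xi chi lambda).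

Lemma divide_once (f : R -> R) : smooth_at f (0 : R) -> f 0 = 0 ->
  exists g, [/\ smooth_at g (0 : R), g 0 = derive1 f 0 & forall t, f t = t * g t].
Proof.
move=> /hadamard [g [gs g0 gE]] f0; exists g; split => // t.
by rewrite gE f0 add0r.
Qed.

Lemma divide_derivative k (P f g : R -> R) : P 0 = 0 ->
  (\forall t \near (0 : R), is_derive t (1 : R) P (f t)) -> (forall t, f t = t ^+ k * g t) ->
  smooth_at g (0 : R) ->
  exists q, [/\ smooth_at q (0 : R), q 0 = g 0 / k.+1%:R & forall t, P t = t ^+ k.+1 * q t].
Proof.
by move=> P0 Pd fE gs; apply: smooth_divide => //; apply: filterS Pd => t; rewrite fE.
Qed.

(** The remainders [S] and [C] stay unknown: they always come multiplied by a
    power of [xi] that pushes them above the leading orders of the curve. *)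
Lemma trig_factors : exists S C : R -> R,
  [/\ smooth_at S (0 : R), smooth_at C (0 : R),
      (forall t, sin (xi t / lambda) = xi t * (lambda^-1 + xi t * S t)) &
      (forall t, cos (xi t / lambda) = 1 + xi t * C t)].
Proof.
have [s1 [s1s s10 s1E]] := hadamard (smooth_at_sin (0 : R)).
have [s2 [s2s _ s2E]] := hadamard s1s.
have [c1 [c1s _ c1E]] := hadamard (smooth_at_cos (0 : R)).
have s10' : s1 0 = 1 by rewrite s10 derive1E derive_val cos0.
have th : smooth_at (fun t => xi t / lambda) (0 : R) by smooth.
have th0 : xi 0 / lambda = 0 by rewrite xi0 mul0r.
exists (fun t => s2 (xi t / lambda) / lambda ^+ 2), (fun t => c1 (xi t / lambda) / lambda); split.
- apply: smooth_atM; last exact: smooth_at_cst.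
  by apply: (@smooth_at_comp1 _ _ (fun t => xi t / lambda)) => //; rewrite th0.
- apply: smooth_atM; last exact: smooth_at_cst.
  by apply: (@smooth_at_comp1 _ _ (fun t => xi t / lambda)) => //; rewrite th0.
- by move=> t; rewrite s1E s2E s10' sin0; field.
- by move=> t; rewrite c1E cos0; field.
Qed.

Lemma section_shape i k (x y : R -> R) : smooth_at x (0 : R) -> smooth_at y (0 : R) ->
  (forall t, chi t = t ^+ i * x t) -> (forall t, xi t = t ^+ k * y t) ->
  exists p q, [/\ shape i (i + k) p q c, p 0 = x 0 & q 0 = x 0 * y 0 / lambda].
Proof.
move=> xs ys chiE xiE; have [S [C [Ss Cs SE CE]]] := trig_factors.
exists (fun t => x t * (1 + xi t * C t)), (fun t => x t * y t * (lambda^-1 + xi t * S t)); split.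
- split; [by smooth|by smooth|] => t.
  by rewrite /polar_curve SE CE chiE exprD xiE; congr (_, _); ring.
- by rewrite xi0 mul0r addr0 mulr1.
- by rewrite xi0 mul0r addr0.
Qed.

Let B0_neq0 : A 0 = 0 -> B 0 != 0.
Proof. by move=> A0; apply: contraNneq AB0 => ->; rewrite A0 !expr0n /= subrr. Qed.

(** The radius [chi] has order at least 3 and the angle order at least 2, so the
    coordinates of [c] have orders at least 3 and 5. *)
Theorem edges_both_vanish : beta 0 = 0 -> A 0 = 0 ->
  [/\ cylinder_edge 3 5 c <-> derive1 beta 0 * l 0 != 0,
      ~ cylinder_edge 2 3 c, ~ cylinder_edge 2 5 c & ~ cylinder_edge 3 4 c].
Proof.
move=> beta0 A0; have B0 := B0_neq0 A0.
have [b1 [b1s b10 b1E]] := divide_once betas beta0.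
have [a1 [a1s a10 a1E]] : exists a1, [/\ smooth_at a1 (0 : R), a1 0 = l 0 * B 0 / 1 &
    forall t, A t = t ^+ 1 * a1 t].
  by apply: (divide_derivative (k := 0) A0 Ad (g := fun t => l t * B t)); [move=> t; rewrite mul1r|smooth].
have [x [xs x0 xE]] : exists x, [/\ smooth_at x (0 : R), x 0 = b1 0 * a1 0 / 3%:R &
    forall t, chi t = t ^+ 3 * x t].
  by apply: (divide_derivative (k := 2) chi0 chid (g := fun t => b1 t * a1 t));
    [move=> t; rewrite b1E a1E; ring|smooth].
have [y [ys y0 yE]] : exists y, [/\ smooth_at y (0 : R), y 0 = b1 0 * B 0 / 2%:R &
    forall t, xi t = t ^+ 2 * y t].
  by apply: (divide_derivative (k := 1) xi0 xid (g := fun t => b1 t * B t));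
    [move=> t; rewrite b1E; ring|smooth].
have [p [q [Sc p0 q0]]] := section_shape xs ys xE yE.
have cs := shape_smooth Sc.
have c3 : vanishing 3 c by exact: shape_vanishing Sc _ _.
have c2 : vanishing 2 c by exact: shape_vanishing Sc _ _.
split.
- rewrite -b10; split => [E|bl].
    apply/negP => /eqP bl; have x00 : p 0 = 0.
      by rewrite p0 x0 a10 -mulrA !mulrA bl !mul0r.
    have [p' Sc'] := shape_succ Sc x00.
    by apply: (edge_upper cs c2 (isT : admissible 3 5) E) => //; exact: shape_vanishing Sc' _ _.
  move: bl; rewrite mulf_eq0 negb_or => /andP[b0 l0].
  have x00 : x 0 != 0 by rewrite x0 a10 !mulf_neq0 ?invr_eq0 ?pnatr_eq0 ?oner_eq0.
  have y00 : y 0 != 0 by rewrite y0 !mulf_neq0 ?invr_eq0 ?pnatr_eq0.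
  by apply: (shape_edge35 Sc); rewrite ?p0 ?q0// !mulf_neq0// invr_eq0.
- by move=> E; exact: (edge_upper cs c2 (isT : admissible 2 3) E).
- by move=> E; exact: (edge_upper cs c2 (isT : admissible 2 5) E).
- exact: (shape_no_edge (i' := 3) (j' := 4) _ Sc).
Qed.

(** The angle has order exactly 1, and the radius [chi] has the order of [a]
    plus 1, that is the order of [l] plus 2; so the coordinates of [c] have
    consecutive orders. *)
Theorem edges_a_vanishes : beta 0 != 0 -> A 0 = 0 ->
  [/\ cylinder_edge 2 3 c <-> l 0 != 0,
      cylinder_edge 3 4 c <-> (l 0 = 0 /\ derive1 l 0 != 0),
      ~ cylinder_edge 2 5 c & ~ cylinder_edge 3 5 c].
Proof.
move=> beta0 A0; have B0 := B0_neq0 A0.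
have [a1 [a1s a10 a1E]] : exists a1, [/\ smooth_at a1 (0 : R), a1 0 = l 0 * B 0 / 1 &
    forall t, A t = t ^+ 1 * a1 t].
  by apply: (divide_derivative (k := 0) A0 Ad (g := fun t => l t * B t)); [move=> t; rewrite mul1r|smooth].
have [x [xs x0 xE]] : exists x, [/\ smooth_at x (0 : R), x 0 = beta 0 * a1 0 / 2%:R &
    forall t, chi t = t ^+ 2 * x t].
  by apply: (divide_derivative (k := 1) chi0 chid (g := fun t => beta t * a1 t));
    [move=> t; rewrite a1E; ring|smooth].
have [y [ys y0 yE]] : exists y, [/\ smooth_at y (0 : R), y 0 = beta 0 * B 0 / 1%:R &
    forall t, xi t = t ^+ 1 * y t].
  by apply: (divide_derivative (k := 0) xi0 xid (g := fun t => beta t * B t));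
    [move=> t; rewrite mul1r|smooth].
have [p [q [Sc p0 q0]]] := section_shape xs ys xE yE.
have y00 : y 0 != 0 by rewrite y0 divr1 mulf_neq0.
have cs := shape_smooth Sc.
have c2 : vanishing 2 c by exact: shape_vanishing Sc _ _.
have [l0|l0] := eqVneq (l 0) 0; last first.
  have x00 : x 0 != 0 by rewrite x0 a10 !mulf_neq0 ?invr_eq0 ?pnatr_eq0 ?oner_eq0.
  have p00 : p 0 != 0 by rewrite p0.
  have E23 : cylinder_edge 2 3 c.
    by apply: (shape_edge23 Sc) => //; rewrite q0 !mulf_neq0// invr_eq0.
  have n3 := shape_not_vanishing Sc p00.
  split.
  - by split.
  - by split=> [/(edge_lower cs c2 (isT : admissible 3 4))/n3|[/eqP]]; rewrite ?(negbTE l0).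
  - by move=> E; have := edge_unique cs (isT : admissible 2 5) (isT : admissible 2 3) E E23.
  - by move=> /(edge_lower cs c2 (isT : admissible 3 5))/n3.
have [l1 [l1s l10 l1E]] := divide_once ls l0.
have [a2 [a2s a20 a2E]] : exists a2, [/\ smooth_at a2 (0 : R), a2 0 = l1 0 * B 0 / 2%:R &
    forall t, A t = t ^+ 2 * a2 t].
  by apply: (divide_derivative (k := 1) A0 Ad (g := fun t => l1 t * B t)); [move=> t; rewrite l1E; ring|smooth].
have [x' [xs' x0' xE']] : exists x, [/\ smooth_at x (0 : R), x 0 = beta 0 * a2 0 / 3%:R &
    forall t, chi t = t ^+ 3 * x t].
  by apply: (divide_derivative (k := 2) chi0 chid (g := fun t => beta t * a2 t));
    [move=> t; rewrite a2E; ring|smooth].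
have [p' [q' [Sc' p0' q0']]] := section_shape xs' ys xE' yE.
have c3 : vanishing 3 c by exact: shape_vanishing Sc' _ _.
have not2 j : admissible 2 j -> ~ cylinder_edge 2 j c.
  by move=> adm E; exact: (edge_upper cs c2 adm E).
have [l1z|l1n] := eqVneq (l1 0) 0.
  have p'z : p' 0 = 0 by rewrite p0' x0' a20 l1z !(mul0r, mulr0).
  have [p'' Sc''] := shape_succ Sc' p'z.
  have c4 : vanishing 4 c by exact: shape_vanishing Sc'' _ _.
  have not3 j : admissible 3 j -> ~ cylinder_edge 3 j c.
    by move=> adm E; exact: (edge_upper cs c2 adm E).
  split; [split => [E|]|split => [E|[_]]|exact: not2|exact: not3].
  - by case: (not2 3 isT E).
  - by [].
  - by case: (not3 4 isT E).
  - by rewrite -l10 l1z eqxx.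
have x'n : x' 0 != 0 by rewrite x0' a20 !mulf_neq0 ?invr_eq0 ?pnatr_eq0.
have E34 : cylinder_edge 3 4 c.
  by apply: (shape_edge34 Sc'); rewrite ?p0'// q0' !mulf_neq0// invr_eq0.
split; [split => [E|]|split => // _|exact: not2|].
- by case: (not2 3 isT E).
- by [].
- by split => //; rewrite -l10.
- by move=> E; have := edge_unique cs (isT : admissible 3 5) (isT : admissible 3 4) E E34.
Qed.

(** Here radius and angle both have order at least 2, so the second coordinate
    has order at least 4.  With [k = b / a] at the point, [xi - k chi] has order
    at least 3, because [B - k A] vanishes at 0; so up to order 5 the second coordinate is
    the multiple [k / lambda] of the square of the first one plus the order 5
    term [chi (xi - k chi) / lambda], whose coefficient is proportional to
    [beta'^2 l (a^2 - b^2)]. *)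
Theorem edges_beta_vanishes : beta 0 = 0 -> A 0 != 0 ->
  [/\ cylinder_edge 2 5 c <-> derive1 beta 0 * l 0 != 0,
      ~ cylinder_edge 2 3 c, ~ cylinder_edge 3 4 c & ~ cylinder_edge 3 5 c].
Proof.
move=> beta0 A0.
have [b1 [b1s b10 b1E]] := divide_once betas beta0.
have [x [xs x0 xE]] : exists x, [/\ smooth_at x (0 : R), x 0 = b1 0 * A 0 / 2%:R &
    forall t, chi t = t ^+ 2 * x t].
  by apply: (divide_derivative (k := 1) chi0 chid (g := fun t => b1 t * A t));
    [move=> t; rewrite b1E; ring|smooth].
have [y [ys y0 yE]] : exists y, [/\ smooth_at y (0 : R), y 0 = b1 0 * B 0 / 2%:R &
    forall t, xi t = t ^+ 2 * y t].
  by apply: (divide_derivative (k := 1) xi0 xid (g := fun t => b1 t * B t));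
    [move=> t; rewrite b1E; ring|smooth].
have [p [q [Sc p0 q0]]] := section_shape xs ys xE yE.
have cs := shape_smooth Sc.
have c2 : vanishing 2 c by exact: shape_vanishing Sc _ _.
have not23 : ~ cylinder_edge 2 3 c by exact: (shape_no_edge (i' := 2) (j' := 3) _ Sc).
pose k := B 0 / A 0.
have G0 : B 0 - k * A 0 = 0 by rewrite /k divfK// subrr.
have Gd : \forall t \near (0 : R), is_derive t (1 : R) (fun t => B t - k * A t) (l t * (A t - k * B t)).
  apply: filterS2 Ad Bd => t Adt Bdt.
  have H := is_deriveB Bdt (is_deriveZ k Adt).
  rewrite (_ : (fun t => _) = B - k *: A); last by apply/funext => s; rewrite !fctE.
  by apply: (is_derive_eq H); rewrite /GRing.scale /=; ring.
have [e [es e0 eE]] : exists e, [/\ smooth_at e (0 : R), e 0 = l 0 * (A 0 - k * B 0) / 1%:R &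
    forall t, B t - k * A t = t ^+ 1 * e t].
  by apply: (divide_derivative (k := 0) G0 Gd (g := fun t => l t * (A t - k * B t)));
    [move=> t; rewrite mul1r|smooth].
have eta0 : xi 0 - k * chi 0 = 0 by rewrite xi0 chi0 mulr0 subrr.
have etad : \forall t \near (0 : R), is_derive t (1 : R) (fun t => xi t - k * chi t) (beta t * (B t - k * A t)).
  apply: filterS2 xid chid => t xidt chidt.
  have H := is_deriveB xidt (is_deriveZ k chidt).
  rewrite (_ : (fun t => _) = xi - k *: chi); last by apply/funext => s; rewrite !fctE.
  by apply: (is_derive_eq H); rewrite /GRing.scale /=; ring.
have [n [ns n0 nE]] : exists n, [/\ smooth_at n (0 : R), n 0 = b1 0 * e 0 / 3%:R &
    forall t, xi t - k * chi t = t ^+ 3 * n t].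
  by apply: (divide_derivative (k := 2) eta0 etad (g := fun t => b1 t * e t));
    [move=> t; rewrite b1E eE; ring|smooth].
have [S [C [Ss Cs SE CE]]] := trig_factors.
pose ka := - (k / lambda).
pose qh t := x t * (n t / lambda + t * (y t ^+ 2 * S t
  + ka * x t * (2 * y t * C t + t ^+ 2 * y t ^+ 2 * C t ^+ 2))).
have qhs : smooth_at qh (0 : R) by rewrite /qh; smooth.
have qh0 : qh 0 = x 0 * n 0 / lambda by rewrite /qh mul0r addr0 mulrA.
pose z t := chi t * cos (xi t / lambda); pose w t := chi t * sin (xi t / lambda).
have zE t : z t = t ^+ 2 * (x t * (1 + xi t * C t)) by rewrite /z CE xE; ring.
have Sh : shape 2 5 (fun t => x t * (1 + xi t * C t)) qh (fun t => (z t, w t + ka * z t ^+ 2)).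
  split; [by smooth|exact: qhs|] => t; congr (_, _); first exact: zE.
  have xin : xi t = k * (t ^+ 2 * x t) + t ^+ 3 * n t by rewrite -nE -xE; ring.
  rewrite /w /z SE CE xE.
  have -> : t ^+ 2 * x t * (xi t * (lambda^-1 + xi t * S t)) =
    t ^+ 2 * x t * (xi t / lambda + xi t ^+ 2 * S t) by ring.
  rewrite {1}xin yE /qh /ka; ring.
have xn : b1 0 != 0 -> x 0 != 0.
  by move=> b0; rewrite x0 !mulf_neq0 ?invr_eq0 ?pnatr_eq0.
have hs : smooth_at (fun p : R * R => p.2 + ka * p.1 ^+ 2) (0 : R * R) by smooth.
have eZ : A 0 - k * B 0 = (A 0 ^+ 2 - B 0 ^+ 2) / A 0 by rewrite /k; field.
have [b0|b0] := eqVneq (b1 0) 0.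
  have xz : x 0 = 0 by rewrite x0 b0 !mul0r.
  have yz : y 0 = 0 by rewrite y0 b0 !mul0r.
  have [x' [xs' _ xE']] := divide_once xs xz; have [y' [ys' _ yE']] := divide_once ys yz.
  have [p' [q' [Sc' _ _]]] := @section_shape 3 3 _ _ xs' ys'
    (fun t => ltac:(by rewrite xE xE'; ring)) (fun t => ltac:(by rewrite yE yE'; ring)).
  have c3 : vanishing 3 c by exact: shape_vanishing Sc' _ _.
  split => //.
  - rewrite -b10 b0 mul0r eqxx; split => // E.
    by have := edge_upper cs c2 (isT : admissible 2 5) E c3.
  - exact: (shape_no_edge (i' := 3) (j' := 4) _ Sc').
  - exact: (shape_no_edge (i' := 3) (j' := 5) _ Sc').
have p00 : p 0 != 0 by rewrite p0 xn.
have n3 := shape_not_vanishing Sc p00.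
split => //.
- rewrite -b10; split => [E|].
    rewrite mulf_neq0//; apply/negP => /eqP l0.
    have qz : qh 0 = 0 by rewrite qh0 n0 e0 l0 !(mul0r, mulr0).
    have [q6 [q6s _ q6E]] := divide_once qhs qz.
    apply: (edge_contact cs c2 (isT : admissible 2 5) E hs (@not_littleo_parabola R ka)).
    case: Sh => _ _ ShE.
    rewrite (_ : (fun t => _) = fun t => t ^+ 6 * q6 t); first exact: vanishing_expnM.
    apply/funext => t; have := congr1 snd (ShE t); rewrite /z /w /polar_curve /= => ->.
    by rewrite q6E; ring.
  rewrite mulf_eq0 negb_or => /andP[_ l0].
  apply: (@shape_edge25 _ ka _ _ c z w) Sh _ _ => //.
    by rewrite xi0 mul0r addr0 mulr1 xn.
  by rewrite qh0 n0 e0 eZ !mulf_neq0 ?invr_eq0 ?pnatr_eq0 ?oner_eq0 ?xn.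
- by move=> /(edge_lower cs c2 (isT : admissible 3 4))/n3.
- by move=> /(edge_lower cs c2 (isT : admissible 3 5))/n3.
Qed.

End Cases.

(** * Legendre curves in the Lorentzian plane *)

Section LegendreData.
Context {R : realType}.

Lemma helicoidal_edge (lambda : R) (gamma : R -> R * R) (u0 v : R) i j :
  lambda != 0 -> smooth_at gamma u0 ->
  cuspidal_edge i j (helicoidal1 lambda gamma) (u0, v) <->
  cylinder_edge i j (section_curve lambda gamma u0).
Proof.
move=> l0 gs.
have F1 := @finite_frame_field R; have F2 := finite_frame_prod F1 F1.
have F3 := finite_frame_prod F2 F1.
have E := helicoidal_cylinder v l0 gs.
have hc : {for ((u0, v) : R * R), continuous (helicoidal1 lambda gamma)}.
  apply: smooth_at_continuous; rewrite /helicoidal1.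
  have g1 : smooth_at (fun p : R * R => gamma p.1) ((u0, v) : R * R).
    by apply: (@smooth_at_comp _ _ _ _ fst gamma) => //; smooth.
  have tr : smooth_at (fun p : R * R => sin p.2) ((u0, v) : R * R) /\
      smooth_at (fun p : R * R => cos p.2) ((u0, v) : R * R).
    by split; [apply: (@smooth_at_comp1 _ _ snd sin)|apply: (@smooth_at_comp1 _ _ snd cos)];
      smooth; [exact: smooth_at_sin|exact: smooth_at_cos].
  by case: tr => ? ?; smooth.
split => H.
  exact: (A_equivalent_trans F2 F2 F2 F3 F3 F3 (A_equivalent_sym hc E) H).
exact: (A_equivalent_trans F2 F2 F2 F3 F3 F3 E H).
Qed.

Lemma derive1_fst (f : R -> R * R) u : smooth_at f u ->
  derive1 (fun u => (f u).1) u = (derive1 f u).1.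
Proof.
move=> /smooth_at_differentiable fd; rewrite !derive1E.
have cf : continuous (@fst R R) by move=> y; exact: cvg_fst.
have sd : differentiable (fst : R * R -> R) (f u) by exact: linear_differentiable.
by rewrite (derive_comp _ fd sd) (deriveE _ sd) (diff_lin _ cf).
Qed.

Lemma derive1_snd (f : R -> R * R) u : smooth_at f u ->
  derive1 (fun u => (f u).2) u = (derive1 f u).2.
Proof.
move=> /smooth_at_differentiable fd; rewrite !derive1E.
have cf : continuous (@snd R R) by move=> y; exact: cvg_snd.
have sd : differentiable (snd : R * R -> R) (f u) by exact: linear_differentiable.
by rewrite (derive_comp _ fd sd) (deriveE _ sd) (diff_lin _ cf).
Qed.

Lemma frenet_coefficients (a b x y : R) : (a ^+ 2 - b ^+ 2) ^+ 2 = 1 -> x * a = y * b ->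
  x = (a ^+ 2 - b ^+ 2) * (- x * b + y * a) * b /\
  y = (a ^+ 2 - b ^+ 2) * (- x * b + y * a) * a.
Proof.
set d := a ^+ 2 - b ^+ 2 => d1 xy; split.
- have -> : d * (- x * b + y * a) * b = d * (- x * b ^+ 2 + (y * b) * a) by ring.
  by rewrite -xy -[LHS]mul1r -d1 /d; ring.
- have -> : d * (- x * b + y * a) * a = d * (- (x * a) * b + y * a ^+ 2) by ring.
  by rewrite xy -[LHS]mul1r -d1 /d; ring.
Qed.

Lemma frenet_coefficients_dual (a b x y : R) : (a ^+ 2 - b ^+ 2) ^+ 2 = 1 -> a * x = b * y ->
  x = (a ^+ 2 - b ^+ 2) * (- x * b + y * a) * b /\
  y = (a ^+ 2 - b ^+ 2) * (- x * b + y * a) * a.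
Proof. by move=> d1; rewrite mulrC (mulrC b); exact: frenet_coefficients. Qed.

Lemma curvature_betaE (gamma nu : R -> R * R) u : curvature_beta gamma nu u =
  ((nu u).1 ^+ 2 - (nu u).2 ^+ 2) *
  (- (gamma^`() u).1 * (nu u).2 + (gamma^`() u).2 * (nu u).1).
Proof. reflexivity. Qed.

Lemma curvature_lE (nu : R -> R * R) u : curvature_l nu u =
  ((nu u).1 ^+ 2 - (nu u).2 ^+ 2) *
  (- (nu^`() u).1 * (nu u).2 + (nu^`() u).2 * (nu u).1).
Proof. reflexivity. Qed.

(** Orthogonality makes [gamma'] a multiple of [(b, a)]; and as
    [(a^2 - b^2)^2 = 1] near the point, [a a' = b b'], which makes [nu'] a
    multiple of [(b, a)] as well. *)
Lemma legendre_frenet (I : set R) (gamma nu : R -> R * R) u :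
  nonlightlike_legendre I gamma nu -> I° u ->
  let a := (nu u).1 in let b := (nu u).2 in
  let beta := curvature_beta gamma nu u in let l := curvature_l nu u in
  [/\ (a ^+ 2 - b ^+ 2) != 0,
      is_derive u (1 : R) (fun u => (gamma u).1) (beta * b) /\
      is_derive u (1 : R) (fun u => (gamma u).2) (beta * a),
      is_derive u (1 : R) (fun u => (nu u).1) (l * b) &
      is_derive u (1 : R) (fun u => (nu u).2) (l * a)].
Proof.
move=> [sm De orth] Iu a b beta l.
have Iu' := interior_subset Iu.
have gns := sm _ Iu'.
have gs : smooth_at gamma u by have := smooth_at_fst gns.
have ns : smooth_at nu u by have := smooth_at_snd gns.
have g1 : is_derive u (1 : R) (fun u => (gamma u).1) (gamma^`() u).1.
  by rewrite -derive1_fst//; apply: smooth_at_is_derive; smooth.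
have g2 : is_derive u (1 : R) (fun u => (gamma u).2) (gamma^`() u).2.
  by rewrite -derive1_snd//; apply: smooth_at_is_derive; smooth.
have n1 : is_derive u (1 : R) (fun u => (nu u).1) (nu^`() u).1.
  by rewrite -derive1_fst//; apply: smooth_at_is_derive; smooth.
have n2 : is_derive u (1 : R) (fun u => (nu u).2) (nu^`() u).2.
  by rewrite -derive1_snd//; apply: smooth_at_is_derive; smooth.
have sq w : I w -> (delta nu w) ^+ 2 = 1.
  move=> /De; rewrite /Delta /delta /pseudo_inner /= => -[]h.
    have -> : (nu w).1 ^+ 2 - (nu w).2 ^+ 2 = - 1 by rewrite -h; ring.
    by ring.
  have -> : (nu w).1 ^+ 2 - (nu w).2 ^+ 2 = 1 by rewrite -[RHS]opprK -h; ring.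
  by ring.
have sqE : (a ^+ 2 - b ^+ 2) ^+ 2 = 1 by exact: sq.
have d0 : a ^+ 2 - b ^+ 2 != 0.
  by apply: contraTneq (oner_neq0 R) => h; rewrite -sqE h expr0n eqxx.
have ab : a * (nu^`() u).1 = b * (nu^`() u).2.
  have H := is_deriveX 2 (is_deriveB (is_deriveX 2 n1) (is_deriveX 2 n2)).
  have H' : is_derive u (1 : R) (((fun u => (nu u).1) ^+ 2 - (fun u => (nu u).2) ^+ 2) ^+ 2) 0.
    apply: (near_eq_is_derive _ (is_derive_cst (1 : R) u (1 : R))).
    have : \forall w \near u, I w by exact: Iu.
    by apply: filterS => w /sq; rewrite /delta !fctE.
  have := @derive_val _ _ _ _ _ _ _ H; rewrite (@derive_val _ _ _ _ _ _ _ H') !fctE -/a -/b.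
  rewrite /GRing.scale /= !expr1 => /esym e.
  apply/eqP; rewrite -subr_eq0; apply/eqP; apply: (mulfI d0); rewrite mulr0.
  apply: (@mulfI _ (4 : R)); first by rewrite pnatr_eq0.
  by rewrite mulr0 -[RHS]e; ring.
have orthu : (gamma^`() u).1 * a = (gamma^`() u).2 * b.
  by have := orth _ Iu'; rewrite /pseudo_inner -/a -/b mulNr addrC => /eqP; rewrite subr_eq0 => /eqP.
have [e1 e2] := frenet_coefficients sqE orthu.
have [e3 e4] := frenet_coefficients_dual sqE ab.
have betaE : curvature_beta gamma nu u =
    (a ^+ 2 - b ^+ 2) * (- (gamma^`() u).1 * b + (gamma^`() u).2 * a) by exact: curvature_betaE.
have lE : curvature_l nu u =
    (a ^+ 2 - b ^+ 2) * (- (nu^`() u).1 * b + (nu^`() u).2 * a) by exact: curvature_lE.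
rewrite /beta /l betaE lE; split.
- exact: d0.
- by split; [exact: (is_derive_eq g1 e1)|exact: (is_derive_eq g2 e2)].
- exact: (is_derive_eq n1 e3).
- exact: (is_derive_eq n2 e4).
Qed.

Lemma smooth_curvatures (gamma nu : R -> R * R) u : smooth_at gamma u -> smooth_at nu u ->
  smooth_at (curvature_beta gamma nu) u /\ smooth_at (curvature_l nu) u.
Proof.
move=> gs ns.
have d1 (f : R -> R * R) : smooth_at f u -> smooth_at f^`() u.
  move=> fs; rewrite (_ : f^`() = 'D_1 f); first exact: smooth_at_derive.
  by apply/funext => y; rewrite derive1E.
have dg := d1 _ gs; have dn := d1 _ ns.
have ds : smooth_at (delta nu) u by rewrite /delta; smooth.
have nu1 : smooth_at (fun u => (nu u).1) u by smooth.
have nu2 : smooth_at (fun u => (nu u).2) u by smooth.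
have inner (f : R -> R * R) : smooth_at f u -> smooth_at (fun u => pseudo_inner (f u) (mu nu u)) u.
  move=> fs; rewrite /pseudo_inner /mu /=.
  apply: smooth_atD; apply: smooth_atM => //; last exact: smooth_at_snd.
  by apply: smooth_atN; exact: smooth_at_fst.
by split; [exact: (smooth_atM ds (inner _ dg))|exact: (smooth_atM ds (inner _ dn))].
Qed.

Lemma is_derive_translate (f : R -> R) u0 t d : is_derive (u0 + t) (1 : R) f d ->
  is_derive t (1 : R) (fun t => f (u0 + t)) d.
Proof.
move=> fd; have H : is_derive t (1 : R) (fun t => u0 + t) 1.
  rewrite -[X in is_derive _ _ _ X]add0r.
  exact: (is_deriveD (is_derive_cst u0 t (1 : R)) (is_derive_id t (1 : R))).
by have := @is_derive1_comp _ f (fun t => u0 + t) t _ _ fd H; rewrite mulr1.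
Qed.

Lemma smooth_translate (V : normedModType R) (f : R -> V) (u0 : R) : finite_frame V ->
  smooth_at f u0 -> smooth_at (fun t => f (u0 + t)) (0 : R).
Proof.
move=> FV fs; apply: (@smooth_at_comp _ _ _ _ (fun t => u0 + t) f) => //.
- exact: finite_frame_field.
- by smooth.
- by rewrite addr0.
Qed.

Lemma derive1_translate (f : R -> R) u0 : smooth_at f u0 ->
  derive1 (fun t => f (u0 + t)) 0 = derive1 f u0.
Proof.
move=> fs; have fd := smooth_at_is_derive fs.
have fd' : is_derive (0 : R) (1 : R) (fun t => f (u0 + t)) (derive1 f u0).
  by apply: is_derive_translate; rewrite addr0.
by rewrite derive1E (@derive_val _ _ _ _ _ _ _ fd').
Qed.

(** A translation of the parameter to 0 reduces this to the three cases; of the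
    Legendre curve only the Frenet equations remain. *)
Theorem helicoidal_edges (gamma nu : R -> R * R) (beta l : R -> R) (lambda u0 v : R) :
  let edge i j := cuspidal_edge i j (helicoidal1 lambda gamma) (u0, v) in
  smooth_at gamma u0 -> smooth_at nu u0 -> smooth_at beta u0 -> smooth_at l u0 ->
  lambda != 0 -> (gamma u0).2 = 0 -> (nu u0).1 ^+ 2 - (nu u0).2 ^+ 2 != 0 ->
  (\forall u \near u0,
    [/\ is_derive u (1 : R) (fun u => (gamma u).1) (beta u * (nu u).2),
        is_derive u (1 : R) (fun u => (gamma u).2) (beta u * (nu u).1),
        is_derive u (1 : R) (fun u => (nu u).1) (l u * (nu u).2) &
        is_derive u (1 : R) (fun u => (nu u).2) (l u * (nu u).1)]) ->
  [/\ beta u0 = 0 -> (nu u0).1 = 0 ->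
        [/\ edge 3 5 <-> derive1 beta u0 * l u0 != 0, ~ edge 2 3, ~ edge 2 5 & ~ edge 3 4],
      beta u0 = 0 -> (nu u0).1 != 0 ->
        [/\ edge 2 5 <-> derive1 beta u0 * l u0 != 0, ~ edge 2 3, ~ edge 3 4 & ~ edge 3 5] &
      beta u0 != 0 -> (nu u0).1 = 0 ->
        [/\ edge 2 3 <-> l u0 != 0, edge 3 4 <-> (l u0 = 0 /\ derive1 l u0 != 0),
            ~ edge 2 5 & ~ edge 3 5]].
Proof.
move=> edge gs ns betas ls lambda0 x20 AB0 frenet.
have F1 := @finite_frame_field R.
pose xi t := (gamma (u0 + t)).1 - (gamma u0).1.
pose chi t := (gamma (u0 + t)).2.
pose A t := (nu (u0 + t)).1; pose B t := (nu (u0 + t)).2.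
pose be t := beta (u0 + t); pose L t := l (u0 + t).
have xis : smooth_at xi (0 : R).
  by apply: smooth_atB; [apply: (@smooth_translate _ (fun u => (gamma u).1)) => //; smooth|smooth].
have As : smooth_at A (0 : R).
  by apply: (@smooth_translate _ (fun u => (nu u).1)) => //; smooth.
have Bs : smooth_at B (0 : R).
  by apply: (@smooth_translate _ (fun u => (nu u).2)) => //; smooth.
have bes : smooth_at be (0 : R) by exact: (smooth_translate F1 betas).
have Ls : smooth_at L (0 : R) by exact: (smooth_translate F1 ls).
have frenet0 : \forall t \near (0 : R),
  [/\ is_derive t (1 : R) xi (be t * B t), is_derive t (1 : R) chi (be t * A t),
      is_derive t (1 : R) A (L t * B t) & is_derive t (1 : R) B (L t * A t)].
  have tc : {for 0, continuous (fun t : R => u0 + t)} by apply: smooth_at_continuous; smooth.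
  apply: filterS (near_comp_at tc (addr0 u0) frenet) => t [d1 d2 d3 d4]; split.
  - have H := is_deriveB (is_derive_translate d1) (is_derive_cst (gamma u0).1 t (1 : R)).
    by apply: (is_derive_eq H); rewrite subr0.
  - exact: (is_derive_translate d2).
  - exact: (is_derive_translate d3).
  - exact: (is_derive_translate d4).
have d1 : \forall t \near (0 : R), is_derive t (1 : R) xi (be t * B t).
  by apply: filterS frenet0 => t [].
have d2 : \forall t \near (0 : R), is_derive t (1 : R) chi (be t * A t).
  by apply: filterS frenet0 => t [].
have d3 : \forall t \near (0 : R), is_derive t (1 : R) A (L t * B t).
  by apply: filterS frenet0 => t [].
have d4 : \forall t \near (0 : R), is_derive t (1 : R) B (L t * A t).
  by apply: filterS frenet0 => t [].
have xi0 : xi 0 = 0 by rewrite /xi addr0 subrr.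
have chi0 : chi 0 = 0 by rewrite /chi addr0.
have AB00 : A 0 ^+ 2 - B 0 ^+ 2 != 0 by rewrite /A /B addr0.
have be0 : be 0 = beta u0 by rewrite /be addr0.
have L0 : L 0 = l u0 by rewrite /L addr0.
have A0 : A 0 = (nu u0).1 by rewrite /A addr0.
have be1 : derive1 be 0 = derive1 beta u0 by exact: derive1_translate.
have L1 : derive1 L 0 = derive1 l u0 by exact: derive1_translate.
have edgeE i j : edge i j <-> cylinder_edge i j (polar_curve xi chi lambda).
  exact: helicoidal_edge.
rewrite -be1 -L1 -be0 -L0 -A0; split => b0 a0.
- have [h1 h2 h3 h4] := edges_both_vanish xis Bs bes Ls d1 d2 d3 xi0 chi0 lambda0 AB00 b0 a0.
  by split; [apply: iff_trans h1|move/edgeE|move/edgeE|move/edgeE].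
- have [h1 h2 h3 h4] := edges_beta_vanishes xis As Bs bes Ls d1 d2 d3 d4 xi0 chi0 lambda0 AB00 b0 a0.
  by split; [apply: iff_trans h1|move/edgeE|move/edgeE|move/edgeE].
- have [h1 h2 h3 h4] := edges_a_vanishes xis Bs bes Ls d1 d2 d3 xi0 chi0 lambda0 AB00 b0 a0.
  by split; [apply: iff_trans h1|apply: iff_trans h2|move/edgeE|move/edgeE].
Qed.

End LegendreData.

Unset Implicit Arguments.

Theorem theorem4p3 (R : realType) (I : set R) (gamma nu : R -> R * R)
    (lambda u0 v0 : R) :
  let a := fun u => (nu u).1 in
  let x2 := fun u => (gamma u).2 in
  let l := curvature_l nu in
  let beta := curvature_beta gamma nu in
  let l' := l^`() in
  let beta' := beta^`() in
  let r1 := helicoidal1 lambda gamma in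
  is_interval I ->
  nonlightlike_legendre I gamma nu ->
  lambda != 0 ->
  I° u0 ->
  singular_point r1 (u0, v0) ->
  x2 u0 = 0 ->
  [/\
      beta u0 = 0 -> a u0 = 0 -> forall v : R,
        [/\ cuspidal_edge 3 5 r1 (u0, v) <-> beta' u0 * l u0 != 0,
            ~ cuspidal_edge 2 3 r1 (u0, v),
            ~ cuspidal_edge 2 5 r1 (u0, v) &
            ~ cuspidal_edge 3 4 r1 (u0, v)],
      beta u0 = 0 -> a u0 <> 0 -> forall v : R,
        [/\ cuspidal_edge 2 5 r1 (u0, v) <-> beta' u0 * l u0 != 0,
            ~ cuspidal_edge 2 3 r1 (u0, v),
            ~ cuspidal_edge 3 4 r1 (u0, v) &
            ~ cuspidal_edge 3 5 r1 (u0, v)] &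
      beta u0 <> 0 -> a u0 = 0 -> forall v : R,
        [/\ cuspidal_edge 2 3 r1 (u0, v) <-> l u0 != 0,
            cuspidal_edge 3 4 r1 (u0, v) <-> (l u0 = 0 /\ l' u0 != 0),
            ~ cuspidal_edge 2 5 r1 (u0, v) &
            ~ cuspidal_edge 3 5 r1 (u0, v)]].
Proof.
move=> a x2 l beta l' beta' r1 _ leg lambda0 Iu0 _ x20.
have gns : smooth_at (fun u => (gamma u, nu u)) u0.
  by case: leg => sm _ _; exact: sm _ (interior_subset Iu0).
have gs : smooth_at gamma u0 by have := smooth_at_fst gns.
have ns : smooth_at nu u0 by have := smooth_at_snd gns.
have [betas ls] := smooth_curvatures gs ns.
have [AB0 _ _ _] := legendre_frenet leg Iu0.
have near_int : \forall u \near u0, I° u by exact: nbhs_interior.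
have frenet : \forall u \near u0,
    [/\ is_derive u (1 : R) (fun u => (gamma u).1) (beta u * (nu u).2),
        is_derive u (1 : R) (fun u => (gamma u).2) (beta u * (nu u).1),
        is_derive u (1 : R) (fun u => (nu u).1) (l u * (nu u).2) &
        is_derive u (1 : R) (fun u => (nu u).2) (l u * (nu u).1)].
  apply: filterS near_int => u Iu; case: (legendre_frenet leg Iu) => _ [d1 d2] d3 d4.
  by split; [exact: d1|exact: d2|exact: d3|exact: d4].
split=> b0 a0 v.
- by have [H _ _] := helicoidal_edges v gs ns betas ls lambda0 x20 AB0 frenet; exact: H.
- have [_ H _] := helicoidal_edges v gs ns betas ls lambda0 x20 AB0 frenet; apply: H => //.
  exact/eqP.
- have [_ _ H] := helicoidal_edges v gs ns betas ls lambda0 x20 AB0 frenet; apply: H => //.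
  exact/eqP.
Qed.
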